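(* For each $n\ge1$ let $\pi=\pi^{(n)}$ be chosen uniformly at random among the increasing parking functions of size $n$. Then the convergence $$\left(\sqrt{\tfrac n2}\,\bigl(F_\pi(x)-x\bigr)\right)_{0\le x\le1}\xrightarrow[n\to\infty]{}\mathbb e$$ holds in distribution for the uniform norm, where $\mathbb e$ is the normalised Brownian excursion on $[0,1]$.
   Context: A parking function of size $n$ is a sequence $\pi=(\pi_1,\dots,\pi_n)$ of elements of $\{1,\dots,n\}$ such that $\#\{i:\pi_i\le k\}\ge k$ for every $k\in\{1,\dots,n\}$. It is increasing if $\pi_1\le\pi_2\le\dots\le\pi_n$. For a parking function $\pi$ of size $n$ and $x\in[0,1]$, $F_\pi(x):=\frac1n\#\{i:\pi_i\le nx\}$. The normalised Brownian excursion $\mathbb e$ is, informally, standard Brownian motion conditioned to be positive on $(0,1)$ and to return to $0$ at time $1$ (rigorously, for instance, the excursion away from $0$ of a standard Brownian motion straddling time 1, taken in absolute value and rescaled to have duration 1). *)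

(* Defs.v *)
From HB Require Import structures.
From mathcomp Require Export all_boot all_order all_algebra.
From mathcomp Require Export all_classical all_reals all_analysis.
Export numFieldNormedType.Exports.
Set Implicit Arguments.
Unset Strict Implicit.
Unset Printing Implicit Defensive.
Import Order.TTheory GRing.Theory Num.Theory.

Local Open Scope classical_set_scope.
Local Open Scope ring_scope.

(* A sequence of elements of {1, ..., n} is a tuple over 'I_n.+1 = {0, ..., n}
   whose entries are positive. *)
Definition parking_function (n : nat) (p : n.-tuple 'I_n.+1) : bool :=
  [forall i, (0 < tnth p i)%N] &&
  [forall k : 'I_n.+1, (0 < k)%N ==> (k <= #|[pred i | (tnth p i <= k)%N]|)%N].

Definition increasing_parking_functions (n : nat) : {set n.-tuple 'I_n.+1} :=
  [set p | parking_function p &&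
    [forall i : 'I_n, forall j : 'I_n,
       (i <= j)%N ==> (tnth p i <= tnth p j)%N]].

Definition parking_cdf (R : realType) (n : nat) (p : n.-tuple 'I_n.+1) (x : R)
  : R := #|[pred i | (tnth p i)%:R <= n%:R * x]|%:R / n%:R.

Definition parking_process (R : realType) (n : nat) (p : n.-tuple 'I_n.+1)
  (x : R) : R := Num.sqrt (n%:R / 2) * (parking_cdf p x - x).

Definition uniform_law d (T : measurableType d) (R : realType)
    (P : probability T R) (S : finType) (A : {set S}) (X : T -> S) : Prop :=
  forall s : S, measurable (X @^-1` [set s]) /\
    P (X @^-1` [set s]) = (if s \in A then (#|A|%:R^-1)%:E else 0%E).

(* The sets A i may be taken to be setT, so the product rule for every
   subfamily is included. *)
Definition mutually_independent d (T : measurableType d) (R : realType)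
    (P : probability T R) (k : nat) (X : 'I_k -> T -> R) : Prop :=
  forall A : 'I_k -> set R, (forall i, measurable (A i)) ->
    P (\bigcap_(i in [set: 'I_k]) (X i @^-1` A i)) =
    (\prod_(i < k) P (X i @^-1` A i))%E.

(* Only the times t >= 0 are constrained; B t for t < 0 is irrelevant.  The
   second argument of normal_prob is the standard deviation. *)
Definition standard_brownian_motion d (T : measurableType d) (R : realType)
    (P : probability T R) (B : R -> {RV P >-> R}) : Prop :=
  [/\ forall w, B 0 w = 0,
      forall w, {within `[0, +oo[, continuous (fun t => B t w)},
      forall s t : R, 0 <= s -> s < t ->
        forall A : set R, measurable A ->
          P ((fun w => B t w - B s w) @^-1` A)
            = normal_prob 0 (Num.sqrt (t - s)) A &
      forall (k : nat) (t : nat -> R), 0 <= t 0%N ->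
        {homo t : i j / (i <= j)%N >-> i <= j} ->
        mutually_independent P
          (fun (i : 'I_k) w => B (t i.+1) w - B (t i) w)].

Definition last_zero_before1 (R : realType) (f : R -> R) : R :=
  sup [set t | 0 <= t <= 1 /\ f t = 0].

Definition first_zero_after1 (R : realType) (f : R -> R) : R :=
  inf [set t | 1 <= t /\ f t = 0].

(* The excursion of f away from 0 straddling time 1, in absolute value and
   rescaled to have duration 1.  For Brownian paths this is meaningful on the
   almost sure event that f has a zero after time 1 and f 1 <> 0. *)
Definition straddling_excursion (R : realType) (f : R -> R) (x : R) : R :=
  let g := last_zero_before1 f in
  let d := first_zero_after1 f in
  `|f (g + x * (d - g))| / Num.sqrt (d - g).

Definition brownian_excursion d (T : measurableType d) (R : realType)
    (P : probability T R) (B : R -> {RV P >-> R}) (w : T) : R -> R :=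
  straddling_excursion (fun t => B t w).

(* Weak convergence, tested on bounded continuous functions; the random
   elements may be defined on different probability spaces. *)
Definition cvg_in_distribution (R : realType) (E : topologicalType)
    (dS : nat -> measure_display) (S : forall n, measurableType (dS n))
    (Q : forall n, probability (S n) R) (X : forall n, S n -> E)
    d (T : measurableType d) (P : probability T R) (Y : T -> E) : Prop :=
  forall h : E -> R, continuous h ->
    (exists M : R, forall e, `|h e| <= M) ->
    ('E_(Q n)[h \o X n])%E @[n --> \oo] --> ('E_P[h \o Y])%E.

(* Main.v *)
(* Reading a car as an up step and a parking spot as a down step identifies the
   increasing parking functions of size n with the positive excursions of length
   2n + 2 of the simple random walk, and the parking process stays uniformly
   close to the rescaled excursion.  It remains to find the limit of a uniform
   excursion of length N.

   Donsker's theorem is obtained for Lipschitz functionals by quantising the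
   increments of the walk over a grid, comparing them with normal increments (de
   Moivre-Laplace) and controlling the path between grid times with a
   fourth-moment maximal inequality; Lipschitz envelopes extend it to bounded
   functionals continuous at almost every Brownian path.  The excursion
   straddling time 1 is such a functional, because almost every Brownian path is
   nonzero at time 1, returns to zero, and takes both signs around each endpoint
   of that excursion.

   For the simple random walk, the excursion straddling a given time is, given
   its length, a uniform excursion of that length.  By the ballot formula, the
   initial parts of uniform excursions of comparable lengths have laws with
   density close to 1, and time reversal controls the final parts, so that the
   limit of averages over a narrow window of lengths is the limit along every
   single length.  Splitting the Brownian excursion according to its length with
   a partition of unity then identifies this limit. *)
Require Import Defs.
From mathcomp Require Import measurable_realfun ring lra zify.
Set Implicit Arguments.
Unset Strict Implicit.
Unset Printing Implicit Defensive.
Import Order.TTheory GRing.Theory Num.Theory.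
Local Open Scope classical_set_scope.
Local Open Scope ring_scope.

(** * Random walks with fair steps *)

(** A uniform excursion of given length is a walk conditioned on an event of vanishing probability,
    out of reach of Donsker's theorem. Looking at the excursion straddling time 1 avoids
    conditioning, but its length is random: Donsker yields only averages of uniform-excursion
    expectations over lengths, with weights that do not involve the tested functional. When the
    lengths in a window have ratios close to 1, these expectations are nearly equal and leave the
    average; in the limit, the expectation at a single length times the mass of the window is the
    Brownian expectation over that window. Adding windows until their total mass is close to 1 gives
    the claim.

    Path functionals come without measurability: on the Brownian side Lipschitz ones are limits of
    functions of finitely many increments, and the others are handled up to null sets. Error events,
    such as a large modulus of continuity, are replaced by Lipschitz functionals with values in
    [0, 1], so that the limit theorem under proof also bounds its own errors. *)

Section fair_steps.
Context {R : realType}.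
Implicit Types (F G : seq bool -> R) (w u v : seq bool).

(** Expectation over uniform words of [n] letters. Recursion on the first letter gives first-step
    analysis by computation; [Ew_tuple] is the usual finite average. *)
Fixpoint Ew n F : R :=
  if n is n'.+1 then
    (Ew n' (fun w => F (true :: w)) + Ew n' (fun w => F (false :: w))) / 2
  else F [::].

Lemma eq_Ew n F G : (forall w, size w = n -> F w = G w) -> Ew n F = Ew n G.
Proof.
elim: n F G => [|n IHn] F G FG /=; first exact: FG.
by congr ((_ + _) / 2); apply: IHn => w wn; apply: FG; rewrite /= wn.
Qed.

Lemma le_Ew n F G : (forall w, size w = n -> F w <= G w) -> Ew n F <= Ew n G.
Proof.
elim: n F G => [|n IHn] F G FG /=; first exact: FG.
by rewrite ler_pM2r ?invr_gt0// lerD// IHn// => w wn; apply: FG; rewrite /= wn.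
Qed.

Lemma EwD n F G : Ew n (fun w => F w + G w) = Ew n F + Ew n G.
Proof. by elim: n F G => [|n IHn] F G //=; rewrite !IHn; lra. Qed.

Lemma EwZ n c F : Ew n (fun w => c * F w) = c * Ew n F.
Proof. by elim: n F => [|n IHn] F //=; rewrite !IHn; lra. Qed.

Lemma EwZr n c F : Ew n (fun w => F w * c) = Ew n F * c.
Proof. by rewrite mulrC -EwZ; apply: eq_Ew => w _; rewrite mulrC. Qed.

Lemma EwB n F G : Ew n (fun w => F w - G w) = Ew n F - Ew n G.
Proof. by elim: n F G => [|n IHn] F G //=; rewrite !IHn; lra. Qed.

Lemma Ew_cst n c : Ew n (fun=> c) = c.
Proof. by elim: n => [|n IHn] //=; rewrite !IHn; lra. Qed.

Lemma Ew_sum n (I : Type) (r : seq I) (P : pred I) (F : I -> seq bool -> R) :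
  Ew n (fun w => \sum_(i <- r | P i) F i w) = \sum_(i <- r | P i) Ew n (F i).
Proof.
elim: n F => [|n IHn] F //=; rewrite !IHn -big_split/= mulr_suml.
by apply: eq_bigr.
Qed.

Lemma Ew_ge0 n F : (forall w, size w = n -> 0 <= F w) -> 0 <= Ew n F.
Proof. by move=> F0; rewrite -(Ew_cst n 0); apply: le_Ew. Qed.

Lemma Ew_le_cst n F c : (forall w, size w = n -> F w <= c) -> Ew n F <= c.
Proof. by move=> Fc; rewrite -[leRHS](Ew_cst n); apply: le_Ew. Qed.

Lemma ler_norm_Ew n F : `|Ew n F| <= Ew n (fun w => `|F w|).
Proof.
rewrite ler_norml -mulN1r -EwZ; apply/andP; split; apply: le_Ew => w _.
  by rewrite mulN1r lerNl -normrN ler_norm.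
exact: ler_norm.
Qed.

Lemma Ew_cat m n F : Ew (m + n) F = Ew m (fun u => Ew n (fun v => F (u ++ v))).
Proof. by elim: m F => [|m IHm] F //=; rewrite !IHm. Qed.

Lemma Ew_rcons n F :
  Ew n.+1 F = (Ew n (fun w => F (rcons w true)) +
               Ew n (fun w => F (rcons w false))) / 2.
Proof.
rewrite -addn1 Ew_cat -EwD -EwZr; apply: eq_Ew => w _ /=.
by rewrite !cats1.
Qed.

Lemma Ew_rev n F : Ew n (fun w => F (rev w)) = Ew n F.
Proof.
elim: n F => [|n IHn] F //; rewrite Ew_rcons /=.
by congr ((_ + _) / 2); rewrite -[RHS]IHn; apply: eq_Ew => w _; rewrite rev_rcons.
Qed.

Lemma Ew_negb n F : Ew n (fun w => F (map negb w)) = Ew n F.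
Proof.
elim: n F => [|n IHn] F //=.
by rewrite (IHn (fun w => F (false :: w))) (IHn (fun w => F (true :: w))) addrC.
Qed.

Lemma Ew_gt0 n F : (forall w, size w = n -> 0 <= F w) ->
  (exists2 w, size w = n & 0 < F w) -> 0 < Ew n F.
Proof.
elim: n F => [|n IHn] F F0 [w wn Fw] /=; first by case: w wn Fw.
have Fge0 b : 0 <= Ew n (fun w => F (b :: w)).
  by apply: Ew_ge0 => z zn; apply: F0; rewrite /= zn.
case: w wn Fw => // b w [wn] Fw; rewrite divr_gt0//.
have Fgt0 : 0 < Ew n (fun w => F (b :: w)).
  apply: IHn; first by move=> z zn; apply: F0; rewrite /= zn.
  by exists w.
by case: b Fw Fgt0 => ? ?; [rewrite ltr_wpDr | rewrite ltr_wpDl].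
Qed.

Lemma Ew_tuple n F :
  Ew n F = (2 ^+ n)^-1 * \sum_(t : n.-tuple bool) F t.
Proof.
elim: n F => [|n IHn] F /=.
  rewrite expr0 invr1 mul1r (big_pred1 [tuple])// => t.
  by apply/esym/eqP; exact: tuple0.
have -> : 2 ^- n.+1 = 2 ^- n / 2 :> R by rewrite exprS invfM mulrC.
rewrite !IHn -mulrDr mulrAC; congr (_ * _).
transitivity (\sum_(p : bool * n.-tuple bool) F (p.1 :: p.2)).
  rewrite -(pair_bigA _ (fun b (t : n.-tuple bool) => F (b :: t)))/=.
  by rewrite big_bool.
rewrite (reindex (fun t : n.+1.-tuple bool => (thead t, [tuple of behead t])))/=.
  by apply: eq_bigr => t _; case/tupleP: t => b t; rewrite theadE.
exists (fun p : bool * n.-tuple bool => [tuple of p.1 :: p.2]) => [t _|[b t] _] /=.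
  by rewrite -tuple_eta.
by rewrite theadE; congr pair; apply/val_inj.
Qed.

Definition sg (b : bool) : int := if b then 1 else -1.
Definition hgt w : int := \sum_(b <- w) sg b.

Lemma hgt_nil : hgt [::] = 0. Proof. by rewrite /hgt big_nil. Qed.

Lemma hgt_cons b w : hgt (b :: w) = sg b + hgt w.
Proof. by rewrite /hgt big_cons. Qed.

Lemma hgt_cat u v : hgt (u ++ v) = hgt u + hgt v.
Proof. by rewrite /hgt big_cat. Qed.

Lemma hgt_negb w : hgt (map negb w) = - hgt w.
Proof.
elim: w => [|b w IHw]; first by rewrite /= hgt_nil oppr0.
by rewrite /= !hgt_cons IHw; case: b => /=; rewrite opprD.
Qed.

Lemma hgt_rev w : hgt (rev w) = hgt w.
Proof.
by elim: w => [|b w IHw] //; rewrite rev_cons -cats1 hgt_cat IHw !hgt_cons hgt_nil addr0 addrC.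
Qed.

Lemma hgt_takeS w j : (j < size w)%N ->
  hgt (take j.+1 w) = hgt (take j w) + sg (nth true w j).
Proof.
move=> jw; rewrite (take_nth true)// -cats1 hgt_cat hgt_cons hgt_nil.
by rewrite addr0.
Qed.

Lemma norm_hgt_step w j : `|hgt (take j.+1 w) - hgt (take j w)| <= 1.
Proof.
have [jw|wj] := ltnP j (size w).
  by rewrite hgt_takeS// addrAC subrr add0r /sg; case: nth.
by rewrite !take_oversize ?subrr// ltnW.
Qed.

Lemma Ew_hgt2 m (x : int) :
  Ew m (fun w => (x + hgt w)%:~R ^+ 2) = x%:~R ^+ 2 + m%:R.
Proof.
elim: m x => [|m IHm] x /=; first by rewrite hgt_nil !addr0.
under eq_Ew do rewrite hgt_cons addrA.
under [X in _ + X]eq_Ew do rewrite hgt_cons addrA.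
by rewrite !IHm /sg !intrD -natr1; field.
Qed.

(** Exit from the open interval of radius [lam] at some time. The starting height is an argument, so
    that the maximal inequality can be proved by conditioning on the first step. *)
Fixpoint hits (lam : R) (x : int) w : bool :=
  (lam <= `|x%:~R|) || (if w is b :: w' then hits lam (x + sg b) w' else false).

Lemma hitsPn lam x w : ~~ hits lam x w ->
  forall j, `|(x + hgt (take j w))%:~R| < lam.
Proof.
elim: w x => [|b w IHw] x /=.
  by rewrite orbF -ltNge => xl j; rewrite hgt_nil addr0.
rewrite negb_or -ltNge => /andP[xl /IHw wl] [|j] /=; first by rewrite hgt_nil addr0.
by rewrite hgt_cons addrA.
Qed.

(* The right-hand side dominates the martingale [S^4 - 6 m S^2 + 3 m^2 + 2 m]
   seen backwards, so the bound propagates one step at a time. *)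
Lemma max_ineq lam m (x : int) : 0 < lam ->
  Ew m (fun w => (hits lam x w)%:R) <=
    (x%:~R ^+ 4 + 6 * x%:~R ^+ 2 * m%:R + 3 * m%:R ^+ 2) / lam ^+ 4.
Proof.
move=> lam0; have lam40 : 0 < lam ^+ 4 by rewrite exprn_gt0.
have trivial_bound k (y : int) w : lam <= `|y%:~R| -> (hits lam y w)%:R <=
    (y%:~R ^+ 4 + 6 * y%:~R ^+ 2 * k%:R + 3 * k%:R ^+ 2) / lam ^+ 4.
  move=> ly; apply: (@le_trans _ _ 1); first by case: hits; rewrite ?ler01.
  rewrite ler_pdivlMr// mul1r.
  have : lam ^+ 4 <= y%:~R ^+ 4.
    rewrite -[leRHS]ger0_norm ?exprn_even_ge0// normrX.
    by rewrite lerXn2r// nnegrE ?normr_ge0// ltW.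
  have := sqr_ge0 (y%:~R : R); have : 0 <= k%:R :> R by [].
  by set a := _ ^+ 4; set b := _ ^+ 2; set c := _%:R; nra.
elim: m x => [|m IHm] x /=.
  have [lx|lx] := boolP (lam <= `|x%:~R|); last first.
    rewrite /= divr_ge0 ?(ltW lam40)// mulr0 expr0n/= mulr0 !addr0.
    by rewrite exprn_even_ge0.
  by have := trivial_bound 0%N x [::] lx; rewrite /= lx.
have [lx|lx] := boolP (lam <= `|x%:~R|).
  apply: le_trans (trivial_bound m.+1 x [::] lx).
  by rewrite /= lx !Ew_cst /= ; lra.
rewrite /=; apply: (@le_trans _ _ ((((x + 1)%:~R ^+ 4 + 6 * (x + 1)%:~R ^+ 2 * m%:R +
   3 * m%:R ^+ 2) / lam ^+ 4 + ((x - 1)%:~R ^+ 4 + 6 * (x - 1)%:~R ^+ 2 * m%:R +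
   3 * m%:R ^+ 2) / lam ^+ 4) / 2)).
  by rewrite ler_pM2r ?invr_gt0// lerD//; apply: IHm.
rewrite -mulrDl mulrAC ler_pM2r ?invr_gt0//.
rewrite !intrD intrN -natr1; set y := x%:~R; set k := m%:R.
by rewrite ler_pdivrMr//; nra.
Qed.

Definition clip (t : R) : R := Num.max 0 (Num.min 1 t).

Lemma clip_ge0 t : 0 <= clip t. Proof. by rewrite /clip le_max lexx. Qed.

Lemma clip_le1 t : clip t <= 1.
Proof. by rewrite /clip ge_max ler01 ge_min lexx. Qed.

Lemma clip_le0 t : t <= 0 -> clip t = 0.
Proof. by move=> t0; rewrite /clip max_l// ge_min t0 orbT. Qed.

Lemma clip_ge1 t : 1 <= t -> clip t = 1.
Proof. by move=> t1; rewrite /clip min_l// max_r. Qed.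

Lemma clip_id t : 0 <= t <= 1 -> clip t = t.
Proof. by move=> /andP[t0 t1]; rewrite /clip min_r// max_r. Qed.

Lemma clip_lip s t : `|clip s - clip t| <= `|s - t|.
Proof.
have [s0|s0] := leP s 0; have [t0|t0] := leP t 0;
  have [s1|s1] := leP 1 s; have [t1|t1] := leP 1 t;
  rewrite ?(clip_le0 s0) ?(clip_le0 t0) ?(clip_ge1 s1) ?(clip_ge1 t1);
  rewrite ?(@clip_id s) ?(@clip_id t) ?subrr ?normr0//; try lra;
  rewrite ?(ltW s0) ?(ltW t0) ?(ltW s1) ?(ltW t1)//;
  rewrite ler_norml; have := ler_norm (s - t); have := ler_norm (t - s);
  rewrite (distrC t s); lra.
Qed.

Lemma continuous_clip : continuous clip.
Proof.
move=> t; apply/cvgrPdist_le => e e0.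
have /cvgrPdist_le/(_ e e0) : (x @[x --> t] --> t) by exact: cvg_id.
by apply: filterS => s; exact: le_trans (clip_lip _ _).
Qed.

(** Linear interpolation as a sum of ramps: the letter of index i contributes its sign times
    [clip (t - i)]. The path is 0 before time 0 and constant after the last letter, which makes
    concatenation additive. *)
Fixpoint walk w (t : R) : R :=
  if w is b :: w' then (sg b)%:~R * clip t + walk w' (t - 1) else 0.

Lemma walk_le0 w t : t <= 0 -> walk w t = 0.
Proof.
elim: w t => [|b w IHw] t t0 //=.
by rewrite clip_le0// mulr0 add0r IHw//; lra.
Qed.

Lemma walk_cat u v t : walk (u ++ v) t = walk u t + walk v (t - (size u)%:R).
Proof.
elim: u t => [|b u IHu] t /=; first by rewrite subr0 add0r.
by rewrite IHu addrA -natr1; congr (_ + walk _ _); lra.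
Qed.

Lemma walk_ge w t : (size w)%:R <= t -> walk w t = (hgt w)%:~R.
Proof.
elim: w t => [|b w IHw] t; first by rewrite hgt_nil.
rewrite /= -natr1 => wt.
have : 0 <= (size w)%:R :> R by [].
move=> ?; rewrite clip_ge1; last by lra.
by rewrite IHw ?hgt_cons ?intrD ?mulr1//; lra.
Qed.

Lemma walk_nat w j : walk w j%:R = (hgt (take j w))%:~R.
Proof.
have [wj|jw] := leqP (size w) j.
  by rewrite take_oversize// walk_ge// ler_nat.
rewrite -[in LHS](cat_take_drop j w) walk_cat walk_ge; last first.
  by rewrite size_takel ?ler_nat// ltnW.
by rewrite walk_le0 ?addr0// size_takel ?subrr// ltnW.
Qed.

Lemma walk_interp w j t : j%:R <= t <= j.+1%:R ->
  walk w t = (1 - (t - j%:R)) * (hgt (take j w))%:~R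
             + (t - j%:R) * (hgt (take j.+1 w))%:~R.
Proof.
move=> /andP[jt tj]; have [wj|jw] := leqP (size w) j.
  rewrite !take_oversize ?(leqW wj)//.
  by rewrite walk_ge ?(le_trans _ jt) ?ler_nat//; lra.
rewrite -[in LHS](cat_take_drop j w) walk_cat (drop_nth true)//=.
rewrite size_takel ?(ltnW jw)// [walk _ (_ - 1)]walk_le0; last first.
  by move: tj; rewrite -natr1; lra.
rewrite walk_ge ?size_takel ?(ltnW jw)// hgt_takeS// intrD clip_id; first by lra.
by move: tj; rewrite -natr1; lra.
Qed.

Lemma walk_negb w t : walk (map negb w) t = - walk w t.
Proof.
elim: w t => [|b w IHw] t /=; first by rewrite oppr0.
by rewrite IHw opprD; case: b => /=; rewrite ?mulN1r ?mul1r ?opprK.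
Qed.

Lemma continuous_walk w : continuous (walk w).
Proof.
elim: w => [|b w IHw] t /=; first exact: cvg_cst.
apply: cvgD; first by apply: cvgMr; exact: continuous_clip.
apply: (@continuous_comp _ _ _ (fun t : R => t - 1) (walk w)); last exact: IHw.
by apply: cvgB; [exact: cvg_id|exact: cvg_cst].
Qed.

Lemma trunc_itv (t : R) : 0 <= t ->
  (Num.truncn t)%:R <= t <= (Num.truncn t).+1%:R.
Proof. by move=> /truncn_itv /andP[-> /ltW ->]. Qed.

Lemma walk_max w (M : R) (a s : nat) t :
  (forall j, (a <= j <= s)%N -> `|(hgt (take j w))%:~R| <= M) ->
  a%:R <= t <= s%:R -> `|walk w t| <= M.
Proof.
move=> wM /andP[at_]; rewrite le_eqVlt => /predU1P[ts|ts].
  by rewrite ts walk_nat wM// leqnn -(ler_nat R) -ts at_.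
have t0 : 0 <= t by apply: le_trans at_.
have /andP[jt tj] := truncn_itv t0; set j := Num.truncn t in jt tj *.
have js : (j < s)%N by rewrite -(ltr_nat R) (le_lt_trans jt).
have aj : (a <= j)%N by rewrite -ltnS -(ltr_nat R) (le_lt_trans at_).
rewrite (@walk_interp w j) ?jt ?(ltW tj)//.
have := wM j; have := wM j.+1.
rewrite aj js (ltnW js) (leqW aj) => /(_ isT) + /(_ isT).
rewrite !ler_norml.
move: jt tj; rewrite -natr1 => jt /ltW tj.
by move: jt tj; set x := (hgt _)%:~R; set y := (hgt _)%:~R; set k := j%:R; nra.
Qed.

End fair_steps.

(** * First passage times *)

Section first_passage.
Context {R : realType}.
Implicit Types (F : seq bool -> R) (w u v : seq bool).

(** The path started at height [b] reaches 0 for the first time at its last step; see [fpP]. *)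
Fixpoint fp (b : nat) w : bool :=
  match b, w with
  | 0, [::] => true
  | b'.+1, s :: w' => fp (if s then b'.+2 else b') w'
  | _, _ => false
  end.

Definition fpp b m : R := Ew m (fun w => (fp b w)%:R).

Lemma fppS b m : fpp b.+1 m.+1 = (fpp b.+2 m + fpp b m) / 2.
Proof. by []. Qed.

Lemma fpp0S m : fpp 0 m.+1 = 0.
Proof. by rewrite /fpp /= !Ew_cst addr0 mul0r. Qed.

Lemma fpp_ge0 b m : 0 <= fpp b m.
Proof. by apply: Ew_ge0. Qed.

(* [h] is the number of down steps. *)
Lemma ballot b m h : (m + b = h.*2)%N ->
  m%:R * fpp b m * 2 ^+ m = b%:R * 'C(m, h)%:R.
Proof.
elim: m b h => [|m IHm] b h mbh.
  rewrite mul0r mul0r; case: b mbh => [|b] mbh; first by rewrite mul0r.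
  by case: h mbh => [|h] //; rewrite bin0n mulr0.
case: b mbh => [|b] mbh; first by rewrite fpp0S mulr0 !mul0r.
case: h mbh => [|h] mbh //.
have /(IHm b.+2 h.+1) e1 : (m + b.+2 = h.+1.*2)%N by lia.
have /(IHm b h) e2 : (m + b = h.*2)%N by lia.
have [m0|m0] := posnP m.
  rewrite m0 in e1 e2 mbh *; rewrite fppS mul1r expr1 divfK//.
  have -> : b = h.*2 by lia.
  case: h {mbh e1 e2} => [|h]; first by rewrite /fpp /= add0r binn mulr1.
  by rewrite bin_small// mulr0 doubleS /fpp /= addr0.
apply: (@mulfI _ m%:R); first by rewrite pnatr_eq0 -lt0n.
rewrite fppS exprS binS natrD.
have e3 : h.+1%:R * 'C(m, h.+1)%:R = (m%:R - h%:R) * 'C(m, h)%:R :> R.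
  have [hm|mh] := leqP h m; first by rewrite -natrB// -!natrM mul_bin_left.
  by rewrite (bin_small mh) (bin_small (leqW mh)) !mulr0.
have -> : m%:R * (m.+1%:R * ((fpp b.+2 m + fpp b m) / 2) * (2 * 2 ^+ m)) =
  m.+1%:R * (m%:R * fpp b.+2 m * 2 ^+ m + m%:R * fpp b m * 2 ^+ m) :> R.
  by field.
rewrite e1 e2.
have bE : b%:R = h%:R *+ 2 - m%:R :> R.
  by rewrite -natr1 in e3 *; rewrite mulr2n -natrD addnn (_ : h.*2 = (m + b)%N) ?natrD; [lra|lia].
move: e3; rewrite -(@natr1 _ b.+1) -(@natr1 _ b) -(@natr1 _ m) -(@natr1 _ h) bE mulr2n.
set x := 'C(m, h)%:R; set y := 'C(m, h.+1)%:R; set k := h%:R; set l := m%:R.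
by move=> e3; lra.
Qed.

(** The ballot formula at [m] and [m.+2] involves ['C(m, h)] and ['C(m.+2, h.+1)], whose quotient is
    rational. The comparison of lengths rests on this exact ratio. *)
Lemma fpp_ratio b m : ~~ odd (m + b) ->
  ((m.+2)%:R ^+ 2 - b%:R ^+ 2) * fpp b m.+2 = m%:R * m.+1%:R * fpp b m.
Proof.
move=> ev; set h := (m + b)./2.
have hE : (m + b = h.*2)%N by rewrite /h; lia.
have /ballot e2 : (m.+2 + b = h.+1.*2)%N by lia.
have e1 := ballot hE.
have e3 : h.+1%:R * (m%:R + 1 - h%:R) * 'C(m.+2, h.+1)%:R =
    (m.+2)%:R * m.+1%:R * 'C(m, h)%:R :> R.
  rewrite mulrAC -(natrM _ h.+1) -(mul_bin_diag m.+2 h) natrM -!mulrA /=.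
  congr (_ * _).
  have [hm|mh] := leqP h m.+1; last by rewrite !bin_small ?mul0r ?mulr0//; lia.
  by rewrite natr1 -natrB// mulrC -natrM (mul_bin_down m.+1 h) natrM.
have bE : b%:R = h%:R *+ 2 - m%:R :> R.
  by rewrite mulr2n -natrD addnn -hE natrD; lra.
apply: (@mulfI _ (2 ^+ m * m.+2%:R)); first by rewrite mulf_neq0// expf_neq0.
have -> : 2 ^+ m * m.+2%:R * ((m.+2%:R ^+ 2 - b%:R ^+ 2) * fpp b m.+2) =
   (m.+2%:R ^+ 2 - b%:R ^+ 2) / 4 * (m.+2%:R * fpp b m.+2 * 2 ^+ m.+2) :> R.
  by rewrite !exprS; field.
have -> : 2 ^+ m * m.+2%:R * (m%:R * m.+1%:R * fpp b m) =
   m.+2%:R * m.+1%:R * (m%:R * fpp b m * 2 ^+ m) :> R by ring.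
rewrite e2 e1.
have -> : (m.+2%:R ^+ 2 - b%:R ^+ 2) / 4 * (b%:R * 'C(m.+2, h.+1)%:R) =
   b%:R * (h.+1%:R * (m%:R + 1 - h%:R) * 'C(m.+2, h.+1)%:R) :> R.
  rewrite bE -(@natr1 _ m.+1) -(@natr1 _ m) -(@natr1 _ h).
  by set y := 'C(_, _)%:R; set k := h%:R; set l := m%:R; rewrite mulr2n; field.
by rewrite e3; ring.
Qed.

Definition pexc w : bool := if w is true :: w' then fp 1 w' else false.

Definition exc_mass N : R := Ew N (fun w => (pexc w)%:R).

Lemma exc_massS m : exc_mass m.+1 = fpp 1 m / 2.
Proof. by rewrite /exc_mass /= Ew_cst addr0. Qed.

Lemma fp_updown l : fp 1 (rcons (flatten (nseq l [:: true; false])) false).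
Proof. by elim: l => [|l IHl]. Qed.

Lemma exc_mass_gt0 N : (0 < N)%N -> ~~ odd N -> 0 < exc_mass N.
Proof.
move=> N0 Nev; apply: Ew_gt0 => //.
exists (true :: rcons (flatten (nseq (N./2.-1) [:: true; false])) false).
  rewrite /= size_rcons size_flatten /shape map_nseq sumn_nseq /=; lia.
by rewrite /= fp_updown.
Qed.

Lemma exc_mass_ratio N : (0 < N)%N -> ~~ odd N ->
  exc_mass N.+2 * N.+2%:R = exc_mass N * (N%:R - 1).
Proof.
case: N => // m _ /= mev; rewrite !exc_massS.
have /fpp_ratio : ~~ odd (m + 1) by rewrite addn1.
rewrite -(@natr1 _ m.+2) -(@natr1 _ m.+1) -(@natr1 _ m) => e.
(* Since (m + 2)^2 - 1 = (m + 1)(m + 3), the common factor m + 1 cancels. *)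
have : (m%:R + 1) * ((m%:R + 3) * fpp 1 m.+2) = (m%:R + 1) * (m%:R * fpp 1 m).
  by move: e; set k := m%:R; set x := fpp _ _; set y := fpp _ _; lra.
move=> /(@mulfI _ (m%:R + 1)) => /(_ _)e'.
have {}e' := e' (lt0r_neq0 (ltr_wpDl (ler0n _ _) ltr01)).
by move: e'; set k := m%:R; set x := fpp _ _; set y := fpp _ _; lra.
Qed.

(** Density, with respect to the free walk, of the prefix of a uniform excursion of length [N'],
    when [m] steps remain and the prefix ends at height [b]; see [Ex_prefix]. *)
Definition density N' b m := fpp b m / exc_mass N'.

(** Lengthening the excursion by two multiplies the density by the ratios of [fpp_ratio] and
    [exc_mass_ratio], both 1 + O(1/m) when [b] is at most of order sqrt m. In [c], [2 * lam] comes
    from the first ratio, 3 from the second and 3 from the cross term. *)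
Lemma density_step N b m (lam : R) (c := 2 * lam + 6) :
  (0 < m < N)%N -> ~~ odd N -> ~~ odd (m + b) ->
  b%:R ^+ 2 <= lam * m%:R -> 1 <= lam -> lam * 2 <= m%:R ->
  (1 - c / m%:R) * density N b m <= density N.+2 b m.+2
  <= (1 + c / m%:R) * density N b m.
Proof.
move=> /andP[m0 mN] Nev mbev bm lam1 lamm.
have N0 : (0 < N)%N by lia.
have := exc_mass_ratio N0 Nev; have := fpp_ratio mbev.
have D0 := exc_mass_gt0 N0 Nev.
have D2 : 0 < exc_mass N.+2 by apply: exc_mass_gt0 => //=; rewrite negbK.
have q0 := fpp_ge0 b m; have q2 := fpp_ge0 b m.+2.
have mR : 0 < m%:R :> R by rewrite ltr0n.
have NR : m%:R + 1 <= N%:R :> R by rewrite natr1 ler_nat.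
rewrite /density; move: D0 D2 q0 q2; rewrite -(@natr1 _ N.+1) -(@natr1 _ N).
rewrite -(@natr1 _ m.+1) -(@natr1 _ m).
set D := exc_mass N; set D' := exc_mass N.+2; set q := fpp b m; set q' := fpp b m.+2.
set M := N%:R in NR *; set k := m%:R in bm lamm mR NR *; set B := b%:R in bm *.
move=> D0 D2 q0 q2 eq' eD'.
have den0 : 0 < (k + 1 + 1) ^+ 2 - B ^+ 2 by nra.
have q'E : q' = (k * (k + 1)) / ((k + 1 + 1) ^+ 2 - B ^+ 2) * q.
  by rewrite mulrAC -eq' mulrAC mulfV ?mul1r// lt0r_neq0.
have D'E : D' = D * (M - 1) / (M + 1 + 1) by rewrite -eD' mulfK// lt0r_neq0//; nra.
have -> : q' / D' = (k * (k + 1)) / ((k + 1 + 1) ^+ 2 - B ^+ 2) *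
    ((M + 1 + 1) / (M - 1)) * (q / D).
  by rewrite q'E D'E; field; rewrite !lt0r_neq0//; nra.
have qD0 : 0 <= q / D by rewrite divr_ge0// ltW.
set r1 := _ / (_ - B ^+ 2); set r2 := (M + 1 + 1) / _.
have r1l : 1 - 3 / k <= r1.
  rewrite /r1 ler_pdivlMr// mulrBl mul1r lerBlDr -lerBlDl.
  have : (k + 1 + 1) ^+ 2 - B ^+ 2 <= (k + 2) ^+ 2 by have := sqr_ge0 B; nra.
  have : 3 <= 3 / k * (k + 2).
    by rewrite mulrAC ler_pdivlMr//; nra.
  have : 0 < 3 / k by rewrite divr_gt0.
  have [B0|B0] := leP (B ^+ 2) (3 * (k + 2)).
    have [k3|k3] := leP k 3.
      have : 1 <= 3 / k by rewrite ler_pdivlMr// mul1r.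
      set z := 3 / k; nra.
    have : 3 / k * k = 3 by rewrite divfK// lt0r_neq0.
    set z := 3 / k; nra.
  have : 3 / k * k = 3 by rewrite divfK// lt0r_neq0.
  have : 3 / k <= 3 by rewrite ler_pdivrMr//; nra.
  set z := 3 / k; nra.
have r1u : r1 <= 1 + 2 * lam / k.
  rewrite /r1 ler_pdivrMr//.
  have : 2 * lam / k * k = 2 * lam by rewrite divfK// lt0r_neq0.
  have : 0 < 2 * lam / k by rewrite divr_gt0//; lra.
  set z := 2 * lam / k; nra.
have M1 : 0 < M - 1 by lra.
have r2l : 1 <= r2 by rewrite /r2 ler_pdivlMr//; lra.
have r2u : r2 <= 1 + 3 / k.
  rewrite /r2 ler_pdivrMr//.
  have : 3 / k * k = 3 by rewrite divfK// lt0r_neq0.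
  have : 0 < 3 / k by rewrite divr_gt0.
  set z := 3 / k; nra.
have r10 : 0 <= r1 by rewrite /r1 divr_ge0 ?ltW//; nra.
have k2 : 2 <= k by lra.
apply/andP; split; apply: ler_wpM2r => //.
  have : 0 <= 3 / k by rewrite divr_ge0// ltW.
  have -> : c / k = 3 / k + (2 * lam + 3) / k by rewrite /c; field; rewrite lt0r_neq0.
  have : 0 <= (2 * lam + 3) / k by rewrite divr_ge0//; lra.
  by nra.
apply: (@le_trans _ _ ((1 + 2 * lam / k) * (1 + 3 / k))).
  by apply: ler_pM => //; lra.
have -> : c / k = 2 * lam / k + 6 / k by rewrite /c; field; rewrite lt0r_neq0.
have : 2 * lam / k <= 1 by rewrite ler_pdivrMr//; lra.
have -> : 6 / k = 3 / k + 3 / k by field; rewrite lt0r_neq0.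
have : 0 <= 3 / k by rewrite divr_ge0// ltW.
by nra.
Qed.

Lemma density_compare N b m j (lam kap : R) (c := 2 * lam + 6) :
  (0 < m < N)%N -> ~~ odd N -> ~~ odd (m + b) ->
  b%:R ^+ 2 <= lam * m%:R -> 1 <= lam -> lam * 2 <= m%:R ->
  2 * c * j%:R <= kap * m%:R -> kap <= 1 ->
  (1 - kap) * density N b m <= density (N + j.*2)%N b (m + j.*2)
  <= (1 + kap) * density N b m.
Proof.
move=> mN Nev mbev bm lam1 lamm jk kap1.
have c0 : 0 < c by rewrite /c; lra.
have m0 : 0 < m%:R :> R by rewrite ltr0n; lia.
have d0 : 0 <= density N b m.
  by rewrite divr_ge0 ?fpp_ge0// ltW// exc_mass_gt0//; lia.
(* Doubling the error y = c / m of one step makes a linear bound inductive: (1 + y)(1 + 2yj) <= 1 +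
   2y(j + 1) as long as 2yj <= 1. *)
suff: (1 - 2 * c * j%:R / m%:R) * density N b m <=
    density (N + j.*2)%N b (m + j.*2) <= (1 + 2 * c * j%:R / m%:R) * density N b m.
  move=> /andP[lo hi]; have jm : 2 * c * j%:R / m%:R <= kap by rewrite ler_pdivrMr.
  apply/andP; split; first by apply: le_trans lo; apply: ler_wpM2r => //; lra.
  by apply: le_trans hi _; apply: ler_wpM2r => //; lra.
have {jk} : 2 * c * j%:R <= m%:R by apply: le_trans jk _; rewrite ler_piMl// ltW.
elim: j => [|j IHj] jm.
  by rewrite !addn0 mulr0 mul0r subr0 addr0 !mul1r lexx.
have /IHj/andP[lo hi] : 2 * c * j%:R <= m%:R by move: jm; rewrite -(@natr1 _ j); nra.
rewrite !doubleS !addnS.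
have mj : m%:R <= (m + j.*2)%:R :> R by rewrite ler_nat leq_addr.
have /andP[lo2 hi2] : (1 - c / (m + j.*2)%:R) * density (N + j.*2)%N b (m + j.*2)
  <= density (N + j.*2).+2 b (m + j.*2).+2 <=
  (1 + c / (m + j.*2)%:R) * density (N + j.*2)%N b (m + j.*2).
  apply: density_step => //.
  - by rewrite addn_gt0 ltn_add2r; case/andP: mN => ->.
  - by rewrite oddD odd_double addbF.
  - by rewrite addnAC oddD odd_double addbF.
  - by apply: le_trans bm _; rewrite ler_pM2l//; lra.
  - exact: le_trans mj.
set d := density _ _ _ in d0 lo hi *; set dj := density _ _ _ in lo hi lo2 hi2 *.
have cm : c / (m + j.*2)%:R <= c / m%:R.
  by rewrite ler_pM2l// lef_pV2 ?posrE//; lra.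
have cmj0 : 0 < c / (m + j.*2)%:R by rewrite divr_gt0//; lra.
have y0 : 0 < c / m%:R by rewrite divr_gt0.
have dj0 : 0 <= dj.
  rewrite divr_ge0 ?fpp_ge0// ltW// exc_mass_gt0//.
    by case/andP: mN => ? ?; rewrite addn_gt0 (leq_ltn_trans _ (_ : m < N)%N).
  by rewrite oddD odd_double addbF.
rewrite -(@natr1 _ j) in jm *.
have zjm : 2 * (c / m%:R) * (j%:R + 1) <= 1.
  by rewrite mulrA mulrAC ler_pdivrMr// mul1r.
have e (x : R) : 2 * c * x / m%:R = 2 * (c / m%:R) * x by rewrite mulrA mulrAC.
rewrite !e in lo hi *; set y := c / m%:R in cm y0 zjm lo hi *.
set y' := c / (m + _)%:R in cm cmj0 lo2 hi2.
have j0 : 0 <= j%:R :> R by [].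
set k := j%:R in zjm lo hi j0 *.
apply/andP; split.
  apply: le_trans lo2; apply: (@le_trans _ _ ((1 - y) * dj)); last first.
    by apply: ler_wpM2r => //; lra.
  apply: (@le_trans _ _ ((1 - y) * ((1 - 2 * y * k) * d))); last first.
    by apply: ler_wpM2l => //; nra.
  by rewrite mulrA; apply: ler_wpM2r => //; nra.
apply: le_trans hi2 _; apply: (@le_trans _ _ ((1 + y) * dj)).
  by apply: ler_wpM2r => //; lra.
apply: (@le_trans _ _ ((1 + y) * ((1 + 2 * y * k) * d))).
  by apply: ler_wpM2l => //; nra.
rewrite mulrA; apply: ler_wpM2r => //; nra.
Qed.

End first_passage.

(** * Comparison of excursions of different lengths *)

Section excursions.
Context {R : realType}.
Implicit Types (F G : seq bool -> R) (w u v : seq bool) (e : R -> R).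

Fixpoint alive (b : nat) u : bool :=
  if u is s :: u' then (0 < b)%N && alive (if s then b.+1 else b.-1) u' else true.

(** The truncated [b.-1] is a genuine down step only on [alive] words, the only ones on which the
    value matters. *)
Fixpoint level (b : nat) u : nat :=
  if u is s :: u' then level (if s then b.+1 else b.-1) u' else b.

Lemma fp_cat b u v : fp b (u ++ v) = alive b u && fp (level b u) v.
Proof. by elim: u b => [|s u IHu] [|b]//=. Qed.

Lemma level_hgt b u : alive b u -> (level b u)%:Z = b%:Z + hgt u.
Proof.
elim: u b => [|s u IHu] b /=; first by rewrite hgt_nil addr0.
by move=> /andP[b0 /IHu ->]; rewrite hgt_cons; case: s => /=; lia.
Qed.

Lemma odd_level b u : alive b u -> odd (level b u) = odd (b + size u).
Proof.
elim: u b => [|s u IHu] b /=; first by rewrite addn0.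
by move=> /andP[b0 /IHu ->]; case: s => /=; case: b b0 => // b _ /=; lia.
Qed.

Lemma fpP b v : fp b v <->
  (b%:Z + hgt v = 0 /\ forall j, (j < size v)%N -> 0 < b%:Z + hgt (take j v)).
Proof.
elim: v b => [|s v IHv] b.
  by rewrite hgt_nil addr0; case: b => [|b]; split=> // -[].
case: b => [|b] /=.
  by split=> // -[_ /(_ 0%N isT)]; rewrite hgt_nil.
rewrite IHv hgt_cons; split=> -[h1 h2]; split.
- by rewrite -h1; case: s {h1 h2} => /=; lia.
- move=> [|j] /=; first by rewrite hgt_nil.
  rewrite ltnS => /h2; rewrite hgt_cons.
  by case: s {h1 h2} => /=; lia.
- by rewrite -h1; case: s {h1 h2} => /=; lia.
- move=> j jv; have := h2 j.+1; rewrite /= ltnS hgt_cons => /(_ jv).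
  by case: s {h1 h2} => /=; lia.
Qed.

Lemma pexcP v : pexc v <-> [/\ (0 < size v)%N, hgt v = 0 &
  forall j, (0 < j < size v)%N -> 0 < hgt (take j v)].
Proof.
case: v => [|[] v] /=; first by split=> // -[].
  rewrite fpP hgt_cons; split=> [[h1 h2]|[_ h1 h2]]; split=> // j.
    by case: j => [|j]//=; rewrite ltnS hgt_cons => /h2.
  by move=> jv; have := h2 j.+1; rewrite /= ltnS hgt_cons; exact.
split=> // -[_]; rewrite hgt_cons /=; case: v => [|s v].
  by rewrite hgt_nil.
by move=> _ /(_ 1%N isT); rewrite /= hgt_cons hgt_nil.
Qed.

(** Time reversal: after j steps the reversed path is at the height of [v] after [size v - j] steps,
    because [v] ends at 0. *)
Lemma pexc_rev v : pexc (rev (map negb v)) = pexc v.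
Proof.
have imp w : pexc w -> pexc (rev (map negb w)).
  move=> /pexcP[w0 hw wpos]; apply/pexcP; split.
  - by rewrite size_rev size_map.
  - by rewrite hgt_rev hgt_negb hw oppr0.
  - rewrite size_rev size_map => j /andP[j0 jw].
    rewrite take_rev hgt_rev -map_drop hgt_negb size_map.
    have := wpos (size w - j)%N; rewrite ltn_subrL j0 w0 subn_gt0 jw => /(_ isT).
    by move: hw; rewrite -[in hgt w = _](cat_take_drop (size w - j) w) hgt_cat; lia.
apply/idP/idP => [/imp|]; last exact: imp.
by rewrite map_rev revK -map_comp map_id_in// => b; rewrite /= negbK.
Qed.

Lemma pexc_hgt_ge0 v j : pexc v -> 0 <= hgt (take j v).
Proof.
move=> /pexcP[_ hv vpos]; have [->|j0] := posnP j; first by rewrite take0 hgt_nil.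
have [vj|jv] := leqP (size v) j; first by rewrite take_oversize// hv.
by rewrite ltW// vpos// j0.
Qed.

(** Expectation under a uniform excursion of length [N]; division by 0 makes it 0 when no excursion
    has that length. *)
Definition Ex N F : R := Ew N (fun w => (pexc w)%:R * F w) / exc_mass N.

Definition pos u : bool := if u is true :: u' then alive 1 u' else false.
Definition end_level u : nat := if u is true :: u' then level 1 u' else 0.

Lemma pexc_cat u v : (0 < size u)%N -> pexc (u ++ v) = pos u && fp (end_level u) v.
Proof. by case: u => [|[] u]//= _; exact: fp_cat. Qed.

Lemma end_level_hgt u : pos u -> (end_level u)%:Z = hgt u.
Proof. by case: u => [|[] u]//= /level_hgt ->; rewrite hgt_cons. Qed.

Lemma odd_end_level u : pos u -> odd (end_level u) = odd (size u).
Proof. by case: u => [|[] u]//= /odd_level ->. Qed.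

(** Markov property at step [s]: given the prefix, the remaining steps only have to be a first
    passage to 0 from its end level. *)
Lemma Ex_prefix N s F : (0 < s <= N)%N ->
  Ex N (fun v => F (take s v)) =
  Ew s (fun u => (pos u)%:R * F u * density N (end_level u) (N - s)).
Proof.
move=> /andP[s0 sN]; rewrite /Ex -[in Ew _ _](subnKC sN) Ew_cat -EwZr.
apply: eq_Ew => u us; rewrite /density mulrA; congr (_ / _).
rewrite /fpp -EwZ; apply: eq_Ew => v _.
rewrite take_size_cat// pexc_cat ?us// -mulnb natrM -!mulrA; congr (_ * _).
by rewrite mulrC.
Qed.

Lemma Ex_rev N F : Ex N (fun v => F (rev (map negb v))) = Ex N F.
Proof.
rewrite /Ex; congr (_ / _).
rewrite -[RHS]Ew_rev -[RHS](Ew_negb _ (fun w => (pexc (rev w))%:R * F (rev w))).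
by apply: eq_Ew => w _; rewrite pexc_rev.
Qed.

Section mass.
Variable N : nat.
Hypotheses (N0 : (0 < N)%N) (Nev : ~~ odd N).

Lemma eq_Ex F G : (forall v, size v = N -> pexc v -> F v = G v) -> Ex N F = Ex N G.
Proof.
move=> FG; congr (_ / _); apply: eq_Ew => w wN.
by case: (boolP (pexc w)) => [/(FG _ wN) ->|]; rewrite ?mul0r.
Qed.

Lemma le_Ex F G : (forall v, size v = N -> pexc v -> F v <= G v) -> Ex N F <= Ex N G.
Proof.
move=> FG; rewrite ler_pM2r ?invr_gt0 ?exc_mass_gt0//; apply: le_Ew => w wN.
by case: (boolP (pexc w)) => [/(FG _ wN)|]; rewrite ?mul0r// !mul1r.
Qed.

Lemma ExD F G : Ex N (fun w => F w + G w) = Ex N F + Ex N G.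
Proof.
by rewrite /Ex -mulrDl -EwD; congr (_ / _); apply: eq_Ew => w _; rewrite mulrDr.
Qed.

Lemma ExB F G : Ex N (fun w => F w - G w) = Ex N F - Ex N G.
Proof.
by rewrite /Ex -mulrBl -EwB; congr (_ / _); apply: eq_Ew => w _; rewrite mulrBr.
Qed.

Lemma ExZ c F : Ex N (fun w => c * F w) = c * Ex N F.
Proof.
by rewrite /Ex mulrA -EwZ; congr (_ / _); apply: eq_Ew => w _; rewrite mulrCA.
Qed.

Lemma Ex_cst c : Ex N (fun=> c) = c.
Proof. by rewrite /Ex EwZr mulrAC mulfV ?mul1r// lt0r_neq0// exc_mass_gt0. Qed.

Lemma Ex_ge0 F : (forall v, size v = N -> pexc v -> 0 <= F v) -> 0 <= Ex N F.
Proof. by move=> F0; rewrite -(Ex_cst 0); apply: le_Ex. Qed.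

Lemma Ex_le1 F : (forall v, size v = N -> pexc v -> F v <= 1) -> Ex N F <= 1.
Proof. by move=> F0; rewrite -[leRHS](Ex_cst 1); apply: le_Ex. Qed.

Lemma ler_norm_Ex F : `|Ex N F| <= Ex N (fun w => `|F w|).
Proof.
rewrite ler_norml -mulN1r -ExZ; apply/andP; split; apply: le_Ex => w _ _.
  by rewrite mulN1r lerNl -normrN ler_norm.
exact: ler_norm.
Qed.

Lemma ler_dist_Ex F G H : (forall v, size v = N -> pexc v -> `|F v - G v| <= H v) ->
  `|Ex N F - Ex N G| <= Ex N H.
Proof. by move=> FG; rewrite -ExB (le_trans (ler_norm_Ex _))// le_Ex. Qed.

End mass.

Definition exc v (x : R) : R := walk v ((size v)%:R * x) / Num.sqrt (size v)%:R.

(** The bound [s] on the distance is an argument, so that no supremum is formed; such a functional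
    sees a path only on [0, K]. *)
Definition lip (K m : R) (h : (R -> R) -> R) := forall (e e' : R -> R) (s : R),
  (forall x : R, 0 <= x <= K -> `|e x - e' x| <= s) -> `|h e - h e'| <= m * s.

Definition oscset (d eta : R) e : set R :=
  [set z | exists x y : R, [/\ 0 <= x <= 1, 0 <= y <= 1, `|x - y| <= d &
    z = Num.min 1 (`|e x - e y| / eta)]].

(** Modulus of continuity at scale [d], in units of [eta] and truncated at 1. It dominates the
    indicator of a modulus reaching [eta] while being Lipschitz, so the limit theorems for Lipschitz
    functionals apply to it. *)
Definition beta (d eta : R) e : R := sup (oscset d eta e).

Section beta_theory.
Variables (d eta : R).
Hypotheses (d0 : 0 <= d) (eta0 : 0 < eta).

Lemma oscset_ub e : ubound (oscset d eta e) 1.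
Proof. by move=> _ [x [y [_ _ _ ->]]]; rewrite ge_min lexx. Qed.

Lemma oscset_has_sup e : has_sup (oscset d eta e).
Proof.
split; last by exists 1; exact: oscset_ub.
by exists (Num.min 1 (`|e 0 - e 0| / eta)), 0, 0; rewrite subrr normr0 lexx ler01.
Qed.

Lemma beta_ge e (x y : R) : 0 <= x <= 1 -> 0 <= y <= 1 -> `|x - y| <= d ->
  Num.min 1 (`|e x - e y| / eta) <= beta d eta e.
Proof.
by move=> x01 y01 xy; apply: ub_le_sup; [case: (oscset_has_sup e)|exists x, y].
Qed.

Lemma beta_le e c :
  (forall x y : R, 0 <= x <= 1 -> 0 <= y <= 1 -> `|x - y| <= d ->
    Num.min 1 (`|e x - e y| / eta) <= c) -> beta d eta e <= c.
Proof.
move=> ec; apply: ge_sup; first by case: (oscset_has_sup e).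
by move=> _ [x [y [x01 y01 xy ->]]]; exact: ec.
Qed.

Lemma beta_ge0 e : 0 <= beta d eta e.
Proof.
apply: le_trans (@beta_ge e 0 0 _ _ _); rewrite ?lexx ?ler01 ?subrr ?normr0//.
by rewrite mul0r le_min lexx ler01.
Qed.

Lemma beta_le1 e : beta d eta e <= 1.
Proof. by apply: beta_le => x y _ _ _; rewrite ge_min lexx. Qed.

Lemma beta_lt1 e : ~~ (1 <= beta d eta e) ->
  forall x y : R, 0 <= x <= 1 -> 0 <= y <= 1 -> `|x - y| <= d -> `|e x - e y| < eta.
Proof.
rewrite -ltNge => b1 x y x01 y01 xy.
have := le_lt_trans (beta_ge e x01 y01 xy) b1.
by rewrite gt_min ltxx/= ltr_pdivrMr// mul1r.
Qed.

Lemma lip_beta : lip 1 (2 / eta) (beta d eta).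
Proof.
suff half (e e' : R -> R) (s : R) : (forall x : R, 0 <= x <= 1 -> `|e x - e' x| <= s) ->
    beta d eta e - beta d eta e' <= 2 / eta * s.
  move=> e e' s ee'; rewrite ler_norml lerNl opprB !half//.
  by move=> x x01; rewrite distrC ee'.
move=> ee'; rewrite lerBlDl; apply: beta_le => x y x01 y01 xy.
have := beta_ge e' x01 y01 xy.
have : `|e x - e y| / eta <= `|e' x - e' y| / eta + 2 / eta * s.
  rewrite mulrAC -mulrDl ler_pM2r ?invr_gt0//.
  have := ee' _ x01; have := ee' _ y01; rewrite !ler_distl.
  move=> /andP[? ?] /andP[? ?].
  have := ler_norm (e' x - e' y); have := ler_norm (e' y - e' x).
  by rewrite (distrC (e' y)) => ? ?; apply/andP; split; lra.
have s0 : 0 <= 2 / eta * s.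
  rewrite mulr_ge0// ?divr_ge0 ?(ltW eta0)//.
  by rewrite (le_trans _ (ee' 0 _))// lexx ler01.
by rewrite !ge_min => h /orP[h1|h1]; apply/orP; [left|right]; lra.
Qed.

(** Chaining: x is reached from 0 in at most x / d + 1 steps of length at most [d], each costing
    less than [eta]. *)
Lemma beta_sup_bound e : 0 < d -> ~~ (1 <= beta d eta e) -> e 0 = 0 ->
  forall x : R, 0 <= x <= 1 -> `|e x| <= eta * (d^-1 + 1).
Proof.
move=> d1 eb e0 x /andP[x0 x1].
suff chain (k : nat) (y : R) : 0 <= y <= 1 -> y <= k%:R * d -> `|e y| <= eta * k%:R.
  have := trunc_itv (divr_ge0 x0 (ltW d1)) => /andP[kx xk].
  have := chain _ x _ _; rewrite x0 x1 => /(_ (Num.truncn (x / d)).+1 isT).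
  rewrite -ler_pdivrMr// => /(_ xk) /le_trans; apply.
  rewrite ler_pM2l// -natr1 lerD2r; apply: le_trans kx _.
  by rewrite ler_piMl// invr_ge0 ltW.
elim: k y => [|k IHk] y /andP[y0 y1].
  rewrite mul0r mulr0 => yle.
  have -> : y = 0 by apply/eqP; rewrite eq_le yle y0.
  by rewrite e0 normr0.
rewrite -natr1 mulrDl mul1r => yk; have [yd|dy] := leP y d.
  have : `|e y - e 0| < eta.
    by apply: beta_lt1 eb _ _ _ _ _; rewrite ?y0 ?lexx ?ler01// subr0 ger0_norm.
  rewrite e0 subr0 mulrDr mulr1 => ?.
  have : 0 <= eta * k%:R by rewrite mulr_ge0// ltW.
  by lra.
have := IHk (y - d); have -> : 0 <= y - d <= 1 by lra.
have -> : y - d <= k%:R * d by lra.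
move=> /(_ isT isT) h1.
have : `|e y - e (y - d)| < eta.
  apply: beta_lt1 eb _ _ _ _ _; rewrite ?y0//; first by lra.
  by rewrite opprB addrC subrK ger0_norm.
have := ler_normD (e y - e (y - d)) (e (y - d)); rewrite subrK mulrDr mulr1.
by lra.
Qed.

End beta_theory.

Lemma walk_take s v t : walk (take s v) t = walk v (Num.min t s%:R) :> R.
Proof.
rewrite -[in RHS](cat_take_drop s v) walk_cat.
have [vs|sv] := leqP (size v) s.
  rewrite take_oversize// drop_oversize//= addr0; case: (leP t s%:R) => // st.
  by rewrite !walk_ge ?ler_nat// (le_trans _ (ltW st))// ler_nat.
have -> : size (take s v) = s by rewrite size_takel// ltnW.
case: (leP t s%:R) => st; first by rewrite [walk (drop _ _) _]walk_le0 ?addr0// subr_le0.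
rewrite subrr [walk (drop _ _) _]walk_le0// addr0 !walk_ge//;
  by rewrite size_takel ?(ltnW sv)// ltW.
Qed.

Lemma exc_nat v j : (0 < size v)%N ->
  exc v (j%:R / (size v)%:R) = (hgt (take j v))%:~R / Num.sqrt (size v)%:R.
Proof.
by move=> v0; rewrite /exc [_ * (_ / _)]mulrC divfK ?walk_nat// pnatr_eq0 -lt0n.
Qed.

Lemma exc0 v : exc v 0 = 0.
Proof. by rewrite /exc mulr0 walk_le0// mul0r. Qed.

Lemma pexc_level_hgt v s : pexc v -> (0 < s <= size v)%N -> 
  (end_level (take s v))%:Z = hgt (take s v) /\ pos (take s v).
Proof.
move=> pv /andP[s0 sv]; suff ps : pos (take s v) by rewrite end_level_hgt.
move: pv; rewrite -[in pexc v](cat_take_drop s v) pexc_cat; first by case/andP.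
by rewrite size_takel.
Qed.

(** * One Lipschitz functional on excursions of two nearby lengths *)

Section compare.
Variables (h : (R -> R) -> R) (m eta kap d : R).
Hypotheses (h01 : forall e, 0 <= h e <= 1) (hlip : lip 1 m h).
Hypotheses (m0 : 0 <= m) (eta0 : 0 < eta) (kap0 : 0 < kap) (kap1 : kap <= 1).
Hypotheses (d0 : 0 < d) (d1 : d <= 4^-1).

Let K := eta * (d^-1 + 1).
(** When [beta] is below 1, [K] bounds the rescaled excursion, so the squared height at step [s] is
    at most [K ^+ 2 * N'], hence at most [4 * K ^+ 2 / d * L], as [N' <= 2 * N] and
    [d * N / 2 <= L]. The summand 1 gives [1 <= lam]. *)
Let lam := 4 * K ^+ 2 / d + 1.
Let c := 2 * lam + 6.
(** Three constraints on N' / N - 1: [d / 4] keeps rescaled times within [d], [eta / K] makes the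
    change of amplitude cost at most [eta], and the last one is what [density_compare] requires. *)
Let eps := Num.min (d / 4) (Num.min (eta / K) (kap * d / (2 * c))).

Let K0 : 0 < K.
Proof. by rewrite mulr_gt0// addr_gt0// invr_gt0. Qed.

Let lam1 : 1 <= lam.
Proof.
rewrite /lam lerDr; apply: divr_ge0; last exact: ltW.
by apply: mulr_ge0 => //; exact: sqr_ge0.
Qed.

Let c0 : 0 < c. Proof. by rewrite /c; move: lam1; lra. Qed.

Let eps0 : 0 < eps.
Proof. by rewrite !lt_min !divr_gt0//= ?mulr_gt0. Qed.

Variables N N' L : nat.
Hypotheses (L_lo : d * N%:R / 2 <= L%:R) (L_hi : L%:R <= 3 / 4 * d * N%:R).
Hypotheses (L_big : lam * 2 <= L%:R).
Hypotheses (Nev : ~~ odd N) (Nev' : ~~ odd N') (NN' : (N <= N')%N).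
Hypothesis N'N : N'%:R <= (1 + eps) * N%:R.

Let L0 : 0 < L%:R :> R. Proof. by apply: lt_le_trans L_big; move: lam1; lra. Qed.

Let Npos : 0 < N%:R :> R.
Proof. by have := lt_le_trans L0 L_hi; rewrite pmulr_rgt0// mulr_gt0//; lra. Qed.

Let NR' : N%:R <= N'%:R :> R. Proof. by rewrite ler_nat. Qed.

Let Npos' : 0 < N'%:R :> R. Proof. exact: lt_le_trans NR'. Qed.

Let eps1 : eps <= d / 4. Proof. by rewrite ge_min lexx. Qed.

Let N'2 : N'%:R <= 2 * N%:R :> R.
Proof.
apply: le_trans N'N _; rewrite ler_pM2r//; move: eps1 d1; lra.
Qed.

Let LN : L%:R <= N%:R / 4 :> R.
Proof. by apply: le_trans L_hi _; move: d1 d0 Npos; nra. Qed.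

(** Length of the common prefix. The [L] steps left are few enough for the tail to stay low and many
    enough for the two prefix densities to be close. *)
Let s := (N - L)%N.

Let LltN : (L < N)%N.
Proof. by rewrite -(ltr_nat R); move: LN Npos; lra. Qed.

Let Ls : (L <= s)%N.
Proof.
by rewrite (leq_subRL _ (ltnW LltN)) -(ler_nat R) natrD; move: LN Npos; lra.
Qed.

Let s0 : (0 < s)%N. Proof. by rewrite subn_gt0. Qed.
Let sN : (s <= N)%N. Proof. exact: leq_subr. Qed.
Let sN' : (s <= N')%N. Proof. exact: leq_trans NN'. Qed.
Let N0 : (0 < N)%N. Proof. exact: leq_trans sN. Qed.
Let N0' : (0 < N')%N. Proof. exact: leq_trans NN'. Qed.
Let sE : s%:R = N%:R - L%:R :> R. Proof. by rewrite natrB// ltnW. Qed.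

Let low u := all (fun j => (hgt (take j u))%:~R <= 2 * eta * Num.sqrt N%:R) (iota 0 L.+1).

(** Good prefixes: the first clause makes [density_compare] applicable; the second controls the
    beginning of the path and, through time reversal, its end. *)
Let G u := ((end_level u)%:R ^+ 2 <= lam * L%:R) && low u.

Let sqrtN' : Num.sqrt N'%:R <= 2 * Num.sqrt N%:R :> R.
Proof.
rewrite -[2](@ger0_norm R)// -sqrtr_sqr -sqrtrM ?sqr_ge0//.
by rewrite ler_sqrt ?mulr_ge0 ?sqr_ge0//; move: N'2 Npos; nra.
Qed.

Let sqrtN0 : 0 < Num.sqrt N%:R :> R. Proof. by rewrite sqrtr_gt0. Qed.
Let sqrtN0' : 0 < Num.sqrt N'%:R :> R. Proof. by rewrite sqrtr_gt0. Qed.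

Let low_take v : low (take s v) = low v.
Proof.
apply: eq_in_all => j; rewrite mem_iota ltnS => /= jL.
by rewrite take_takel// (leq_trans jL Ls).
Qed.

Let good_of_beta v : size v = N' -> pexc v ->
  ~~ (1 <= beta d eta (exc v)) -> G (take s v).
Proof.
move=> vN pv bv; have v0 : (0 < size v)%N by rewrite vN.
apply/andP; split.
  have [|lv _] := @pexc_level_hgt v s pv; first by rewrite s0 vN sN'.
  have s01 : 0 <= (s%:R / (size v)%:R : R) <= 1.
    by rewrite vN divr_ge0//= ler_pdivrMr// mul1r ler_nat.
  have := beta_sup_bound (ltW d0) eta0 d0 bv (exc0 v) s01.
  rewrite exc_nat// -lv vN ger0_norm ?divr_ge0// ler_pdivrMr// => Kl.
  apply: (@le_trans _ _ (K ^+ 2 * N'%:R)).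
    rewrite -[N'%:R in leRHS]sqr_sqrtr// -exprMn lerXn2r ?nnegrE//.
    exact: mulr_ge0 (ltW K0) (sqrtr_ge0 _).
  have : lam * L%:R >= 4 * K ^+ 2 / d * L%:R.
    by rewrite ler_pM2r// /lam lerDl.
  apply: le_trans.
  have -> : 4 * K ^+ 2 / d * L%:R = K ^+ 2 * (4 * (L%:R / d)) by field; rewrite lt0r_neq0.
  rewrite ler_pM2l ?exprn_gt0//.
  have : d * N%:R / 2 / d <= L%:R / d by rewrite ler_pM2r// invr_gt0.
  have -> : d * N%:R / 2 / d = N%:R / 2 by field; rewrite lt0r_neq0.
  by move: N'2; lra.
rewrite low_take; apply/allP => j; rewrite mem_iota ltnS /= => jL.
have j01 : 0 <= (j%:R / (size v)%:R : R) <= 1.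
  rewrite vN divr_ge0//= ler_pdivrMr// mul1r ler_nat (leq_trans jL)//.
  exact: leq_trans Ls sN'.
have o01 : 0 <= (0 : R) <= 1 by rewrite lexx ler01.
have j0d : `|j%:R / (size v)%:R - 0| <= d.
  rewrite subr0 vN ger0_norm ?divr_ge0// ler_pdivrMr//.
  have : j%:R <= L%:R :> R by rewrite ler_nat.
  by move: L_hi NR' d0 Npos; nra.
have := beta_lt1 (ltW d0) eta0 bv j01 o01 j0d; rewrite exc0 subr0 exc_nat// vN.
move=> /(le_lt_trans (ler_norm _)); rewrite ltr_pdivrMr// => /ltW/le_trans; apply.
by rewrite -mulrA mulrCA ler_pM2l.
Qed.

(** The path is frozen after its prefix and rescaled by [N] whatever the length of the excursion, so
    that both lengths test the same function of the prefix. *)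
Let hY u := h (fun x => walk u (N%:R * x) / Num.sqrt N%:R).

Let p := Ex N' (fun v => beta d eta (exc v)).

Let bad' : Ex N' (fun v => (~~ G (take s v))%:R) <= p.
Proof.
apply: le_Ex => // v vN pv; have [Gv|Gv] := boolP (G _); first by rewrite /= beta_ge0// ltW.
by case: (boolP (1 <= beta d eta (exc v))) => // /(good_of_beta vN pv); rewrite (negbTE Gv).
Qed.

Let density_close u : size u = s -> pos u -> G u ->
  `|density N (end_level u) (N - s) - density N' (end_level u) (N' - s)|
   <= kap * density N (end_level u) (N - s).
Proof.
move=> us pu /andP[lev _]; pose j := (N' - N)./2.
have jE : (N' = N + j.*2)%N by rewrite /j; move: Nev Nev' NN'; clear; lia.
have LE : (N - s)%N = L by rewrite subKn// ltnW.
have LE' : (N' - s)%N = (L + j.*2)%N by rewrite jE addnC -addnBA// LE addnC.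
rewrite LE LE' [in density N' _ _]jE.
have /andP[lo hi] : (1 - kap) * density N (end_level u) L <=
   density (N + j.*2) (end_level u) (L + j.*2) <= (1 + kap) * density N (end_level u) L.
  apply: (@density_compare _ _ _ _ _ lam) => //.
  - by rewrite LltN andbT -(ltr_nat R).
  - by rewrite oddD odd_end_level// us /s oddB ?(ltnW LltN)// (negbTE Nev) addFb addbb.
  have : j.*2%:R <= eps * N%:R :> R.
      by have := N'N; rewrite jE natrD mulrDl mul1r lerD2l.
    rewrite -muln2 natrM => j2.
    have : eps * (2 * c) <= kap * d.
      by rewrite -ler_pdivlMr ?mulr_gt0// ge_min ge_min lexx !orbT.
    have := L_lo; have := kap0; have := c0; rewrite -/lam -/c => c0' k0 Llo ec.
    have h1 : c * (j%:R * 2) <= c * (eps * N%:R) by rewrite ler_pM2l.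
    have h2 : eps * (2 * c) * N%:R <= kap * d * N%:R by rewrite ler_pM2r.
    have h3 : kap * (d * N%:R / 2) <= kap * L%:R by rewrite ler_pM2l.
    by lra.
by rewrite ler_distl; move: lo hi; lra.
Qed.

Let Ex_close F : (forall u, 0 <= F u <= 1) ->
  `|Ex N (fun v => (G (take s v))%:R * F (take s v)) -
    Ex N' (fun v => (G (take s v))%:R * F (take s v))| <= kap.
Proof.
move=> F01.
rewrite (@Ex_prefix N s (fun u => (G u)%:R * F u)) ?s0//.
rewrite (@Ex_prefix N' s (fun u => (G u)%:R * F u)) ?s0//.
rewrite -EwB (le_trans (ler_norm_Ew _ _))//.
apply: (@le_trans _ _ (kap * Ex N (fun v => (G (take s v))%:R * F (take s v)))); last first.
  rewrite -[leRHS]mulr1 ler_pM2l//; apply: Ex_le1 => // v _ _.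
  have /andP[F0 F1] := F01 (take s v).
  by case: (G _); rewrite ?mul1r ?mul0r.
rewrite (@Ex_prefix N s (fun u => (G u)%:R * F u)) ?s0// -EwZ.
apply: le_Ew => u us; case: (boolP (pos u)) => pu; last first.
  by rewrite !mul0r subrr normr0 mulr0.
case: (boolP (G u)) => Gu; last by rewrite !(mul0r, mulr0) subrr normr0.
rewrite !mul1r -mulrBr normrM; have /andP[F0 F1] := F01 u.
by rewrite ger0_norm// mulrCA; apply: ler_wpM2l => //; exact: density_close.
Qed.

(** Good prefixes have nearly the same probability at both lengths, by [Ex_close] for the constant
    1; the modulus at length [N'] thus bounds the bad prefixes at length [N]. *)
Let bad : Ex N (fun v => (~~ G (take s v))%:R) <= p + kap.
Proof.
have E1 n : (0 < n)%N -> ~~ odd n -> Ex n (fun v => (~~ G (take s v))%:R) =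
    1 - Ex n (fun v => (G (take s v))%:R * 1) :> R.
  move=> n0 nev; rewrite -[X in _ = X - _](Ex_cst n0 nev) -ExB//; apply: eq_Ex => // v _ _.
  by case: (G _); rewrite ?mulr1 ?subrr ?subr0.
have := @Ex_close (fun=> 1); rewrite ler01 lexx => /(_ (fun=> isT)).
by have := bad'; rewrite !E1// ler_distl; lra.
Qed.

(** After step [s] the path is the beginning of the reversed path, which [low] keeps below
    [2 * eta * Num.sqrt N%:R]; freezing changes it by at most twice that. *)
Let tail_close v : size v = N -> pexc v -> low (rev (map negb v)) ->
  `|h (exc v) - hY (take s v)| <= m * (4 * eta).
Proof.
move=> vN pv lv; apply: hlip => x /andP[x0 x1].
rewrite /exc vN -mulrBl normrM [`|_^-1|]gtr0_norm ?invr_gt0//.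
rewrite ler_pdivrMr// walk_take; case: (leP (N%:R * x) s%:R) => [|sx].
  by rewrite subrr normr0 !mulr_ge0// ltW.
have bnd j : (s <= j <= N)%N -> `|(hgt (take j v))%:~R| <= 2 * eta * Num.sqrt N%:R.
  move=> /andP[sj jN]; rewrite ger0_norm ?ler0z ?pexc_hgt_ge0//.
  have /allP/(_ (N - j)%N) := lv; rewrite mem_iota ltnS /= leq_subLR.
  rewrite (_ : (N <= j + L)%N); last by rewrite -leq_subLR -/s leq_subCl// in sj *; rewrite leq_subCl.
  move=> /(_ isT); rewrite take_rev hgt_rev -map_drop hgt_negb size_map vN subKn//.
  have /pexcP[_ hv _] := pv; move: hv.
  by rewrite -{1}(cat_take_drop j v) hgt_cat => /eqP; rewrite addr_eq0 => /eqP ->.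
have sxN : s%:R <= N%:R * x <= N%:R by rewrite ltW//= ler_piMr.
have := @walk_max R v _ s N _ bnd sxN.
have := @walk_max R v _ s N s%:R bnd; rewrite lexx ler_nat sN => /(_ isT).
have := ler_normB (walk v (N%:R * x)) (walk v s%:R).
by lra.
Qed.

(** Two errors of size [eta]: a time change of at most [d], controlled by the modulus, and the
    amplitude factor sqrt (N' / N), controlled by [eps * K <= eta]. *)
Let head_close v : size v = N' -> pexc v -> ~~ (1 <= beta d eta (exc v)) ->
  `|h (exc v) - hY (take s v)| <= m * (2 * eta).
Proof.
move=> vN pv bv; apply: hlip => x /andP[x0 x1].
rewrite walk_take; set t := Num.min _ _.
have t0 : 0 <= t by rewrite le_min mulr_ge0//= ler0n.
have ts : t <= s%:R by rewrite ge_min lexx orbT.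
have tN : t <= N'%:R by rewrite (le_trans ts)// ler_nat.
have y01 : 0 <= t / N'%:R <= 1 by rewrite divr_ge0//= ler_pdivrMr// mul1r.
have -> : walk v t = exc v (t / N'%:R) * Num.sqrt N'%:R.
  by rewrite /exc vN [_ * (t / _)]mulrC !divfK// lt0r_neq0.
have xy : `|x - t / N'%:R| <= d.
  rewrite -(ler_pM2r Npos') -[X in _ * X <= _](gtr0_norm Npos') -normrM.
  rewrite mulrBl divfK ?lt0r_neq0// ler_norml.
  have NN'd : N'%:R <= N%:R + d / 4 * N%:R.
    by apply: le_trans N'N _; rewrite mulrDl mul1r lerD2l ler_pM2r.
  have sd : N%:R - s%:R <= 3 / 4 * d * N%:R by move: L_hi; rewrite sE; lra.
  have dNN' : d * N%:R <= d * N'%:R by rewrite ler_pM2l.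
  have xN1 : x * (N'%:R - N%:R) <= N'%:R - N%:R by rewrite ler_piMl// subr_ge0.
  have xN0 : 0 <= x * (N'%:R - N%:R) by rewrite mulr_ge0// subr_ge0.
  have xN2 : x * N'%:R <= N'%:R by rewrite ler_piMl.
  have dN0 : 0 <= d * N%:R by rewrite mulr_ge0// ltW.
  have [sx|/ltW sx] := leP (N%:R * x) s%:R.
    rewrite (_ : t = N%:R * x); last by rewrite /t min_l.
    by apply/andP; split; lra.
  rewrite (_ : t = s%:R); last by rewrite /t min_r.
  by apply/andP; split; lra.
have x01 : 0 <= x <= 1 by rewrite x0.
have e1 := beta_lt1 (ltW d0) eta0 bv x01 y01 xy.
have e2 := beta_sup_bound (ltW d0) eta0 d0 bv (exc0 v) y01.
set a := exc v x in e1 *; set b := exc v _ in e1 e2 *.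
rewrite -mulrA; set r := Num.sqrt N'%:R / _.
have r1 : 1 <= r by rewrite ler_pdivlMr// mul1r ler_sqrt// ltW.
have e10 : 0 <= 1 + eps by move: eps0; lra.
have r2 : r <= 1 + eps.
  rewrite ler_pdivrMr// -[1 + eps]ger0_norm// -sqrtr_sqr -sqrtrM ?sqr_ge0//.
  rewrite ler_sqrt ?mulr_ge0 ?sqr_ge0//.
  apply: le_trans N'N _; rewrite ler_pM2r// expr2.
  by move: eps0; nra.
have epsK : eps * K <= eta by rewrite -ler_pdivlMr// ge_min ge_min lexx orbT.
have -> : a - b * r = (a - b) - b * (r - 1) by lra.
have : `|b * (r - 1)| <= eta.
  rewrite normrM mulrC; apply: le_trans epsK; apply: ler_pM => //.
  by rewrite ger0_norm; lra.
have := ler_normB (a - b) (b * (r - 1)); move: e1; lra.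
Qed.

(** The path is frozen at step [s] for length [N], the two prefix laws are exchanged, and the path
    is released for length [N']; the costs are [step1], [step2] and [step3]. *)
Lemma exc_compare_at : `|Ex N (fun v => h (exc v)) - Ex N' (fun v => h (exc v))| <=
  6 * m * eta + 3 * kap + 4 * p.
Proof.
have dist01 (a b : R) : 0 <= a <= 1 -> 0 <= b <= 1 -> `|a - b| <= 1.
  by move=> /andP[? ?] /andP[? ?]; rewrite ler_norml; lra.
have me : 0 <= m * eta by rewrite mulr_ge0// ltW.
have step1 : `|Ex N (fun v => h (exc v)) - Ex N (fun v => hY (take s v))| <=
    m * (4 * eta) + (p + kap).
  apply: (@le_trans _ _ (Ex N (fun v => m * (4 * eta) + (~~ low (rev (map negb v)))%:R))).
    apply: ler_dist_Ex => // v vN pv; case: (boolP (low _)) => lv /=.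
      by rewrite addr0; exact: tail_close.
    apply: (@le_trans _ _ 1); first exact: dist01 (h01 _) (h01 _).
    by rewrite lerDr; move: me; lra.
  rewrite ExD// Ex_cst// lerD2l.
  (* Reversal turns the condition on the last [L] steps into one on the first [L], which is part of
     being a good prefix. *)
  rewrite (Ex_rev N (fun v => (~~ low v)%:R)); apply: le_trans bad.
  apply: le_Ex => // v vN pv; rewrite /G low_take.
  by case: (low v) => /=; rewrite ?andbF.
have step2 : `|Ex N (fun v => hY (take s v)) - Ex N' (fun v => hY (take s v))| <=
    2 * kap + 2 * p.
  have split_ n : (0 < n)%N -> ~~ odd n -> Ex n (fun v => hY (take s v)) =
      Ex n (fun v => (G (take s v))%:R * hY (take s v)) +
      Ex n (fun v => (~~ G (take s v))%:R * hY (take s v)).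
    move=> n0 nev; rewrite -ExD//; apply: eq_Ex => // v _ _.
    by case: (G _) => /=; rewrite !(mul1r, mul0r) ?addr0 ?add0r.
  have small n : (0 < n)%N -> ~~ odd n ->
      0 <= Ex n (fun v => (~~ G (take s v))%:R * hY (take s v)) <=
      Ex n (fun v => (~~ G (take s v))%:R).
    move=> n0 nev; apply/andP; split.
      by apply: Ex_ge0 => // v _ _; rewrite mulr_ge0//; case/andP: (h01 (fun x => walk (take s v) (N%:R * x) / Num.sqrt N%:R)).
    apply: le_Ex => // v _ _; rewrite ler_piMr//.
    by case/andP: (h01 (fun x => walk (take s v) (N%:R * x) / Num.sqrt N%:R)).
  have /andP[a1 a2] := small N N0 Nev; have /andP[b1 b2] := small N' N0' Nev'.
  rewrite (split_ N)// (split_ N')//.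
  have := @Ex_close hY (fun=> h01 _).
  have := bad; have := bad'; rewrite !ler_norml; move: a1 a2 b1 b2 => /=; lra.
have step3 : `|Ex N' (fun v => h (exc v)) - Ex N' (fun v => hY (take s v))| <=
    m * (2 * eta) + p.
  apply: (@le_trans _ _ (Ex N' (fun v => m * (2 * eta) + beta d eta (exc v)))).
    apply: ler_dist_Ex => // v vN pv.
    case: (boolP (1 <= beta d eta (exc v))) => bv.
      apply: (@le_trans _ _ 1); first exact: dist01 (h01 _) (h01 _).
      by move: bv me; lra.
    apply: le_trans (head_close vN pv bv) _.
    by rewrite lerDl beta_ge0// ltW.
  by rewrite ExD// Ex_cst.
move: step1 step2 step3; rewrite !ler_norml; lra.
Qed.

End compare.

Lemma exc_compare h (m eta kap d : R) : (forall e, 0 <= h e <= 1) -> lip 1 m h ->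
  0 <= m -> 0 < eta -> 0 < kap <= 1 -> 0 < d <= 4^-1 ->
  exists2 eps : R, 0 < eps & exists N0 : nat, forall N N' : nat,
    (N0 <= N)%N -> ~~ odd N -> ~~ odd N' -> (N <= N')%N ->
    N'%:R <= (1 + eps) * N%:R ->
    `|Ex N (fun v => h (exc v)) - Ex N' (fun v => h (exc v))| <=
      6 * m * eta + 3 * kap + 4 * Ex N' (fun v => beta d eta (exc v)).
Proof.
move=> h01 hl m0 eta0 /andP[k0 k1] /andP[d0 d1].
set K := eta * (d^-1 + 1); set lam := 4 * K ^+ 2 / d + 1.
set c := 2 * lam + 6.
exists (Num.min (d / 4) (Num.min (eta / K) (kap * d / (2 * c)))).
  have K0 : 0 < K by rewrite mulr_gt0// addr_gt0// invr_gt0.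
  have lam0 : 0 <= 4 * K ^+ 2 / d.
    apply: divr_ge0; last exact: ltW.
    by apply: mulr_ge0 => //; exact: sqr_ge0.
  have c0 : 0 < c by rewrite /c /lam; move: lam0; lra.
  by rewrite !lt_min !divr_gt0//= ?mulr_gt0.
have lam0 : 0 <= lam.
  rewrite addr_ge0//; apply: divr_ge0; last exact: ltW.
  by apply: mulr_ge0 => //; exact: sqr_ge0.
(* Large enough for the integer part of 3dN/4 to be at least both dN/2 and 2 lam. *)
exists (Num.truncn ((4 + 8 * lam) / d)).+1 => N N' NN0 Nev Nev' NN' N'N.
have Nbig : 4 + 8 * lam <= d * N%:R.
  rewrite [d * _]mulrC -ler_pdivrMr//; apply: le_trans (ltW (truncnS_gt _)) _.
  by rewrite ler_nat.
have := @truncn_itv _ (3 / 4 * d * N%:R) _.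
have -> : 0 <= 3 / 4 * d * N%:R by rewrite !mulr_ge0// ?ltW//; lra.
move=> /(_ isT); set L := Num.truncn _; rewrite -(@natr1 _ L) => /andP[L1 L2].
apply: (@exc_compare_at _ _ _ _ _ h01 hl m0 eta0 k0 k1 d0 d1 N N' L) => //.
- by lra.
- by rewrite -/K -/lam; lra.
Qed.

End excursions.

(** * The de Moivre-Laplace theorem *)

Section normal_cdf.
Context {R : realType}.
Variable sigma : R.
Hypothesis sigma0 : 0 < sigma.
Implicit Types x y C : R.

Local Notation mu := (normal_prob 0 sigma).

Definition Phi x : R := fine (mu `]-oo, x[).

Lemma normal_prob_fin (A : set R) : measurable A -> mu A \is a fin_num.
Proof. by move=> mA; apply: fin_num_measure. Qed.

Lemma Phi_ge0 x : 0 <= Phi x. Proof. exact: fine_ge0. Qed.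

Lemma Phi_le1 x : Phi x <= 1.
Proof. by rewrite -lee_fin fineK ?normal_prob_fin// probability_le1. Qed.

Lemma Phi_diff x y : x <= y -> mu `[x, y[ = (Phi y - Phi x)%:E.
Proof.
move=> xy; have -> : mu `[x, y[ = (mu `]-oo, y[ - mu `]-oo, x[)%E.
  rewrite (_ : `]-oo, y[%classic = `]-oo, x[ `|` `[x, y[); last first.
    by rewrite -itv_bndbnd_setU// bnd_simp.
  rewrite measureU//; last first.
    by apply/seteqP; split => z //= []; rewrite !in_itv/= => zx /andP[]; rewrite leNgt zx.
  by rewrite addeAC subee ?add0e// normal_prob_fin.
by rewrite EFinB !fineK// normal_prob_fin.
Qed.

Lemma Phi_homo x y : x <= y -> Phi x <= Phi y.
Proof. by move=> xy; rewrite -subr_ge0 -lee_fin -Phi_diff. Qed.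

Lemma Phi_diff_le x y C : x <= y -> (forall z, x <= z < y -> normal_pdf 0 sigma z <= C) ->
  Phi y - Phi x <= C * (y - x).
Proof.
move=> xy pC; rewrite -lee_fin -Phi_diff//.
apply: (@le_trans _ _ (\int[lebesgue_measure]_(z in `[x, y[) (cst C%:E) z)%E); last first.
  rewrite integral_cst//= lebesgue_measure_itv/= lte_fin.
  case: ltP => [_|yx]; first by rewrite -EFinB -EFinM.
  by rewrite mule0 lee_fin (@le_anti _ R x y) ?xy// subrr mulr0.
apply: ge0_le_integral => //=.
- by move=> z _; rewrite lee_fin normal_pdf_ge0.
- by apply/measurable_EFinP/measurable_funTS; exact: measurable_normal_pdf.
Qed.

Lemma Phi_diff_ge x y C : 0 <= C -> x <= y ->
  (forall z, x <= z < y -> C <= normal_pdf 0 sigma z) ->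
  C * (y - x) <= Phi y - Phi x.
Proof.
move=> C0 xy pC; rewrite -lee_fin -Phi_diff//.
apply: (@le_trans _ _ (\int[lebesgue_measure]_(z in `[x, y[) (cst C%:E) z)%E).
  rewrite integral_cst//= lebesgue_measure_itv/= lte_fin.
  case: ltP => [_|yx]; first by rewrite -EFinB -EFinM.
  by rewrite mule0 lee_fin (@le_anti _ R x y) ?xy// subrr mulr0.
apply: ge0_le_integral => //=.
- by apply/measurable_EFinP/measurable_funTS; exact: measurable_normal_pdf.
Qed.

Lemma Phi_lip x y : x <= y -> Phi y - Phi x <= normal_peak sigma * (y - x).
Proof. by move=> xy; apply: Phi_diff_le => // z _; rewrite normal_pdf_ub ?lt0r_neq0. Qed.

Lemma Phi_tails e : 0 < e -> exists A0 : R, forall A, A0 <= A -> Phi (- A) <= e /\ 1 - e <= Phi A.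
Proof.
move=> e0; pose F (n : nat) : set R := `[- n%:R, n%:R[%classic.
have FT : \bigcup_n F n = setT.
  apply/seteqP; split => // x _; exists (Num.truncn `|x|).+1 => //.
  rewrite /F /= in_itv/=; have := truncnS_gt `|x|; rewrite ltr_norml => /andP[/ltW -> ->].
  by [].
have : mu \o F @ \oo --> mu (\bigcup_n F n).
  apply: (@nondecreasing_cvg_mu _ _ _ mu F) => [i||m n mn].
  - exact: measurable_itv.
  - by apply: bigcup_measurable => i _; exact: measurable_itv.
  - apply/subsetPset => x; rewrite /F/= !in_itv/= => /andP[x1 x2].
  by rewrite (le_trans _ x1) ?(lt_le_trans x2) ?lerN2 ?ler_nat.
rewrite FT probability_setT => /fine_cvgP[_ /cvgrPdist_le/(_ e e0)][n _ /(_ n (leqnn n))].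
rewrite /= /F Phi_diff; last by rewrite (@le_trans _ _ 0)// oppr_le0.
rewrite ler_norml => /andP[_ h]; exists n%:R => A nA.
have := Phi_homo nA; have := Phi_homo (_ : - A <= - n%:R); rewrite lerN2 => /(_ nA).
have := Phi_ge0 (- n%:R); have := Phi_le1 n%:R; move: h => /=; lra.
Qed.

End normal_cdf.

Section de_moivre_laplace.
Context {R : realType}.

Definition binR M j : R := 'C(M.*2, M + j)%:R.

Lemma binR_gt0 M j : (j <= M)%N -> 0 < binR M j.
Proof. by move=> jM; rewrite ltr0n bin_gt0 -addnn leq_add2l. Qed.

Lemma binRS M j : (M + j).+1%:R * binR M j.+1 = (M - j)%:R * binR M j.
Proof. by rewrite -!natrM addnS mul_bin_left -addnn subnDl. Qed.

(** Consecutive weights have ratio 1 - (2j + 1) / (M + j + 1), bounded by an exponential, and the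
    odd numbers add up to j^2. The lower bound [binR_lb] treats the inverse ratio 1 + (2j + 1) / (M
    - j) in the same way. *)
Lemma binR_ub M j : (j <= M)%N ->
  binR M j <= binR M 0 * expR (- (j%:R ^+ 2 / (M + j)%:R)).
Proof.
elim: j => [|j IHj] jM; first by rewrite expr0n/= mul0r oppr0 expR0 mulr1.
have Mj : 0 < (M + j).+1%:R :> R by rewrite ltr0n.
have Mj' : 0 < (M + j)%:R :> R by rewrite ltr0n addn_gt0 (leq_ltn_trans _ jM).
rewrite -(ler_pM2l Mj) binRS.
apply: (@le_trans _ _ ((M - j)%:R * (binR M 0 * expR (- (j%:R ^+ 2 / (M + j).+1%:R))))).
  apply: ler_wpM2l => //; apply: le_trans (IHj (ltnW jM)) _.
  rewrite ler_pM2l ?binR_gt0// ler_expR lerN2.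
  by rewrite ler_wpM2l ?sqr_ge0// lef_pV2 ?posrE// ler_nat.
have -> : - (j.+1%:R ^+ 2 / (M + j.+1)%:R) =
   - (j%:R ^+ 2 / (M + j).+1%:R) + - ((2 * j%:R + 1) / (M + j).+1%:R) :> R.
  by rewrite addnS -opprD -mulrDl -(@natr1 _ j); congr (- (_ / _)); ring.
rewrite expRD.
have E0 : 0 <= binR M 0 * expR (- (j%:R ^+ 2 / (M + j).+1%:R)).
  by rewrite mulr_ge0 ?expR_ge0// ltW// binR_gt0.
have key : (M - j)%:R <= (M + j).+1%:R * expR (- ((2 * j%:R + 1) / (M + j).+1%:R)) :> R.
  apply: le_trans (ler_wpM2l (ltW Mj) (expR_ge1Dx _)).
  rewrite mulrDr mulr1 mulrN mulrC divfK ?lt0r_neq0// natrB ?(ltnW jM)//.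
  by rewrite -(@natr1 _ (M + j)) natrD; lra.
by have := ler_wpM2l E0 key; lra.
Qed.

Lemma binR_lb M j : (j <= M)%N ->
  binR M 0 * expR (- (j%:R ^+ 2 / (M + 1 - j)%:R)) <= binR M j.
Proof.
elim: j => [|j IHj] jM; first by rewrite expr0n/= mul0r oppr0 expR0 mulr1.
have Mj : 0 < (M + j).+1%:R :> R by rewrite ltr0n.
have Mj' : 0 < (M - j)%:R :> R by rewrite ltr0n subn_gt0.
rewrite -(ler_pM2l Mj) binRS; apply: le_trans (ler_wpM2l (ltW Mj') (IHj (ltnW jM))).
have -> : (M + 1 - j.+1)%N = (M - j)%N by rewrite addn1 subSS.
have -> : j.+1%:R ^+ 2 / (M - j)%:R =
   j%:R ^+ 2 / (M - j)%:R + (2 * j%:R + 1) / (M - j)%:R :> R.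
  by rewrite -mulrDl -(@natr1 _ j); congr (_ / _); ring.
have le1 : expR (- (j%:R ^+ 2 / (M - j)%:R)) <= expR (- (j%:R ^+ 2 / (M + 1 - j)%:R)) :> R.
  rewrite ler_expR lerN2 ler_wpM2l ?sqr_ge0// lef_pV2 ?posrE// ?ltr0n ?subn_gt0//.
    by rewrite ler_nat leq_sub2r// addn1.
  by rewrite addn1 ltnW.
have key : (M + j).+1%:R * expR (- ((2 * j%:R + 1) / (M - j)%:R)) <= (M - j)%:R :> R.
  rewrite expRN -ler_pdivlMr ?invr_gt0 ?expR_gt0// invrK.
  apply: le_trans (ler_wpM2l (ltW Mj') (expR_ge1Dx _)).
  rewrite mulrDr mulr1 mulrC divfK ?lt0r_neq0// natrB ?(ltnW jM)//.
  by rewrite -(@natr1 _ (M + j)) natrD; lra.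
rewrite opprD expRD.
have B0 : 0 <= binR M 0 by rewrite ltW// binR_gt0.
have := ler_wpM2l (mulr_ge0 B0 (expR_ge0 (- (j%:R ^+ 2 / (M - j)%:R)))) key.
have := ler_wpM2l (mulr_ge0 B0 (ltW Mj')) le1.
lra.
Qed.

Lemma Ew_count n (G : nat -> R) :
  Ew n (fun w => G (count id w)) = 2 ^- n * \sum_(k < n.+1) 'C(n, k)%:R * G k.
Proof.
elim: n G => [|n IHn] G /=.
  by rewrite expr0 invr1 mul1r big_ord_recl big_ord0 addr0 bin0 mul1r.
rewrite (IHn (fun k => G k.+1)) (IHn G) -mulrDr exprS invfM -[RHS]mulrA [RHS]mulrC.
congr (_ * _ / _).
rewrite [RHS]big_ord_recl bin0 [X in _ + X = _]big_ord_recl bin0.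
under [X in _ + (_ + X) = _]eq_bigr do rewrite lift0.
under [X in _ = _ + X]eq_bigr do rewrite lift0 binS natrD mulrDl.
rewrite big_split/= [X in _ = _ + (X + _)]big_ord_recr/= bin_small// mul0r addr0.
by rewrite addrC addrA addrAC -addrA; congr (_ + _); rewrite addrC.
Qed.

Lemma ler_frac (x y z w : R) : 0 < y -> 0 < w -> x * w <= z * y -> x / y <= z / w.
Proof. by move=> y0 w0 xwzy; rewrite ler_pdivrMr// mulrAC ler_pdivlMr. Qed.

(** [IT] and [IB] are the normal masses of all central cells and of those below the threshold, [ST]
    and [SB] the binomial ones, [o] the binomial mass outside. Both totals are close to 1, which
    pins the unknown [c] near 1; the lower parts [E] and [F] then agree. *)
Lemma mass_ratio_arith (c rho del F E o IT IB ST SB : R) :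
  c * IT <= rho * ST -> ST <= rho * (c * IT) ->
  c * IB <= rho * SB -> SB <= rho * (c * IB) ->
  E <= SB + o -> 1 <= ST + o -> SB <= E -> 0 <= IB -> 1 <= rho ->
  F <= 1 -> 0 <= F -> rho <= 1 + del -> 0 < del -> del <= 8^-1 -> 0 < c ->
  F - 2 * del <= IB -> IB <= F + del -> IT <= 1 -> 1 - 2 * del <= IT ->
  ST <= 1 -> o <= del -> `|E - F| <= 20 * del.
Proof.
move=> T1 T2 B1 B2 SBE STE ESB IB0 rho1 P1 P0 rd d0 d4 c0 Il Iu IT2 IT1 ST1 od.
have rST : rho * ST <= rho * 1 by rewrite ler_pM2l//; lra.
have c2 : c * (1 - 2 * del) <= 1 + del.
  by have := ler_wpM2l (ltW c0) IT1; lra.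
have c3 : c <= 1 + 6 * del.
  have : (1 + del) * 1 <= (1 + 6 * del) * (1 - 2 * del) by nra.
  by rewrite mulr1 => /(le_trans c2); rewrite ler_pM2r//; lra.
have cIT0 : 0 <= c * IT by rewrite mulr_ge0 ?ltW//; lra.
have c1 : 1 - del <= (1 + del) * c.
  have := ler_wpM2r cIT0 rd; have : c * IT <= c * 1 by rewrite ler_pM2l.
  by move=> h; have := ler_wpM2l (_ : 0 <= 1 + del) h; rewrite mulr1 => /(_ _)/wrap[]; lra.
have SB0 : 0 <= SB by have := ler_wpM2l (ltW c0) IB0; rewrite mulr0; nra.
have E0 : 0 <= E by lra.
have up : E <= (1 + del) * ((1 + 6 * del) * (F + del)) + del.
  have h1 : c * IB <= (1 + 6 * del) * (F + del) by apply: ler_pM => //; exact: ltW.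
  have h2 : rho * (c * IB) <= (1 + del) * ((1 + 6 * del) * (F + del)).
    by apply: ler_pM => //; [lra|rewrite mulr_ge0// ltW].
  lra.
have lo : (1 - del) * IB <= (1 + del) * ((1 + del) * E).
  have h1 : (1 - del) * IB <= (1 + del) * c * IB by apply: ler_wpM2r.
  have h2 : rho * SB <= (1 + del) * E by apply: ler_pM => //; lra.
  have h3 : (1 + del) * (c * IB) <= (1 + del) * ((1 + del) * E).
    by rewrite ler_pM2l; lra.
  lra.
have dd : del * del <= del / 8 by rewrite ler_pM2l.
rewrite ler_norml; apply/andP; split; last first.
  have h1 : (1 + del) * (1 + 6 * del) <= 1 + 8 * del by lra.
  have h2 : (1 + del) * ((1 + 6 * del) * (F + del)) <= (1 + 8 * del) * (F + del).
    by rewrite mulrA; apply: ler_wpM2r => //; lra.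
  have h3 : del * F <= del * 1 by rewrite ler_pM2l.
  lra.
have lo2 : (1 - 3 * del) * IB <= E.
  have d2 : 0 < (1 + del) ^+ 2 by rewrite exprn_gt0//; lra.
  rewrite -(ler_pM2l d2); apply: le_trans (_ : (1 - del) * IB <= _).
    rewrite mulrA; apply: ler_wpM2r => //.
    have : 0 <= del * del by rewrite mulr_ge0// ltW.
    have : 0 <= del * del * del by rewrite !mulr_ge0// ltW.
    by rewrite expr2; clear; lra.
  by rewrite expr2 -mulrA.
have : del * IB <= del * 2 by rewrite ler_pM2l//; lra.
lra.
Qed.

Lemma count_hgt w : hgt w = (count id w).*2%:Z - (size w)%:Z.
Proof.
by elim: w => [|b w IHw]; rewrite ?hgt_nil// hgt_cons IHw; case: b => /=; lia.
Qed.

(* Cell by cell, the binomial weights are a constant multiple of the normal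
   masses of the cells, up to a factor close to [1]; the constant is then
   determined by total mass and Chebyshev's inequality. *)
Section cells.
Variables (sigma A : R) (M J : nat).
Hypotheses (sigma0 : 0 < sigma) (A1 : 1 <= A) (M0 : (0 < M)%N).
Hypotheses (JA : J%:R <= A * Num.sqrt M%:R) (J4 : A * Num.sqrt M%:R * 4 <= M%:R).

(** Spacing of the atoms of the rescaled height: changing one letter moves the height by 2. The atom
    with [k] up steps is [pt k]. *)
Let mesh : R := 2 * sigma / Num.sqrt M.*2%:R.
Let pt (k : nat) : R := mesh * (k%:R - M%:R).
Let bw (k : nat) : R := 2 ^- M.*2 * 'C(M.*2, k)%:R.
Let c : R := bw M / (mesh * normal_peak sigma).
(** Product of the error [4 * A ^+ 3] on the binomial weights and of the error [4 * A + 4] on the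
    normal density inside a cell, simplified with [A <= A ^+ 3]. *)
Let rho : R := expR ((8 * A ^+ 3 + 8) / Num.sqrt M%:R).

Let sqM : Num.sqrt M.*2%:R = Num.sqrt 2 * Num.sqrt M%:R :> R.
Proof. by rewrite -mul2n natrM sqrtrM. Qed.

Let s0 : 0 < Num.sqrt M%:R :> R. Proof. by rewrite sqrtr_gt0 ltr0n. Qed.

Let s2 : Num.sqrt M%:R ^+ 2 = M%:R :> R. Proof. by rewrite sqr_sqrtr. Qed.

Let mesh0 : 0 < mesh.
Proof. by rewrite divr_gt0 ?mulr_gt0// sqM mulr_gt0// sqrtr_gt0. Qed.

Let mesh2 : mesh ^+ 2 = 2 * sigma ^+ 2 / M%:R.
Proof.
rewrite /mesh expr_div_n exprMn sqr_sqrtr// -mul2n natrM.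
by field; rewrite pnatr_eq0 -lt0n.
Qed.

Let pdfE z : normal_pdf 0 sigma z = normal_peak sigma * expR (- (z ^+ 2 / (2 * sigma ^+ 2))).
Proof.
by rewrite /normal_pdf (negbTE (lt0r_neq0 sigma0)) /normal_fun subr0 mulNr mulr_natl.
Qed.

Let dist (k : nat) : R := k%:R - M%:R.

(** The exponents of [binR_ub] and [binR_lb] differ from j^2 / M by O(j^3 / M^2), which is O(A^3 /
    sqrt M) on the central cells. *)
Let bw_bounds k : `|dist k| <= J%:R ->
  bw M * expR (- (dist k ^+ 2 / M%:R)) <= expR (4 * A ^+ 3 / Num.sqrt M%:R) * bw k /\
  bw k <= bw M * expR (4 * A ^+ 3 / Num.sqrt M%:R) * expR (- (dist k ^+ 2 / M%:R)).
Proof.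
move=> kJ.
have [j [jJ jd jb]] : exists j : nat, [/\ (j <= J)%N, j%:R ^+ 2 = dist k ^+ 2 &
    bw k = 2 ^- M.*2 * binR M j].
  have [Mk|kM] := leqP M k.
    exists (k - M)%N; split.
    - by rewrite -(ler_nat R) natrB// -(ger0_norm (_ : 0 <= _ - _)) // subr_ge0 ler_nat.
    - by rewrite natrB.
    - by rewrite /binR subnKC.
  exists (M - k)%N; split.
  - rewrite -(ler_nat R) natrB ?(ltnW kM)// -(ger0_norm (_ : 0 <= _ - _)).
      by rewrite distrC.
    by rewrite subr_ge0 ler_nat ltnW.
  - by rewrite natrB ?(ltnW kM)// -sqrrN opprB.
  - rewrite /binR /bw; have -> : (M + (M - k) = M.*2 - k)%N by move: kM; rewrite -addnn; clear; lia.
    by rewrite bin_sub// -addnn (leq_trans (ltnW kM))// leq_addr.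
have bwM : bw M = 2 ^- M.*2 * binR M 0 by rewrite /binR addn0.
have jR : j%:R <= A * Num.sqrt M%:R by apply: le_trans JA; rewrite ler_nat.
have jM : (j <= M)%N by rewrite -(ler_nat R); move: J4 jR (ler0n R j); lra.
have p2 : 0 < 2 ^- M.*2 :> R by rewrite invr_gt0 exprn_gt0.
have MR : 0 < M%:R :> R by rewrite ltr0n.
have jM2 : (M + 1 - j)%:R = M%:R + 1 - j%:R :> R by rewrite natrB ?natrD// addn1 leqW.
have j3 : j%:R ^+ 3 <= A ^+ 3 * Num.sqrt M%:R ^+ 3.
  by rewrite -exprMn lerXn2r// nnegrE ?ler0n// mulr_ge0// ltW// (lt_le_trans _ A1).
have err0 : j%:R ^+ 3 / M%:R ^+ 2 <= A ^+ 3 / Num.sqrt M%:R.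
  have -> : M%:R ^+ 2 = Num.sqrt M%:R ^+ 4 :> R by rewrite -[in LHS]s2 -exprM.
  rewrite ler_pdivrMr ?exprn_gt0//; apply: le_trans j3 _.
  rewrite -[leRHS]mulrA ler_pM2l ?exprn_gt0 ?(lt_le_trans _ A1)//.
  by rewrite [_ ^+ 4]exprS mulKf// lt0r_neq0.
rewrite jb bwM -jd; split.
  rewrite [leRHS]mulrCA -[leLHS]mulrA ler_pM2l//.
  apply: le_trans (ler_wpM2l (expR_ge0 _) (binR_lb jM)).
  rewrite [leRHS]mulrCA ler_pM2l ?binR_gt0// -expRD ler_expR jM2.
  suff : j%:R ^+ 2 / (M%:R + 1 - j%:R) - j%:R ^+ 2 / M%:R <= 4 * (j%:R ^+ 3 / M%:R ^+ 2) :> R.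
    by move: err0; lra.
  have Mj : M%:R / 2 <= M%:R + 1 - j%:R :> R by move: J4 jR; lra.
  have Mj0 : 0 < M%:R + 1 - j%:R :> R by apply: lt_le_trans Mj; rewrite divr_gt0.
  have -> : j%:R ^+ 2 / (M%:R + 1 - j%:R) - j%:R ^+ 2 / M%:R =
     j%:R ^+ 2 * (j%:R - 1) / (M%:R * (M%:R + 1 - j%:R)) :> R.
    by field; rewrite !lt0r_neq0.
  rewrite mulrA; apply: ler_frac; rewrite ?mulr_gt0 ?exprn_gt0//.
  have j0 : 0 <= j%:R :> R by [].
  have h1 : 0 <= j%:R ^+ 2 :> R by rewrite sqr_ge0.
  have h2 : M%:R ^+ 2 <= 4 * (M%:R * (M%:R + 1 - j%:R)) :> R by nra.
  have h3 : j%:R ^+ 2 * (j%:R - 1) <= j%:R ^+ 3 :> R by rewrite [_ ^+ 3]exprSr; nra.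
  have h4 : 0 <= j%:R ^+ 3 :> R by rewrite exprn_ge0.
  have h5 : 0 <= M%:R ^+ 2 :> R by rewrite sqr_ge0.
  apply: (@le_trans _ _ (j%:R ^+ 3 * M%:R ^+ 2)); first by apply: ler_wpM2r.
  by have := ler_wpM2l h4 h2; lra.
rewrite -!mulrA ler_pM2l//; apply: le_trans (binR_ub jM) _.
rewrite ler_pM2l ?binR_gt0// -expRD ler_expR natrD.
suff : j%:R ^+ 2 / M%:R - j%:R ^+ 2 / (M%:R + j%:R) <= 4 * (j%:R ^+ 3 / M%:R ^+ 2) :> R.
  by move: err0; lra.
have Mj0 : 0 < M%:R + j%:R :> R by rewrite ltr_wpDr.
have -> : j%:R ^+ 2 / M%:R - j%:R ^+ 2 / (M%:R + j%:R) =
   j%:R ^+ 3 / (M%:R * (M%:R + j%:R)) :> R.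
  by field; rewrite !lt0r_neq0.
rewrite mulrA; apply: ler_frac; rewrite ?mulr_gt0 ?exprn_gt0//.
have h4 : 0 <= j%:R ^+ 3 :> R by rewrite exprn_ge0.
have h2 : M%:R ^+ 2 <= 4 * (M%:R * (M%:R + j%:R)) :> R.
  by have : 0 <= j%:R :> R by []; nra.
by have := ler_wpM2l h4 h2; lra.
Qed.

Let cell_pdf k z : `|dist k| <= J%:R -> pt k <= z <= pt k.+1 ->
  expR (- ((4 * A + 4) / Num.sqrt M%:R)) * (normal_peak sigma * expR (- (dist k ^+ 2 / M%:R)))
  <= normal_pdf 0 sigma z <=
  expR ((4 * A + 4) / Num.sqrt M%:R) * (normal_peak sigma * expR (- (dist k ^+ 2 / M%:R))).
Proof.
move=> kJ zk; rewrite pdfE.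
have peak0 : 0 < normal_peak sigma by rewrite normal_peak_gt0// lt0r_neq0.
have ptE : pt k = mesh * dist k by [].
have ptSE : pt k.+1 = mesh * dist k + mesh by rewrite /pt /dist -(@natr1 _ k); lra.
set u := z / mesh.
have zu : z = mesh * u by rewrite /u mulrC divfK// lt0r_neq0.
have ud : dist k <= u <= dist k + 1.
  have e : mesh * (dist k + 1) = pt k.+1 by rewrite ptSE; ring.
  by rewrite -(ler_pM2l mesh0 (dist k)) -(ler_pM2l mesh0 u) e -zu.
have -> : z ^+ 2 / (2 * sigma ^+ 2) = u ^+ 2 / M%:R.
  rewrite zu exprMn mesh2; field.
  by rewrite pnatr_eq0 -lt0n M0 lt0r_neq0.
have close : `|u ^+ 2 / M%:R - dist k ^+ 2 / M%:R| <= (4 * A + 4) / Num.sqrt M%:R.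
  rewrite -mulrBl normrM [`|_^-1|]ger0_norm ?invr_ge0// ler_pdivrMr ?ltr0n//.
  have -> : (4 * A + 4) / Num.sqrt M%:R * M%:R = (4 * A + 4) * Num.sqrt M%:R.
    by rewrite -{2}s2 expr2 mulrA divfK// lt0r_neq0.
  have s1 : 1 <= Num.sqrt M%:R :> R.
    by rewrite -[leLHS]sqrtr1 ler_sqrt// ler1n.
  have := le_trans kJ JA; rewrite ler_norml => /andP[d1 d2].
  rewrite ler_norml; move: ud => /andP[u1 u2].
  set d := dist k in u1 u2 d1 d2 *; set s := Num.sqrt _ in s1 d1 d2 *.
  have -> : u ^+ 2 - d ^+ 2 = (u - d) * (u + d) by ring.
  have : A >= 1 by [].
  by move=> ?; apply/andP; split; nra.
rewrite !(mulrCA (expR _) (normal_peak sigma)) !ler_pM2l// -!expRD !ler_expR.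
by move: close; rewrite ler_norml; lra.
Qed.

Let peak0 : 0 < normal_peak sigma. Proof. by rewrite normal_peak_gt0// lt0r_neq0. Qed.

Let bw0 k : 0 <= bw k.
Proof. by rewrite mulr_ge0// invr_ge0 exprn_ge0. Qed.

Let bwM0 : 0 < bw M.
Proof. by rewrite mulr_gt0 ?invr_gt0 ?exprn_gt0// ltr0n bin_gt0 -addnn leq_addr. Qed.

Let c0 : 0 < c. Proof. by rewrite divr_gt0// mulr_gt0. Qed.

Let rhoE : expR ((4 * A + 4) / Num.sqrt M%:R) * expR (4 * A ^+ 3 / Num.sqrt M%:R) <= rho.
Proof.
rewrite -expRD ler_expR -mulrDl ler_pM2r ?invr_gt0//.
have : A <= A ^+ 3 by rewrite exprS ler_peMr ?exprn_ege1// ltW// (lt_le_trans _ A1).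
lra.
Qed.

Let pt_mono k : pt k <= pt k.+1.
Proof. by rewrite /pt -(@natr1 _ k) ler_pM2l//; lra. Qed.

Let ptB k : pt k.+1 - pt k = mesh.
Proof. by rewrite /pt -(@natr1 _ k); lra. Qed.

Let dPhi k := Phi sigma (pt k.+1) - Phi sigma (pt k).

Let cells_close k : `|dist k| <= J%:R ->
  c * dPhi k <= rho * bw k /\ bw k <= rho * (c * dPhi k).
Proof.
move=> kJ; have [b1 b2] := bw_bounds kJ.
set E := expR (- (dist k ^+ 2 / M%:R)) in b1 b2.
set r1 := expR ((4 * A + 4) / Num.sqrt M%:R).
set r2 := expR (4 * A ^+ 3 / Num.sqrt M%:R) in b1 b2.
have E0 : 0 < E by exact: expR_gt0.
have r10 : 0 < r1 by exact: expR_gt0.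
have r20 : 0 < r2 by exact: expR_gt0.
have up : dPhi k <= r1 * (normal_peak sigma * E) * mesh.
  rewrite /dPhi -(ptB k); apply: Phi_diff_le => // z /andP[z1 z2].
  have zk : pt k <= z <= pt k.+1 by rewrite z1 ltW.
  by have /andP[] := cell_pdf kJ zk.
have lo : r1^-1 * (normal_peak sigma * E) * mesh <= dPhi k.
  rewrite /dPhi -(ptB k); apply: Phi_diff_ge => //.
    by rewrite mulr_ge0 ?invr_ge0 ?ltW// mulr_gt0.
  move=> z /andP[z1 z2]; rewrite -expRN.
  have zk : pt k <= z <= pt k.+1 by rewrite z1 ltW.
  by have /andP[] := cell_pdf kJ zk.
have cE : c * (normal_peak sigma * mesh) = bw M.
  by rewrite /c mulrC [normal_peak _ * _]mulrC mulrC divfK// lt0r_neq0// mulr_gt0.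
split.
  apply: (@le_trans _ _ (r1 * (bw M * E))).
    apply: le_trans (ler_wpM2l (ltW c0) up) _.
    by rewrite -cE; have -> : c * (r1 * (normal_peak sigma * E) * mesh) =
       r1 * (c * (normal_peak sigma * mesh) * E) by ring.
  apply: (@le_trans _ _ (r1 * (r2 * bw k))); first by rewrite ler_pM2l.
  by rewrite mulrA; apply: ler_wpM2r => //; exact: rhoE.
apply: le_trans b2 _; apply: (@le_trans _ _ (r1 * r2 * (c * dPhi k))); last first.
  by apply: ler_wpM2r; [rewrite mulr_ge0 ?subr_ge0 ?Phi_homo// ltW|exact: rhoE].
rewrite -cE.
have := ler_wpM2l (mulr_ge0 (mulr_ge0 (ltW r10) (ltW r20)) (ltW c0)) lo.
have -> : r1 * r2 * c * (r1^-1 * (normal_peak sigma * E) * mesh) =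
   c * (normal_peak sigma * mesh) * r2 * E * (r1 * r1^-1) by ring.
by rewrite mulfV ?lt0r_neq0// mulr1 -!mulrA.
Qed.

Let Ib (P : pred nat) := \sum_(M - J <= k < M + J | P k) dPhi k.
Let Sb (P : pred nat) := \sum_(M - J <= k < M + J | P k) bw k.

Let sums_close P : c * Ib P <= rho * Sb P /\ Sb P <= rho * (c * Ib P).
Proof.
have inr k : (M - J <= k < M + J)%N -> `|dist k| <= J%:R.
  move=> /andP[k1 k2]; rewrite /dist ler_norml.
  have : k%:R <= M%:R + J%:R :> R by rewrite -natrD ler_nat ltnW.
  have : M%:R <= k%:R + J%:R :> R by rewrite -natrD ler_nat addnC -leq_subLR.
  lra.
split; rewrite /Ib /Sb !mulr_sumr; rewrite big_nat_cond [leRHS]big_nat_cond; apply: ler_sum => k /andP[/inr kJ _].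
  by case: (cells_close kJ).
by case: (cells_close kJ).
Qed.

Let JM : (J <= M)%N.
Proof.
rewrite -(ler_nat R); have : 0 <= A * Num.sqrt M%:R by rewrite mulr_ge0// (le_trans _ A1).
by move: JA J4; lra.
Qed.

Let Sub (P : pred nat) : Sb P <= 2 ^- M.*2 * \sum_(k < M.*2.+1) 'C(M.*2, k)%:R * (P k)%:R.
Proof.
rewrite mulr_sumr /Sb big_mkcond/=.
have -> : \sum_(k < M.*2.+1) 2 ^- M.*2 * ('C(M.*2, k)%:R * (P k)%:R) =
   \sum_(0 <= k < M.*2.+1) (if P k then bw k else 0).
  rewrite big_mkord; apply: eq_bigr => k _; rewrite mulrA -/(bw k).
  by case: (P k); rewrite ?mulr1 ?mulr0.
have t0 k : 0 <= (if P k then bw k else 0) by case: ifP.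
rewrite [leRHS](@big_cat_nat _ _ _ (M - J))//=; last by rewrite leq_subLR -addnn -addnS addnCA leq_addr.
rewrite [X in _ + X](@big_cat_nat _ _ _ (M + J))//=.
- by rewrite -[leLHS]add0r -[leLHS]addr0 -addrA !lerD// sumr_ge0.
- by rewrite leq_subLR addnCA leq_addr.
- by rewrite ltnW// ltnS -addnn leq_add2l.
Qed.

Let walk_sum (P : pred nat) : Ew M.*2 (fun w => (P (count id w))%:R : R) =
  2 ^- M.*2 * \sum_(k < M.*2.+1) 'C(M.*2, k)%:R * (P k)%:R.
Proof. exact: (Ew_count M.*2 (fun k => (P k)%:R)). Qed.

Let window : pred nat := fun k => (M - J <= k < M + J)%N.

(** Chebyshev: outside the window the height is at least [2 * J] in absolute value. *)
Let outside_small : Ew M.*2 (fun w => (~~ window (count id w))%:R) * (2 * J%:R ^+ 2) <= M%:R :> R.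
Proof.
have := @Ew_hgt2 R M.*2 0; rewrite expr0n/= add0r => e.
have : Ew M.*2 (fun w => (~~ window (count id w))%:R * (4 * J%:R ^+ 2)) <= M.*2%:R :> R.
  rewrite -e; apply: le_Ew => w wM; rewrite add0r.
  case: (boolP (window _)) => [_|kout]; first by rewrite mul0r sqr_ge0.
  rewrite mul1r; have hE := count_hgt w; rewrite wM in hE.
  have : (2 * J)%:Z <= `|hgt w|.
    rewrite hE; case/nandP: kout; rewrite -?ltnNge -?leqNgt; clear; lia.
  rewrite -(ler_int R) intr_norm => h2.
  rewrite -[leRHS]ger0_norm ?sqr_ge0// normrX; apply: le_trans (lerXn2r 2 _ _ h2).
  - by rewrite -pmulrn natrM exprMn; lra.
  - by rewrite nnegrE -pmulrn ler0n.
  - by rewrite nnegrE normr_ge0.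
rewrite EwZr -mul2n natrM; lra.
Qed.

Let S_total : Sb predT <= 1.
Proof. by apply: le_trans (Sub predT) _; rewrite -walk_sum Ew_cst. Qed.

Let S_inside (P : pred nat) : Ew M.*2 (fun w => (P (count id w))%:R) <=
  Sb P + Ew M.*2 (fun w => (~~ window (count id w))%:R).
Proof.
apply: (@le_trans _ _ (Ew M.*2 (fun w => (window (count id w) && P (count id w))%:R) +
    Ew M.*2 (fun w => (~~ window (count id w))%:R))).
  rewrite -EwD; apply: le_Ew => w _.
  by case: (window _); case: (P _) => /=; rewrite ?addr0 ?add0r.
rewrite lerD2r (walk_sum (predI window P)) mulr_sumr.
rewrite -(big_mkord predT (fun k => 2 ^- M.*2 * ('C(M.*2, k)%:R * (predI window P k)%:R))).
rewrite /Sb [leRHS](big_nat_widen _ _ M.*2.+1); last first.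
  by rewrite ltnW// ltnS -addnn leq_add2l.
rewrite [leRHS](big_nat_widenl _ 0)// [leRHS]big_mkcond/=; apply: ler_sum => k _.
rewrite mulrA -/(bw k) /window.
by case: (P k) => /=; rewrite ?andbF ?andbT ?mulr0 ?mulr1//; case: ltnP => _;
  rewrite ?andbF ?andbT ?mulr0//; case: leqP => _; rewrite ?mulr0 ?mulr1.
Qed.

Variables (a del : R).
Hypotheses (del0 : 0 < del) (del4 : del <= 8^-1) (Jdel : M%:R <= del * (2 * J%:R ^+ 2)).
Hypotheses (tail_lo : Phi sigma (- (mesh * J%:R)) <= del)
  (tail_hi : 1 - del <= Phi sigma (mesh * J%:R)).
Hypotheses (rho_del : rho <= 1 + del) (mesh_del : normal_peak sigma * mesh <= del).

Let below : pred nat := fun k => pt k < a.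

Let J0 : (0 < J)%N.
Proof.
rewrite lt0n; apply/eqP => J0; move: Jdel; rewrite J0 expr0n/= !mulr0.
by rewrite leNgt ltr0n M0.
Qed.

Let le_range : (M - J <= M + J)%N. Proof. by rewrite leq_subLR addnCA leq_addr. Qed.

Let pt_lo : pt (M - J) = - (mesh * J%:R).
Proof. by rewrite /pt natrB// addrAC subrr add0r mulrN. Qed.

Let pt_hi : pt (M + J) = mesh * J%:R.
Proof. by rewrite /pt natrD addrAC subrr add0r. Qed.

Let outside_del : Ew M.*2 (fun w => (~~ window (count id w))%:R) <= del :> R.
Proof.
have J2 : 0 < 2 * J%:R ^+ 2 :> R by rewrite mulr_gt0// exprn_gt0// ltr0n.
by rewrite -(ler_pM2r J2); apply: le_trans outside_small _.
Qed.

Let I_total : 1 - 2 * del <= Ib predT.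
Proof.
rewrite /Ib telescope_sumr// pt_lo pt_hi; move: tail_lo tail_hi; lra.
Qed.

Let I_le1 : Ib predT <= 1.
Proof.
rewrite /Ib telescope_sumr//.
by have := Phi_le1 sigma (pt (M + J)); have := Phi_ge0 sigma (pt (M - J)); lra.
Qed.

Let I_ub : Ib below <= Phi sigma a + del.
Proof.
have -> : Phi sigma a + del = Phi sigma a - 0 + del by rewrite subr0.
(* A cell whose left end is below [a] may stick out beyond [a] by one mesh, so the telescoping sum
   is cut at [a + mesh]. *)
pose Psi k := Phi sigma (Num.min (a + mesh) (pt k)).
apply: (@le_trans _ _ (\sum_(M - J <= k < M + J) (Psi k.+1 - Psi k))).
  rewrite /Ib big_mkcond/=; apply: ler_sum => k _; rewrite /below.
  case: ifPn => [pa|_]; last first.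
    by rewrite subr_ge0; apply: Phi_homo => //; rewrite le_min !ge_min lexx pt_mono orbT.
  rewrite /Psi /dPhi !min_r//; first by move: pa mesh0; lra.
  by have := ptB k; move: pa; lra.
rewrite telescope_sumr//.
have := Phi_ge0 sigma (Num.min (a + mesh) (pt (M - J))).
have : Psi (M + J) <= Phi sigma (a + mesh) by apply: Phi_homo => //; rewrite ge_min lexx.
have := @Phi_lip R sigma sigma0 a (a + mesh); rewrite lerDl (ltW mesh0) => /(_ isT).
rewrite addrAC subrr add0r /Psi; move: mesh_del; lra.
Qed.

Let I_lb : Phi sigma a - 2 * del <= Ib below.
Proof.
pose Psi k := Phi sigma (Num.min a (pt k)).
apply: (@le_trans _ _ (\sum_(M - J <= k < M + J) (Psi k.+1 - Psi k))); last first.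
  rewrite /Ib [leRHS]big_mkcond/=; apply: ler_sum => k _; rewrite /below /Psi.
  case: ltP => [pa|ap]; last by rewrite !min_l ?subrr// (le_trans ap).
  by rewrite /dPhi lerD2r; apply: Phi_homo => //; rewrite ge_min lexx orbT.
rewrite telescope_sumr//.
have : Psi (M - J)%N <= del.
  by apply: le_trans tail_lo; rewrite -pt_lo; apply: Phi_homo => //; rewrite ge_min lexx orbT.
suff : Phi sigma a - del <= Psi (M + J)%N by rewrite /Psi; lra.
rewrite /Psi; case: (leP a (pt (M + J))) => _.
  by move: del0; lra.
by have := Phi_le1 sigma a; rewrite pt_hi; move: tail_hi; lra.
Qed.

Lemma walk_cdf_close :
  `|Ew M.*2 (fun w => (sigma * (hgt w)%:~R / Num.sqrt M.*2%:R < a)%R%:R : R) - Phi sigma a|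
    <= 20 * del.
Proof.
have -> : Ew M.*2 (fun w => (sigma * (hgt w)%:~R / Num.sqrt M.*2%:R < a)%R%:R) =
   Ew M.*2 (fun w => (below (count id w))%:R) :> R.
  apply: eq_Ew => w wM; congr ((_ < _)%R%:R).
  rewrite /pt /mesh count_hgt wM intrB -!mul2n -!pmulrn !natrM.
  by ring.
have [T1 T2] := sums_close predT; have [B1 B2] := sums_close below.
have SB := S_inside below; have ST := S_inside predT; rewrite Ew_cst in ST.
have SB' := Sub below; rewrite -walk_sum in SB'.
have := outside_del; have := S_total; have := I_total; have := I_le1; have := I_ub; have := I_lb.
have P1 := Phi_le1 sigma a; have P0 := Phi_ge0 sigma a.
have IB0 : 0 <= Ib below.
  by rewrite /Ib sumr_ge0// => k _; rewrite subr_ge0 Phi_homo.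
have rho1 : 1 <= rho.
  rewrite -[leLHS]expR0 ler_expR divr_ge0// addr_ge0// mulr_ge0// exprn_ge0//.
  exact: le_trans A1.
set E := Ew _ _ in SB SB' *; set o := Ew _ _ in SB ST *.
move=> Il Iu IT2 IT1 ST1 od.
exact: (mass_ratio_arith T1 T2 B1 B2 SB ST SB' IB0 rho1 P1 P0 rho_del del0 del4 c0 Il Iu IT2 IT1 ST1 od).
Qed.

End cells.

Lemma sqrt_ge_near (B : R) : exists M0 : nat, forall M, (M0 <= M)%N -> B <= Num.sqrt M%:R.
Proof.
exists (Num.truncn (B ^+ 2)).+1 => M MM.
apply: le_trans (ler_norm _) _; rewrite -sqrtr_sqr ler_sqrt//.
by rewrite ltW// (lt_le_trans (truncnS_gt _))// ler_nat.
Qed.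

Lemma de_moivre_laplace (sigma a e : R) : 0 < sigma -> 0 < e ->
  exists M0 : nat, forall M, (M0 <= M)%N ->
  `|Ew M.*2 (fun w => (sigma * (hgt w)%:~R / Num.sqrt M.*2%:R < a)%R%:R : R) - Phi sigma a|
    <= e.
Proof.
move=> sigma0 e0; pose del : R := Num.min (e / 20) 8^-1.
have del0 : 0 < del by rewrite lt_min divr_gt0//= invr_gt0.
have dele : 20 * del <= e by rewrite mulrC -ler_pdivlMr// ge_min lexx.
have del8 : del <= 8^-1 by rewrite ge_min lexx orbT.
have [A0 tails] := @Phi_tails R sigma del del0.
(* The second term puts the ends of the window beyond [A0], where the normal tails are small; the
   third makes Chebyshev's bound outside the window at most [del]. *)
pose A := 2 + 2 * `|A0| / sigma + 2 / del.
have A01 : 0 <= 2 * `|A0| / sigma by rewrite divr_ge0 ?mulr_ge0// ltW.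
have d2 : 0 < 2 / del by rewrite divr_gt0.
have A1 : 1 <= A by rewrite /A; lra.
pose C := 8 * A ^+ 3 + 8.
have C0 : 0 < C by rewrite addr_gt0// mulr_gt0// exprn_gt0// (lt_le_trans _ A1).
have peak0 : 0 < normal_peak sigma by rewrite normal_peak_gt0// lt0r_neq0.
(* The term [4 * A] keeps the window well inside the range of the binomial law; the quotients by
   [del] bring [rho] close to 1 and make the mesh small. *)
have [M0 M0P] := sqrt_ge_near (4 * A + 2 * C / del + 2 * C + 2 * sigma * normal_peak sigma / del + 2).
have t1 : 0 <= 2 * C / del by rewrite divr_ge0 ?mulr_ge0// ltW.
have t2 : 0 <= 2 * sigma * normal_peak sigma / del.
  by rewrite divr_ge0 ?mulr_ge0// ltW.
exists M0 => M /M0P MB; apply: le_trans dele.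
set s := Num.sqrt M%:R in MB.
have s4 : 4 * A <= s by lra.
have s0 : 0 < s by lra.
have M0' : (0 < M)%N by move: s0; rewrite /s sqrtr_gt0 ltr0n.
have s2 : s ^+ 2 = M%:R by rewrite sqr_sqrtr.
pose J := Num.truncn (A * s).
have /truncn_itv/andP[J1 J2] : 0 <= A * s by rewrite mulr_ge0// ltW// (lt_le_trans _ A1).
rewrite -/J -(@natr1 _ J) in J1 J2.
have As2 : 2 <= A * s by nra.
have Jlo : A * s / 2 <= J%:R by lra.
have sq2 : Num.sqrt M.*2%:R = Num.sqrt 2 * s :> R by rewrite -mul2n natrM sqrtrM.
have r1 : 1 <= Num.sqrt 2 :> R by rewrite -[leLHS]sqrtr1 ler_sqrt//; lra.
have r2 : Num.sqrt 2 <= 2 :> R.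
  by rewrite -[leRHS](@ger0_norm R)// -sqrtr_sqr ler_sqrt// expr2; lra.
have den0 : 0 < Num.sqrt 2 * s by rewrite mulr_gt0//; lra.
have mJ : A0 <= 2 * sigma / Num.sqrt M.*2%:R * J%:R.
  apply: le_trans (ler_norm _) _.
  rewrite sq2 mulrAC ler_pdivlMr//.
  have h1 : 2 * `|A0| <= A * sigma.
    have : 2 * `|A0| / sigma <= A by rewrite /A; lra.
    by rewrite ler_pdivrMr.
  have h2 : sigma * (A * s / 2) <= sigma * J%:R by rewrite ler_pM2l.
  have h3 : 2 * `|A0| * s <= A * sigma * s by rewrite ler_pM2r.
  have h4 : `|A0| * (Num.sqrt 2 * s) <= `|A0| * (2 * s).
    by apply: ler_wpM2l => //; rewrite ler_pM2r.
  lra.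
have [tl th] := tails _ mJ.
apply: (@walk_cdf_close sigma A M J) => //.
- by rewrite -/s -[leRHS]s2 expr2; have := ler_wpM2r (ltW s0) s4; lra.
- rewrite -[leLHS]s2; have h1 : (A * s / 2) ^+ 2 <= J%:R ^+ 2.
    by rewrite lerXn2r// ?nnegrE; lra.
  have h2 : 2 <= del * A.
    have : 2 / del <= A by rewrite /A; lra.
    by rewrite ler_pdivrMr// mulrC.
  have h3 : del * (2 * (A * s / 2) ^+ 2) <= del * (2 * J%:R ^+ 2).
    by rewrite ler_pM2l// ler_pM2l.
  apply: le_trans h3; have -> : del * (2 * (A * s / 2) ^+ 2) = s ^+ 2 * (A * (del * A) / 2).
    by field.
  by rewrite -[leLHS]mulr1; apply: ler_wpM2l; [exact: sqr_ge0|nra].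
- rewrite -/C -/s; set x := C / s.
  have x0 : 0 < x by rewrite divr_gt0.
  have x1 : x <= del / 2.
    rewrite ler_pdivrMr// mulrAC ler_pdivlMr//.
    have : 2 * C / del <= s by lra.
    by rewrite ler_pdivrMr//; lra.
  have := expR_ge1Dx (- x); rewrite expRN => ex.
  have e1 : 0 < expR x by exact: expR_gt0.
  have : (1 - x) * expR x <= 1.
    by rewrite -[leRHS](mulVf (lt0r_neq0 e1)) ler_pM2r.
  by nra.
- rewrite sq2 mulrA ler_pdivrMr//.
  have : 2 * sigma * normal_peak sigma / del <= s by lra.
  rewrite ler_pdivrMr// => h.
  have : s <= Num.sqrt 2 * s by nra.
  nra.
Qed.

End de_moivre_laplace.

(** * Donsker's theorem for Lipschitz functionals *)

Section bounded_expectation.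
Context {d : measure_display} {T : measurableType d} {R : realType}.
Variable P : probability T R.
Implicit Types f g : T -> R.

Definition bmf f := measurable_fun setT f /\ exists C : R, forall w, `|f w| <= C.

Definition EP f : R := \int[P]_w f w.

Lemma bmf_integrable f : bmf f -> P.-integrable setT (EFin \o f).
Proof.
move=> [mf [C fC]]; apply: measurable_bounded_integrable => //.
  by rewrite [X in (X < _)%E](_ : _ = 1%E) ?ltry//; exact: probability_setT.
exists C; split; first exact: num_real.
by move=> x Cx w _; apply: le_trans (fC w) (ltW Cx).
Qed.

Lemma bmf01 f : measurable_fun setT f -> (forall w, 0 <= f w <= 1) -> bmf f.
Proof.
move=> mf f01; split => //; exists 1 => w.
by have /andP[f0 f1] := f01 w; rewrite ger0_norm.
Qed.

Lemma bmf_cst c : bmf (fun=> c).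
Proof. by split=> //; exists `|c|. Qed.

Lemma bmfD f g : bmf f -> bmf g -> bmf (fun w => f w + g w).
Proof.
move=> [mf [C fC]] [mg [D gD]]; split; first exact: measurable_funD.
by exists (C + D) => w; apply: le_trans (ler_normD _ _) (lerD _ _).
Qed.

Lemma bmfM f g : bmf f -> bmf g -> bmf (fun w => f w * g w).
Proof.
move=> [mf [C fC]] [mg [D gD]]; split; first exact: measurable_funM.
by exists (C * D) => w; rewrite normrM ler_pM.
Qed.

Lemma bmfB f g : bmf f -> bmf g -> bmf (fun w => f w - g w).
Proof.
move=> [mf [C fC]] [mg [D gD]]; split; first exact: measurable_funB.
by exists (C + D) => w; apply: le_trans (ler_normB _ _) (lerD _ _).
Qed.

Lemma expectation_EP f : bmf f -> ('E_P[f])%E = (EP f)%:E.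
Proof.
by move=> /bmf_integrable fi; rewrite unlock /EP /Rintegral fineK// integrable_fin_num.
Qed.

Lemma EP_cst c : EP (fun=> c) = c.
Proof.
rewrite /EP Rintegral_cst// [X in _ * X](_ : _ = 1) ?mulr1//.
by rewrite [X in fine X](_ : _ = 1%E)//; exact: probability_setT.
Qed.

Lemma le_EP f g : bmf f -> bmf g -> (forall w, f w <= g w) -> EP f <= EP g.
Proof. by move=> bf bg fg; apply: le_Rintegral => //; exact: bmf_integrable. Qed.

Lemma EPD f g : bmf f -> bmf g -> EP (fun w => f w + g w) = EP f + EP g.
Proof. by move=> bf bg; apply: RintegralD => //; exact: bmf_integrable. Qed.

Lemma EPB f g : bmf f -> bmf g -> EP (fun w => f w - g w) = EP f - EP g.
Proof. by move=> bf bg; apply: RintegralB => //; exact: bmf_integrable. Qed.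

Lemma EPZ c f : bmf f -> EP (fun w => c * f w) = c * EP f.
Proof. by move=> bf; apply: RintegralZl => //; exact: bmf_integrable. Qed.

Lemma EP_sum (I : Type) (s : seq I) (F : I -> T -> R) : (forall i, bmf (F i)) ->
  EP (fun w => \sum_(i <- s) F i w) = \sum_(i <- s) EP (F i).
Proof.
move=> bF; suff [] : bmf (fun w => \sum_(i <- s) F i w) /\
  EP (fun w => \sum_(i <- s) F i w) = \sum_(i <- s) EP (F i) by [].
elim: s => [|i s [bs IHs]].
  under eq_fun do rewrite big_nil; rewrite big_nil EP_cst; split => //.
  exact: bmf_cst.
under eq_fun do rewrite big_cons; rewrite big_cons EPD// IHs; split => //.
exact: bmfD.
Qed.

Lemma EP_indic (A : set T) : measurable A -> EP \1_A = fine (P A).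
Proof. by move=> mA; rewrite /EP /Rintegral integral_indic// setIT. Qed.

Lemma EP_dominated (f : nat -> T -> R) g (C : R) :
  (forall n, measurable_fun setT (f n)) -> measurable_fun setT g ->
  (forall n w, `|f n w| <= C) -> {ae P, forall w, f n w @[n --> \oo] --> g w} ->
  EP (f n) @[n --> \oo] --> EP g.
Proof.
move=> mf mg fC fg.
have [ig _] : [/\ P.-integrable setT (EFin \o g),
    [sequence (\int[P]_w `|(f n w)%:E - (g w)%:E|)%E]_n @ \oo --> 0%E &
    [sequence (\int[P]_w (f n w)%:E)%E]_n @ \oo --> (\int[P]_w (g w)%:E)%E].
  apply: (@dominated_convergence _ _ _ P setT measurableT
      (fun n w => (f n w)%:E) (fun w => (g w)%:E) (cst C%:E)).
  - by move=> n; exact/measurable_EFinP.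
  - exact/measurable_EFinP.
  - apply: filterS fg => w fgw _; apply/fine_cvgP; split => //; exact: nearW.
  - by have := bmf_integrable (bmf_cst C).
  - by apply: aeW => w n _; rewrite lee_fin.
have -> : (\int[P]_w (g w)%:E)%E = (EP g)%:E.
  by rewrite /EP /Rintegral fineK// integrable_fin_num.
by move=> /fine_cvgP[].
Qed.

End bounded_expectation.

(** * Paths with quantised increments *)

Section quantisation.
Context {R : realType}.
Implicit Types (f : R -> R) (x t : R).

Definition step_path (k r : nat) (a : nat -> R) t : R :=
  \sum_(i < r) (if i.+1%:R <= k%:R * t then a i else 0).

(** The truncation is 0 on negative numbers and [minn] caps it, so the two extreme cells also
    collect everything beyond the grid. *)
Definition cell (theta : R) (J : nat) x : 'I_J.*2.+1 :=
  inord (minn (Num.truncn (x / theta + J%:R)) J.*2).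

Definition cell_value (theta : R) (J : nat) (c : 'I_J.*2.+1) : R := (c%:R - J%:R) * theta.

Lemma cell_close theta J x : 0 < theta -> `|x| <= J%:R * theta ->
  `|x - cell_value theta (cell theta J x)| <= theta.
Proof.
move=> t0; rewrite ler_norml => /andP[x1 x2].
have y0 : 0 <= x / theta + J%:R.
  by rewrite -lerBlDr sub0r ler_pdivlMr// mulNr.
have yJ : x / theta + J%:R <= J.*2%:R.
  by rewrite -addnn natrD lerD2r ler_pdivrMr.
have tJ : (Num.truncn (x / theta + J%:R) <= J.*2)%N.
  by rewrite -(ler_nat R) (le_trans _ yJ)// truncn_le.
rewrite /cell_value /cell inordK ?ltnS ?geq_minr// (minn_idPl tJ).
have /andP[] := truncn_itv y0; rewrite -(@natr1 _ (Num.truncn _)); set n := _%:R => n1 n2.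
have -> : x - (n - J%:R) * theta = (x / theta + J%:R - n) * theta.
  by rewrite !mulrDl divfK ?lt0r_neq0// mulNr; ring.
by rewrite normrM (gtr0_norm t0) -[leRHS]mul1r ler_pM2r// ger0_norm; lra.
Qed.

Lemma step_path_close (K k : nat) (theta eta : R) J f :
  (0 < k)%N -> 0 < theta -> 0 <= eta <= J%:R * theta -> f 0 = 0 ->
  (forall (i : nat) t, (i < K * k)%N -> i%:R / k%:R <= t <= i.+1%:R / k%:R ->
     `|f t - f (i%:R / k%:R)| <= eta) ->
  forall t, 0 <= t <= K%:R ->
  `|f t - step_path k (K * k) (fun i => cell_value theta
     (cell theta J (f (i.+1%:R / k%:R) - f (i%:R / k%:R)))) t|
  <= eta + (K * k)%:R * theta.
Proof.
move=> k0 t0 /andP[eta0 eJ] f0 osc t /andP[tge0 tK]; set a := fun i => _.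
have kR : 0 < k%:R :> R by rewrite ltr0n.
have kt0 : 0 <= k%:R * t by rewrite mulr_ge0.
have /andP[jt tj] := truncn_itv kt0; set j := Num.truncn _ in jt tj.
have jr : (j <= K * k)%N.
  by rewrite -(ler_nat R) (le_trans jt)// natrM mulrC ler_pM2r.
have -> : step_path k (K * k) a t = \sum_(0 <= i < j) a i.
  rewrite /step_path -(big_mkord predT (fun i => if i.+1%:R <= k%:R * t then a i else 0)).
  rewrite (@big_cat_nat _ _ _ j)//= [X in _ + X]big1_seq ?addr0; last first.
    move=> i; rewrite mem_index_iota => /andP[_ /andP[ji _]].
    by rewrite ifF//; apply/negbTE; rewrite -ltNge (lt_le_trans tj)// ler_nat.
  by apply: eq_big_nat => i /andP[_ ij]; rewrite ifT// (le_trans _ jt)// ler_nat.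
have -> : f t = (f t - f (j%:R / k%:R)) +
    \sum_(0 <= i < j) (f (i.+1%:R / k%:R) - f (i%:R / k%:R)).
  by rewrite (telescope_sumr (fun i => f (i%:R / k%:R)))// mul0r f0 subr0 subrK.
rewrite -addrA -sumrB; apply: le_trans (ler_normD _ _) (lerD _ _).
  have [jr'|] := ltnP j (K * k)%N.
    by apply: osc => //; rewrite ler_pdivrMr// ler_pdivlMr// mulrC jt ltW.
  move=> rj; have -> : t = j%:R / k%:R; last by rewrite subrr normr0.
  apply/le_anti; rewrite ler_pdivrMr// ler_pdivlMr// [t * _]mulrC jt andbT.
  have -> : j = (K * k)%N by apply/eqP; rewrite eqn_leq jr.
  by rewrite natrM mulrC ler_pM2r.
apply: le_trans (ler_norm_sum _ _ _) _.
apply: (@le_trans _ _ (\sum_(0 <= i < j) theta)); last first.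
  by rewrite sumr_const_nat subn0 -[leLHS]mulr_natl ler_pM2r// ler_nat.
apply: ler_sum_nat => i /andP[_ ij]; apply: cell_close => //; apply: le_trans eJ.
apply: osc; first exact: leq_trans ij jr.
by rewrite lexx andbT ler_pM2r ?invr_gt0// ler_nat.
Qed.

(* [surv c x] holds when the cell of [x] has index at least [c]. *)
Definition surv (theta : R) (J c : nat) x : bool :=
  (c == 0)%N || ((c <= J.*2)%N && ((c%:R - J%:R) * theta <= x)).

Lemma surv_cell theta J c x : 0 < theta -> surv theta J c x = (c <= cell theta J x)%N.
Proof.
move=> t0; rewrite /surv /cell inordK ?ltnS ?geq_minr//; case: c => // c /=.
rewrite leq_min andbC; congr (_ && _).
by rewrite truncn_gt_nat -lerBlDr ler_pdivlMr.
Qed.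

Lemma cell_indic theta J (c : 'I_J.*2.+1) x : 0 < theta ->
  (cell theta J x == c)%:R = (surv theta J c x)%:R - (surv theta J c.+1 x)%:R :> R.
Proof.
move=> t0; rewrite !surv_cell// -val_eqE/=.
by case: ltngtP => _ /=; rewrite ?subrr ?subr0.
Qed.

(** A functional of a quantised path becomes a finite sum of constants times products of indicators
    of increments. This gives measurability for an arbitrary [L] and lets independence factor the
    expectations. *)
Lemma step_path_sum theta J k r (L : (R -> R) -> R) (f : R -> R) :
  L (step_path k r (fun i => cell_value theta
     (cell theta J (f (i.+1%:R / k%:R) - f (i%:R / k%:R))))) =
  \sum_(j : {ffun 'I_r -> 'I_J.*2.+1})
     L (step_path k r (fun i => if insub i is Some i' then cell_value theta (j i') else 0)) *
     \prod_(i < r) (cell theta J (f (i.+1%:R / k%:R) - f (i%:R / k%:R)) == j i)%:R.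
Proof.
pose j0 := [ffun i : 'I_r => cell theta J (f (i.+1%:R / k%:R) - f (i%:R / k%:R))].
rewrite (bigD1 j0)//= [X in _ * X]big1 ?mulr1; last by move=> i _; rewrite ffunE eqxx.
rewrite [X in _ + X]big1 ?addr0; last first.
  move=> j jj0; have /existsP[i ij] : [exists i, j0 i != j i].
    by rewrite -negb_forall; apply: contra jj0 => /forallP jj; apply/eqP/ffunP => i; exact/esym/eqP.
  by rewrite (bigD1 i)//= -[cell _ _ _](ffunE (fun i : 'I_r => cell theta J (f (i.+1%:R / k%:R) - f (i%:R / k%:R)))) (negbTE ij) mul0r mulr0.
congr L; apply/funext => t; apply: eq_bigr => i _; case: ifP => // _.
by rewrite valK ffunE.
Qed.

End quantisation.

Section continuity_on_segments.
Context {R : realType}.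

Lemma within_eps (A : set R) (f : R -> R) x (e : R) : {within A, continuous f} -> A x -> 0 < e ->
  exists2 del : R, 0 < del & forall z, A z -> `|x - z| < del -> `|f x - f z| <= e.
Proof.
move=> /subspace_continuousP cf Ax e0.
have /cvgrPdist_le/(_ e e0) := cf x Ax.
rewrite /within/= => -[del /= del0 h]; exists del => // z Az xz.
exact: h.
Qed.

Lemma heine (f : R -> R) (a b e : R) : {within `[a, b], continuous f} -> 0 < e ->
  exists2 del : R, 0 < del & forall x y, a <= x <= b -> a <= y <= b ->
    `|x - y| <= del -> `|f x - f y| <= e.
Proof.
move=> cf e0; have /compact_near_coveringP/near_covering_withinP := @segment_compact R a b.
move=> /(_ R (0 : R)^'+ (fun i x => forall y, a <= y <= b -> `|x - y| <= i -> `|f x - f y| <= e) _).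
case.
  move=> x xab; have [del del0 fx] := within_eps cf xab (divr_gt0 e0 (ltr0n _ 2)).
  exists (ball x (del / 2), [set i | i < del / 2]).
    split; first by apply: nbhsx_ballx; rewrite divr_gt0.
    by apply: nbhs_right_lt; rewrite divr_gt0.
  move=> [x' i] /= [xx' idel] x'ab y yab x'y.
  have h1 : `|f x - f x'| <= e / 2 by apply: fx => //; move: xx'; rewrite /ball/=; lra.
  have h2 : `|f x - f y| <= e / 2.
    apply: fx; first by rewrite /= in_itv.
    move: xx'; rewrite /ball/=; have := ler_normD (x - x') (x' - y); rewrite addrA subrK.
    by lra.
  by have := ler_distD (f x) (f x') (f y); rewrite (distrC (f x') (f x)); lra.
move=> i /= i0 h; have i2 : 0 < i / 2 by rewrite divr_gt0.
exists (i / 2) => // x y xab yab xy; apply: (h (i / 2)) => //=.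
- by rewrite sub0r normrN gtr0_norm//; lra.
Qed.

End continuity_on_segments.

Section donsker.
Context {d : measure_display} {T : measurableType d} {R : realType}.
Variable P : probability T R.

Lemma measurable_surv theta J c : measurable_fun setT (fun x : R => (surv theta J c x)%:R : R).
Proof.
rewrite /surv; case: eqP => [_|_] /=; first exact: measurable_cst.
case: leqP => _ /=; last exact: measurable_cst.
set a := _ * theta.
rewrite (_ : (fun x => _) = \1_`[a, +oo[%classic); last first.
  by apply/funext => x; rewrite indicE mem_setE in_itv/= andbT.
exact: measurable_indic.
Qed.

Lemma measurable_cell theta J (c : 'I_J.*2.+1) : 0 < theta ->
  measurable_fun setT (fun x : R => (cell theta J x == c)%:R : R).
Proof.
move=> t0; under eq_fun do rewrite cell_indic//.
by apply: measurable_funB; exact: measurable_surv.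
Qed.

(** With [K * k] increments the rounding errors add up to 1/k; the range [grid_J * grid_theta] is k,
    so every increment of size at most 1 is inside the grid. *)
Definition grid_theta (K k : nat) : R := ((k * (K * k))%:R)^-1.
Definition grid_J (K k : nat) : nat := (k * k * (K * k))%N.

Definition quantised (K k : nat) (f : R -> R) : R -> R :=
  step_path k (K * k) (fun i => cell_value (grid_theta K k)
     (cell (grid_theta K k) (grid_J K k) (f (i.+1%:R / k%:R) - f (i%:R / k%:R)))).

Lemma quantised_close (K k : nat) (eta : R) f : (0 < K)%N -> (0 < k)%N ->
  0 <= eta <= 1 -> f 0 = 0 ->
  (forall (i : nat) t, (i < K * k)%N -> i%:R / k%:R <= t <= i.+1%:R / k%:R ->
     `|f t - f (i%:R / k%:R)| <= eta) ->
  forall t, 0 <= t <= K%:R -> `|f t - quantised K k f t| <= eta + k%:R^-1.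
Proof.
move=> K0 k0 /andP[eta0 eta1] f0 osc t tK.
have kR : 0 < k%:R :> R by rewrite ltr0n.
have rR : 0 < (K * k)%:R :> R by rewrite ltr0n muln_gt0 K0.
have th0 : 0 < grid_theta K k by rewrite invr_gt0 natrM mulr_gt0.
have e : k%:R^-1 = (K * k)%:R * grid_theta K k.
  by rewrite /grid_theta (natrM _ k (K * k)) invfM mulrCA mulfV ?mulr1// lt0r_neq0.
rewrite e; apply: step_path_close => //; rewrite eta0 (le_trans eta1)//.
rewrite /grid_J /grid_theta -mulnA natrM mulfK ?ler1n//.
by rewrite natrM mulf_neq0// lt0r_neq0.
Qed.

Section path_functional.
Variables (X : R -> T -> R) (K : nat) (L : (R -> R) -> R) (m : R).
Hypotheses (K0 : (0 < K)%N) (m0 : 0 <= m) (lipL : lip K%:R m L).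
Hypotheses (mX : forall t, measurable_fun setT (X t)).
Hypotheses (X0 : forall w, X 0 w = 0).
Hypothesis cX : forall w, {within `[0, K%:R], continuous (X^~ w)}.

Lemma quantised_cvg w : L (quantised K k (X^~ w)) @[k --> \oo] --> L (X^~ w).
Proof.
apply/cvgrPdist_le => e e0.
have m1 : 0 < m + 1 by rewrite ltr_wpDl.
pose eta := Num.min 1 (e / (2 * (m + 1))).
have eta0 : 0 < eta by rewrite lt_min ltr01 divr_gt0// mulr_gt0.
have [del del0 osc] := heine (@cX w) eta0.
have [N [N1 NR]] : exists N : nat, (0 < N)%N /\ del^-1 + eta^-1 <= N%:R.
  by exists (Num.truncn (del^-1 + eta^-1)).+1; split=> //; exact/ltW/truncnS_gt.
exists N => // k /= Nk; have k0 : (0 < k)%N by exact: leq_trans Nk.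
have kR : 0 < k%:R :> R by rewrite ltr0n.
have kN : del^-1 + eta^-1 <= k%:R by rewrite (le_trans NR)// ler_nat.
have [d1 e1] : 0 < del^-1 /\ 0 < eta^-1 by rewrite !invr_gt0.
have kdel : k%:R^-1 <= del by rewrite -[leRHS]invrK lef_pV2 ?posrE//; lra.
have keta : k%:R^-1 <= eta by rewrite -[leRHS]invrK lef_pV2 ?posrE//; lra.
have close : forall t, 0 <= t <= K%:R ->
    `|X t w - quantised K k (X^~ w) t| <= eta + k%:R^-1.
  apply: quantised_close => //; first by rewrite ltW//= ge_min lexx.
  move=> i t iK /andP[it ti].
  have it1 : i.+1%:R / k%:R <= K%:R :> R by rewrite ler_pdivrMr// -natrM ler_nat.
  have i0 : 0 <= i%:R / k%:R :> R by rewrite divr_ge0.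
  rewrite distrC; apply: osc.
  - by rewrite i0 (le_trans it)// (le_trans ti).
  - by rewrite (le_trans i0 it) (le_trans ti).
  - rewrite distrC ger0_norm ?subr_ge0// (le_trans _ kdel)//.
    by move: ti; rewrite -(@natr1 _ i) mulrDl mul1r; lra.
have := lipL close; move=> /le_trans; apply.
have : (m + 1) * eta <= e / 2.
  have : eta <= e / (2 * (m + 1)) by rewrite ge_min lexx orbT.
  rewrite ler_pdivlMr ?mulr_gt0//; lra.
have : m * (eta + k%:R^-1) <= m * (eta + eta) by apply: ler_wpM2l => //; lra.
by move: eta0; lra.
Qed.

Lemma measurable_quantised k : (0 < k)%N ->
  measurable_fun setT (fun w => L (quantised K k (X^~ w))).
Proof.
move=> k0; have th0 : 0 < grid_theta K k by rewrite invr_gt0 ltr0n !muln_gt0 k0 K0.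
rewrite (funext (fun w => step_path_sum (grid_theta K k) (grid_J K k) k (K * k) L (X^~ w))).
apply: measurable_sum => j; apply: measurable_funM; first exact: measurable_cst.
apply: measurable_prod => i _.
have mD : measurable_fun setT (fun w => X (i.+1%:R / k%:R) w - X (i%:R / k%:R) w).
  by apply: measurable_funB; exact: mX.
exact: (measurableT_comp (measurable_cell (j i) th0) mD).
Qed.

(** A Lipschitz functional of a continuous path is the pointwise limit of its values on quantised
    paths, so no sigma-algebra on the space of paths is involved. *)
Lemma measurable_lip : measurable_fun setT (fun w => L (X^~ w)).
Proof.
apply: (@measurable_fun_cvg _ _ _ setT (fun k w => L (quantised K k.+1 (X^~ w)))).
  by move=> k; exact: measurable_quantised.
move=> w _; have := quantised_cvg (w := w); rewrite -(cvg_shiftS _). exact.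
Qed.

Lemma bmf_lip : (forall e, 0 <= L e <= 1) -> bmf (fun w => L (X^~ w)).
Proof. by move=> L01; apply: bmf01 => //; exact: measurable_lip. Qed.

Lemma EP_quantised_cvg : (forall e, 0 <= L e <= 1) ->
  EP P (fun w => L (quantised K k.+1 (X^~ w))) @[k --> \oo] --> EP P (fun w => L (X^~ w)).
Proof.
move=> L01; apply: (@EP_dominated _ _ _ _ _ _ 1).
- by move=> k; exact: measurable_quantised.
- exact: measurable_lip.
- by move=> n w; have /andP[? ?] := L01 (quantised K n.+1 (X^~ w)); rewrite ger0_norm.
- by apply: aeW => w; have := quantised_cvg (w := w); rewrite -(cvg_shiftS _); exact.
Qed.

End path_functional.

(* The limit of the expectations of quantised functionals, given the masses of
   the cells under the law of one increment. *)
Definition grid_sum (L : (R -> R) -> R) (K k : nat) (q : 'I_(grid_J K k).*2.+1 -> R) : R :=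
  \sum_(j : {ffun 'I_(K * k) -> 'I_(grid_J K k).*2.+1})
     L (step_path k (K * k) (fun i => if insub i is Some i' then
           cell_value (grid_theta K k) (j i') else 0)) * \prod_(i < K * k) q (j i).

Section brownian_side.
Variable B : R -> {RV P >-> R}.
Hypothesis BM : standard_brownian_motion B.

Lemma bm_increment (s t : R) (A : set R) : 0 <= s -> s < t -> measurable A ->
  P ((fun w => B t w - B s w) @^-1` A) = normal_prob 0 (Num.sqrt (t - s)) A.
Proof. by case: BM => _ _ h _ s0 st mA; exact: h. Qed.

Lemma bm_continuous K w : {within `[0, K], continuous (fun t => B t w)}.
Proof.
case: BM => _ h _ _; apply: continuous_subspaceW (h w) => x /=.
by rewrite !in_itv/= andbT => /andP[].
Qed.

Lemma bm0 w : B 0 w = 0. Proof. by case: BM. Qed.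

Definition cell_mass (K k : nat) (c : 'I_(grid_J K k).*2.+1) : R :=
  fine (normal_prob 0 (Num.sqrt k%:R^-1)
    [set x | cell (grid_theta K k) (grid_J K k) x = c]).

Lemma measurable_cell_set theta J (c : 'I_J.*2.+1) : 0 < theta ->
  measurable [set x : R | cell theta J x = c].
Proof.
move=> t0; have := measurable_cell c t0 => /(_ measurableT [set 1] (measurable_set1 _)).
rewrite setTI; congr measurable; apply/seteqP; split => x /=.
  by case: eqP => //= _ /eqP; rewrite eq_sym oner_eq0.
by move=> ->; rewrite eqxx.
Qed.

Lemma EP_quantised (L : (R -> R) -> R) (K k : nat) : (0 < K)%N -> (0 < k)%N ->
  EP P (fun w => L (quantised K k (fun t => B t w))) = grid_sum L (@cell_mass K k).
Proof.
move=> K0 k0; have th0 : 0 < grid_theta K k by rewrite invr_gt0 ltr0n !muln_gt0 k0 K0.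
have kR : 0 < k%:R :> R by rewrite ltr0n.
pose Dl (i : nat) w := B (i.+1%:R / k%:R) w - B (i%:R / k%:R) w.
have mD i : measurable_fun setT (Dl i) by apply: measurable_funB.
rewrite (funext (fun w => step_path_sum (grid_theta K k) (grid_J K k) k (K * k) L (fun t => B t w))).
have mc i c : measurable_fun setT
    (fun w => (cell (grid_theta K k) (grid_J K k) (Dl i w) == c)%:R : R).
  exact: (measurableT_comp (measurable_cell c th0) (mD i)).
rewrite EP_sum; last first.
  move=> j; apply: bmfM; first exact: bmf_cst.
  apply: bmf01; first by apply: measurable_prod => i _; exact: mc.
  by move=> w; rewrite prodr_ge0//= prodr_ile1// => i _; rewrite ler0n lern1 leq_b1.
apply: eq_bigr => j _; rewrite EPZ; last first.
  apply: bmf01; first by apply: measurable_prod => i _; exact: mc.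
  by move=> w; rewrite prodr_ge0//= prodr_ile1// => i _; rewrite ler0n lern1 leq_b1.
congr (_ * _).
pose A (i : 'I_(K * k)) := [set x | cell (grid_theta K k) (grid_J K k) x = j i].
have mA i : measurable (A i) by exact: measurable_cell_set.
have mpre (i : 'I_(K * k)) : measurable (Dl i @^-1` A i).
  by rewrite -[X in measurable X]setTI; exact: mD.
have -> : (fun w => \prod_(i < K * k) (cell (grid_theta K k) (grid_J K k) (Dl i w) == j i)%:R) =
   \1_(\bigcap_(i in [set: 'I_(K * k)]) (Dl i @^-1` A i)) :> (T -> R).
  apply/funext => w; rewrite indicE; case: (boolP (w \in _)) => wA.
    rewrite big1// => i _; move: wA; rewrite inE => /(_ i Logic.I).
    by rewrite /A/= => ->; rewrite eqxx.
  have [i Hi] : exists i : 'I_(K * k), cell (grid_theta K k) (grid_J K k) (Dl i w) != j i.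
    apply/existsP; rewrite -negb_forall; apply: contra wA => /forallP wA.
    by rewrite inE => i _; exact/eqP.
  by rewrite (bigD1 i)//= (negbTE Hi) mul0r.
rewrite EP_indic; last by apply: fin_bigcap_measurable => // i _; exact: mpre.
have indep : P (\bigcap_(i in [set: 'I_(K * k)]) (Dl i @^-1` A i)) =
    (\prod_(i < K * k) P (Dl i @^-1` A i))%E.
  case: BM => _ _ _ /(_ (K * k)%N (fun i => i%:R / k%:R)); apply => //.
  by move=> a b ab; rewrite ler_pM2r ?invr_gt0// ler_nat.
rewrite indep.
have PE (i : 'I_(K * k)) : P (Dl i @^-1` A i) = (cell_mass (j i))%:E.
  rewrite /Dl bm_increment//; last by rewrite ltr_pM2r ?invr_gt0// ltr_nat.
  rewrite -mulrBl -(@natr1 _ i) addrAC subrr add0r mul1r fineK// normal_prob_fin//.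
  exact: measurable_cell_set.
under eq_bigr do rewrite PE.
by rewrite prodEFin.
Qed.

End brownian_side.

Definition walk_path (n : nat) (w : seq bool) (t : R) : R :=
  walk w (n%:R * t) / Num.sqrt n%:R.

Definition block (m i : nat) (w : seq bool) := take m (drop (i * m) w).

(** Consecutive blocks of steps are independent: the walk's counterpart of independent
    increments. *)
Lemma Ew_blocks m r (G : nat -> seq bool -> R) :
  Ew (r * m) (fun w => \prod_(i < r) G i (block m i w)) = \prod_(i < r) Ew m (G i).
Proof.
elim: r G => [|r IHr] G; first by rewrite mul0n /= !big_ord0.
rewrite mulSn Ew_cat big_ord_recl -(IHr (fun i => G i.+1)) -EwZr.
apply: eq_Ew => u um; rewrite -EwZ; apply: eq_Ew => v _.
rewrite big_ord_recl /block mul0n drop0 take_size_cat//; congr (_ * _).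
apply: eq_bigr => i _; rewrite lift0 mulSn drop_cat um ltnNge leq_addr/= addKn.
by [].
Qed.

Lemma Ew_block m r i (G : seq bool -> R) : (i < r)%N ->
  Ew (r * m) (fun w => G (block m i w)) = Ew m G.
Proof.
move=> ir; have := Ew_blocks m r (fun j w => if j == i then G w else 1).
rewrite (bigD1 (Ordinal ir))//= [X in _ * X]big1; last first.
  by move=> j; rewrite -val_eqE/= => /negbTE ->; rewrite Ew_cst.
rewrite eqxx mulr1 => <-; apply: eq_Ew => w _.
rewrite (bigD1 (Ordinal ir))//= eqxx big1 ?mulr1// => j.
by rewrite -val_eqE/= => /negbTE ->.
Qed.

Lemma walk_path_block k m w (i : nat) t : (0 < k)%N -> (0 < m)%N ->
  i%:R / k%:R <= t <= i.+1%:R / k%:R ->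
  walk_path (k * m) w t - walk_path (k * m) w (i%:R / k%:R) =
  walk (block m i w) ((k * m)%:R * t - (i * m)%:R) / Num.sqrt (k * m)%:R.
Proof.
move=> k0 m0 /andP[it ti]; rewrite /walk_path -mulrBl; congr (_ / _).
have kR : 0 < k%:R :> R by rewrite ltr0n.
have mR : 0 < m%:R :> R by rewrite ltr0n.
have e : (k * m)%:R * (i%:R / k%:R) = (i * m)%:R :> R.
  by rewrite !natrM; field; exact: lt0r_neq0.
have s0 : 0 <= (k * m)%:R * t - (i * m)%:R.
  by rewrite -e -mulrBr mulr_ge0// subr_ge0.
have sm : (k * m)%:R * t - (i * m)%:R <= m%:R.
  rewrite -e -mulrBr; apply: (@le_trans _ _ ((k * m)%:R * k%:R^-1)).
    by apply: ler_wpM2l => //; move: ti; rewrite -(@natr1 _ i) mulrDl mul1r; lra.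
  by rewrite natrM mulrAC mulfV ?mul1r// lt0r_neq0.
rewrite e walk_nat /block walk_take min_l//.
have [wi|iw] := leqP (size w) (i * m).
  rewrite take_oversize// drop_oversize//= walk_ge ?subrr//.
  by apply: (@le_trans _ _ (i * m)%:R); [rewrite ler_nat|lra].
rewrite -{1}(cat_take_drop (i * m) w) walk_cat walk_ge ?size_takel ?(ltnW iw)//; last by lra.
by rewrite addrAC subrr add0r.
Qed.

Definition step_mass (K k M : nat) (c : 'I_(grid_J K k).*2.+1) : R :=
  Ew M.*2 (fun v => (cell (grid_theta K k) (grid_J K k)
    (Num.sqrt k%:R^-1 * (hgt v)%:~R / Num.sqrt M.*2%:R) == c)%:R).

(** Walk and Brownian motion give the same [grid_sum], at different masses of single cells; with the
    grid fixed, their comparison reduces to one increment, that is to [step_mass_cvg]. *)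
Lemma Ew_quantised (L : (R -> R) -> R) (K k M : nat) : (0 < K)%N -> (0 < k)%N -> (0 < M)%N ->
  Ew (K * k * M.*2) (fun w => L (quantised K k (walk_path (k * M.*2) w))) =
  grid_sum L (@step_mass K k M).
Proof.
move=> K0 k0 M0; have m0 : (0 < M.*2)%N by rewrite double_gt0.
have kR : 0 < k%:R :> R by rewrite ltr0n.
have mR : 0 < M.*2%:R :> R by rewrite ltr0n.
rewrite (funext (fun w => step_path_sum (grid_theta K k) (grid_J K k) k (K * k) L (walk_path (k * M.*2) w))).
rewrite Ew_sum; apply: eq_bigr => j _; rewrite EwZ; congr (_ * _).
pose G (i : nat) v : R := if insub i is Some i' then (cell (grid_theta K k) (grid_J K k)
    (Num.sqrt k%:R^-1 * (hgt v)%:~R / Num.sqrt M.*2%:R) == j i')%:R else 1.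
transitivity (Ew (K * k * M.*2) (fun w => \prod_(i < K * k) G i (block M.*2 i w))).
  apply: eq_Ew => w wn; apply: eq_bigr => i _; rewrite /G valK.
  rewrite walk_path_block//; last by rewrite lexx andbT ler_pM2r ?invr_gt0// ler_nat.
  have -> : (k * M.*2)%:R * (i.+1%:R / k%:R) - (i * M.*2)%:R = M.*2%:R :> R.
    rewrite !natrM -(@natr1 _ i); field; exact: lt0r_neq0.
  rewrite walk_ge; last by rewrite /block size_take; case: ltnP => //; rewrite ler_nat.
  congr ((cell _ _ _ == _)%:R).
  by rewrite natrM sqrtrM// invfM sqrtrV// mulrCA mulrA.
rewrite Ew_blocks; apply: eq_bigr => i _; rewrite /G valK.
by [].
Qed.

Lemma surv_mass (sigma theta : R) J c : 0 < sigma ->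
  Ew M.*2 (fun v => (surv theta J c (sigma * (hgt v)%:~R / Num.sqrt M.*2%:R))%:R) @[M --> \oo]
  --> EP (normal_prob 0 sigma) (fun x => (surv theta J c x)%:R).
Proof.
move=> s0; rewrite /surv; case: eqP => [_|_] /=.
  rewrite EP_cst; under eq_cvg do rewrite Ew_cst; exact: cvg_cst.
case: leqP => _ /=; last first.
  rewrite EP_cst; under eq_cvg do rewrite Ew_cst; exact: cvg_cst.
set a := _ * theta.
have -> : EP (normal_prob 0 sigma) (fun x => (a <= x)%R%:R) = 1 - Phi sigma a.
  rewrite (_ : (fun x => _) = (fun x => 1 - \1_`]-oo, a[%classic x)); last first.
    apply/funext => x; rewrite indicE mem_setE in_itv/= ltNge.
    by case: (a <= x); rewrite ?subr0 ?subrr.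
  rewrite EPB; last 2 first.
  - exact: bmf_cst.
  - by apply: bmf01; [exact: measurable_indic|move=> x; rewrite indicE; case: (_ \in _); rewrite ?ler01 ?lexx].
  by rewrite EP_cst EP_indic.
have eM M : Ew M.*2 (fun v => (a <= sigma * (hgt v)%:~R / Num.sqrt M.*2%:R)%R%:R) =
    1 - Ew M.*2 (fun v => (sigma * (hgt v)%:~R / Num.sqrt M.*2%:R < a)%R%:R : R).
  rewrite -[X in _ = X - _](Ew_cst M.*2) -EwB; apply: eq_Ew => v _.
  by rewrite ltNge; case: (a <= _); rewrite ?subr0 ?subrr.
under eq_cvg do rewrite eM.
apply: cvgB; first exact: cvg_cst.
apply/cvgrPdist_le => e e0; have [M0 h] := de_moivre_laplace a s0 e0.
by exists M0 => // M /= /h; rewrite distrC.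
Qed.

Lemma step_mass_cvg (K k : nat) (c : 'I_(grid_J K k).*2.+1) : (0 < K)%N -> (0 < k)%N ->
  step_mass M c @[M --> \oo] --> cell_mass c.
Proof.
move=> K0 k0; have th0 : 0 < grid_theta K k by rewrite invr_gt0 ltr0n !muln_gt0 k0 K0.
have s0 : 0 < Num.sqrt k%:R^-1 :> R by rewrite sqrtr_gt0 invr_gt0 ltr0n.
have bs i : bmf (fun x : R => (surv (grid_theta K k) (grid_J K k) i x)%:R : R).
  apply: bmf01; first exact: measurable_surv.
  by move=> x; rewrite ler0n lern1 leq_b1.
have -> : cell_mass c = EP (normal_prob 0 (Num.sqrt k%:R^-1))
    (fun x => (surv (grid_theta K k) (grid_J K k) c x)%:R) -
  EP (normal_prob 0 (Num.sqrt k%:R^-1))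
    (fun x => (surv (grid_theta K k) (grid_J K k) c.+1 x)%:R).
  have -> : cell_mass c = EP (normal_prob 0 (Num.sqrt k%:R^-1))
      (\1_[set x | cell (grid_theta K k) (grid_J K k) x = c] : R -> R).
    by rewrite EP_indic//; exact: measurable_cell_set.
  rewrite -EPB; [|exact: bs|exact: bs].
  congr EP; apply/funext => x; rewrite -cell_indic// indicE.
  have -> // : (x \in [set x | cell (grid_theta K k) (grid_J K k) x = c]) =
      (cell (grid_theta K k) (grid_J K k) x == c).
  by apply/idP/eqP => [|h]; rewrite inE.
have smE M : step_mass M c =
    Ew M.*2 (fun v => (surv (grid_theta K k) (grid_J K k) c
      (Num.sqrt k%:R^-1 * (hgt v)%:~R / Num.sqrt M.*2%:R))%:R) -
    Ew M.*2 (fun v => (surv (grid_theta K k) (grid_J K k) c.+1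
      (Num.sqrt k%:R^-1 * (hgt v)%:~R / Num.sqrt M.*2%:R))%:R) :> R.
  by rewrite -EwB; apply: eq_Ew => v _; rewrite cell_indic.
under eq_cvg do rewrite smE.
by apply: cvgB; exact: surv_mass.
Qed.

Lemma grid_sum_cvg (L : (R -> R) -> R) (K k : nat) : (0 < K)%N -> (0 < k)%N ->
  grid_sum L (@step_mass K k M) @[M --> \oo] --> grid_sum L (@cell_mass K k).
Proof.
move=> K0 k0; apply: cvg_big => [|j _]; first exact: add_continuous.
apply: cvgM; first exact: cvg_cst.
by apply: cvg_big => [|i _]; [exact: mul_continuous|exact: step_mass_cvg].
Qed.

(** Union bound over the [K * k] blocks: by [max_ineq] each block oscillates by more than [eta] with
    probability at most 3 / (eta^4 k^2). A second-moment bound would give only O(1/k) per block, and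
    the sum would not vanish. *)
Lemma walk_quantised_close (K k M : nat) (eta : R) (L : (R -> R) -> R) (m : R) :
  (0 < K)%N -> (0 < k)%N -> (0 < M)%N -> 0 < eta <= 1 -> 0 <= m ->
  (forall e, 0 <= L e <= 1) -> lip K%:R m L ->
  `|Ew (K * k * M.*2) (fun w => L (walk_path (k * M.*2) w)) -
    Ew (K * k * M.*2) (fun w => L (quantised K k (walk_path (k * M.*2) w)))| <=
  m * (eta + k%:R^-1) + 3 * K%:R / eta ^+ 4 / k%:R.
Proof.
move=> K0 k0 M0 /andP[eta0 eta1] m0 L01 lipL.
have mpos : (0 < M.*2)%N by rewrite double_gt0.
have kR : 0 < k%:R :> R by rewrite ltr0n.
have mR : 0 < M.*2%:R :> R by rewrite ltr0n.
have nR : 0 < (k * M.*2)%:R :> R by rewrite natrM mulr_gt0.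
have sq0 : 0 < Num.sqrt (k * M.*2)%:R :> R by rewrite sqrtr_gt0.
pose bad i w := hits (eta * Num.sqrt (k * M.*2)%:R) 0 (block M.*2 i w).
have pw w : `|L (walk_path (k * M.*2) w) - L (quantised K k (walk_path (k * M.*2) w))| <=
    m * (eta + k%:R^-1) + \sum_(i < K * k) (bad i w)%:R.
  have [allgood|/existsP[i badi]] := boolP [forall i : 'I_(K * k), ~~ bad i w]; last first.
    apply: (@le_trans _ _ 1).
      have /andP[? ?] := L01 (walk_path (k * M.*2) w).
      have /andP[? ?] := L01 (quantised K k (walk_path (k * M.*2) w)).
      by rewrite ler_norml; lra.
    rewrite (bigD1 i)//=; rewrite negbK in badi; rewrite badi /= mulr1n.
    have : 0 <= \sum_(j < K * k | j != i) (bad j w)%:R :> R by apply: sumr_ge0.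
    have : 0 <= m * (eta + k%:R^-1) by rewrite mulr_ge0// addr_ge0 ?ltW// invr_gt0.
    by lra.
  rewrite big1 ?addr0; last by move=> i _; rewrite (negbTE (forallP allgood i)).
  apply: lipL; apply: quantised_close => //.
  - by rewrite ltW.
  - by rewrite /walk_path mulr0 walk_le0// mul0r.
  move=> i t iK it; rewrite walk_path_block//.
  rewrite normrM [`|_^-1|]gtr0_norm ?invr_gt0// ler_pdivrMr//.
  have good := hitsPn (forallP allgood (Ordinal iK)).
  apply: (@walk_max _ _ _ 0 M.*2).
    by move=> j _; have := good j; rewrite add0r => /ltW.
  have e : (k * M.*2)%:R * (i%:R / k%:R) = (i * M.*2)%:R :> R.
    by rewrite !natrM; field; exact: lt0r_neq0.
  case/andP: it => it ti; rewrite -e -mulrBr mulr_ge0 ?subr_ge0//=.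
  apply: (@le_trans _ _ ((k * M.*2)%:R * k%:R^-1)).
    by apply: ler_wpM2l => //; move: ti; rewrite -(@natr1 _ i) mulrDl mul1r; lra.
  by rewrite natrM mulrAC mulfV ?mul1r// lt0r_neq0.
rewrite -EwB; apply: le_trans (ler_norm_Ew _ _) _.
apply: le_trans (le_Ew (fun w _ => pw w)) _.
rewrite EwD Ew_cst lerD2l Ew_sum.
apply: (@le_trans _ _ (\sum_(i < K * k) 3 / (eta ^+ 4 * k%:R ^+ 2))); last first.
  rewrite sumr_const card_ord -[leLHS]mulr_natl natrM.
  rewrite le_eqVlt; apply/orP; left; apply/eqP; field.
  by rewrite !lt0r_neq0.
apply: ler_sum => i _; rewrite (@Ew_block _ _ _ (fun v => (hits (eta * Num.sqrt (k * M.*2)%:R) 0 v)%:R))//.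
apply: le_trans (max_ineq _ _ _) _; first by rewrite mulr_gt0.
rewrite !expr0n/= mulr0 mul0r !add0r exprMn.
have -> : Num.sqrt (k * M.*2)%:R ^+ 4 = (k * M.*2)%:R ^+ 2 :> R.
  by rewrite (exprM _ 2 2) sqr_sqrtr.
rewrite natrM exprMn le_eqVlt; apply/orP; left; apply/eqP; field.
by rewrite !lt0r_neq0.
Qed.

(** The grid size [k] is fixed first; then [M], half the number of steps per grid interval, tends to
    infinity. The path has [k * M.*2] steps per unit of time, on [0, K]. *)
Lemma donsker_lip (B : R -> {RV P >-> R}) (K : nat) (L : (R -> R) -> R) (m e : R) :
  standard_brownian_motion B -> (0 < K)%N -> 0 <= m ->
  (forall e, 0 <= L e <= 1) -> lip K%:R m L -> 0 < e ->
  \forall k \near \oo, \forall M \near \oo,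
  `|Ew (K * k * M.*2) (fun w => L (walk_path (k * M.*2) w)) -
    EP P (fun w => L (fun t => B t w))| <= e.
Proof.
move=> BM K0 m0 L01 lipL e0.
have m1 : 0 < m + 1 by rewrite ltr_wpDl.
pose eta := Num.min 1 (e / (8 * (m + 1))).
have eta0 : 0 < eta by rewrite lt_min ltr01 divr_gt0// mulr_gt0.
have meta : m * eta <= e / 8.
  have : eta <= e / (8 * (m + 1)) by rewrite ge_min lexx orbT.
  rewrite ler_pdivlMr ?mulr_gt0//; lra.
have e4 : 0 < eta ^+ 4 by rewrite exprn_gt0.
have KR : 0 < K%:R :> R by rewrite ltr0n.
have quant : \forall k \near \oo, `|EP P (fun w => L (quantised K k (fun t => B t w))) -
    EP P (fun w => L (fun t => B t w))| <= e / 4.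
  have h : EP P (fun w => L (quantised K k (fun t => B t w))) @[k --> \oo] -->
      EP P (fun w => L (fun t => B t w)).
    rewrite -(cvg_shiftS (fun k => EP P (fun w => L (quantised K k (fun t => B t w))))).
    apply: (@EP_quantised_cvg (fun t w => B t w) K L m) => //.
      by move=> w; exact: bm0.
    by move=> w; exact: bm_continuous.
  have /cvgrPdist_le/(_ (e / 4)) := h; rewrite divr_gt0// => /(_ isT) h'.
  by near=> k; rewrite distrC; near: k; exact: h'.
have [N NR] : exists N : nat, eta^-1 + (3 * K%:R / eta ^+ 4) * (8 / e) <= N%:R.
  by exists (Num.truncn (eta^-1 + (3 * K%:R / eta ^+ 4) * (8 / e))).+1; exact/ltW/truncnS_gt.
near=> k.
have k0 : (0 < k)%N by near: k; exists 1%N.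
have kR : 0 < k%:R :> R by rewrite ltr0n.
have kN : eta^-1 + (3 * K%:R / eta ^+ 4) * (8 / e) <= k%:R.
  by apply: le_trans NR _; rewrite ler_nat; near: k; exists N.
have a1 : 0 < (3 * K%:R / eta ^+ 4) * (8 / e) by rewrite mulr_gt0// divr_gt0// mulr_gt0.
have a2 : 0 < eta^-1 by rewrite invr_gt0.
have keta : k%:R^-1 <= eta by rewrite -[leRHS]invrK lef_pV2 ?posrE//; lra.
have tail : 3 * K%:R / eta ^+ 4 / k%:R <= e / 8.
  rewrite ler_pdivrMr//; set A := _ / eta ^+ 4 in a1 kN *.
  have -> : A = e / 8 * (A * (8 / e)) by field; exact: lt0r_neq0.
  by apply: ler_wpM2l; [rewrite divr_ge0// ltW|lra].
near=> M.
have M0 : (0 < M)%N by near: M; exists 1%N.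
have h1 : `|Ew (K * k * M.*2) (fun w => L (walk_path (k * M.*2) w)) -
    Ew (K * k * M.*2) (fun w => L (quantised K k (walk_path (k * M.*2) w)))| <= e / 2.
  have eta01 : 0 < eta <= 1 by rewrite eta0 ge_min lexx.
  apply: le_trans (walk_quantised_close K0 k0 M0 eta01 m0 L01 lipL) _.
  have : m * (eta + k%:R^-1) <= m * (eta + eta) by apply: ler_wpM2l => //; lra.
  by lra.
have h2 : `|grid_sum L (@cell_mass K k) - grid_sum L (@step_mass K k M)| <= e / 4.
  near: M; have /cvgrPdist_le := @grid_sum_cvg L _ _ K0 k0; apply.
  by rewrite divr_gt0.
have h3 : `|grid_sum L (@cell_mass K k) - EP P (fun w => L (fun t => B t w))| <= e / 4.
  by rewrite -(EP_quantised BM L K0 k0); near: k; exact: quant.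
rewrite Ew_quantised// in h1.
have t1 := ler_distD (grid_sum L (@step_mass K k M)) (Ew (K * k * M.*2) (fun w => L (walk_path (k * M.*2) w))) (EP P (fun w => L (fun t => B t w))).
have t2 := ler_distD (grid_sum L (@cell_mass K k)) (grid_sum L (@step_mass K k M)) (EP P (fun w => L (fun t => B t w))).
rewrite (distrC (grid_sum L (@step_mass K k M)) (grid_sum L (@cell_mass K k))) in t2.
by lra.
Unshelve. all: by end_near. Qed.

End donsker.

(** * Functionals continuous at almost every Brownian path *)

Section almost_measurable.
Context {d : measure_display} {T : measurableType d} {R : realType}.
Variable P : probability T R.
Implicit Types f g : T -> R.
Import HBNNSimple.

(* Simple functions below [f] may be set to 0 on a negligible set, so the
   integral ignores such sets even when [f] is not measurable. *)
Lemma ge0_integral_ae (f g : T -> \bar R) : (forall w, 0 <= f w)%E -> (forall w, 0 <= g w)%E ->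
  {ae P, forall w, f w = g w} -> (\int[P]_w f w = \int[P]_w g w)%E.
Proof.
suff h (f1 g1 : T -> \bar R) : (forall w, 0 <= f1 w)%E -> (forall w, 0 <= g1 w)%E ->
    {ae P, forall w, f1 w = g1 w} -> (\int[P]_w f1 w <= \int[P]_w g1 w)%E.
  move=> f0 g0 fg; apply/eqP; rewrite eq_le !h//.
  by apply: filterS fg => w ->.
move=> f0 g0 [N [mN N0 subN]].
rewrite !ge0_integralTE//; apply/ge_ereal_sup => /= _ [s sf <-].
have mC : measurable (~` N) by exact: measurableC.
apply: (@le_trans _ _ (sintegral P (proj_nnsfun s mC))).
  rewrite -!integralT_nnsfun; rewrite le_eqVlt; apply/orP; left; apply/eqP.
  apply: ge0_ae_eq_integral => //.
  - exact/measurable_EFinP.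
  - exact/measurable_EFinP.
  - by move=> w _; rewrite lee_fin.
  - by move=> w _; rewrite lee_fin.
  - exists N; split => // w /= => h; apply: contrapT => Nw; apply: h => _.
    by rewrite mindicE mem_set// mulr1.
apply: ereal_sup_ubound => /=; exists (proj_nnsfun s mC) => //= w.
rewrite mindicE; case: (boolP (w \in ~` N)) => /= [|_]; last by rewrite mulr0.
rewrite inE => Nw; rewrite mulr1 (le_trans (sf w))//.
by have -> : f1 w = g1 w by apply: contrapT => fg; apply: Nw; exact: subN.
Qed.

Lemma integral_ae (f g : T -> \bar R) :
  {ae P, forall w, f w = g w} -> (\int[P]_w f w = \int[P]_w g w)%E.
Proof.
move=> fg; rewrite integralE [RHS]integralE; congr (_ - _)%E.
  by apply: ge0_integral_ae => //; apply: filterS fg => w /= fw; rewrite !funeposE fw.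
by apply: ge0_integral_ae => //; apply: filterS fg => w /= fw; rewrite !funenegE fw.
Qed.

Lemma EP_ae f g : {ae P, forall w, f w = g w} -> EP P f = EP P g.
Proof.
move=> fg; rewrite /EP /Rintegral; congr fine; apply: integral_ae.
by apply: filterS fg => w /= ->.
Qed.

(** [P] is not assumed complete, so an almost sure limit of measurable functions need only agree
    almost everywhere with a measurable one; by [EP_ae] the expectation does not see the
    difference. *)
Definition aebmf f := exists2 g, bmf g & {ae P, forall w, f w = g w}.

Lemma aebmf_bmf f : bmf f -> aebmf f.
Proof. by exists f => //; exact: aeW. Qed.

Lemma aebmf_expectation f : aebmf f -> ('E_P[f])%E = (EP P f)%:E.
Proof.
move=> [g bg fg]; rewrite (EP_ae fg) -expectation_EP// unlock; apply: integral_ae.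
by apply: filterS fg => w ->.
Qed.

Lemma aebmf_cst (c : R) : aebmf (fun=> c).
Proof. exact/aebmf_bmf/bmf_cst. Qed.

Lemma aebmfD f g : aebmf f -> aebmf g -> aebmf (fun w => f w + g w).
Proof.
move=> [f' bf ff] [g' bg gg]; exists (fun w => f' w + g' w); first exact: bmfD.
by apply: filterS2 ff gg => w -> ->.
Qed.

Lemma aebmfB f g : aebmf f -> aebmf g -> aebmf (fun w => f w - g w).
Proof.
move=> [f' bf ff] [g' bg gg]; exists (fun w => f' w - g' w); first exact: bmfB.
by apply: filterS2 ff gg => w -> ->.
Qed.

Lemma aebmfM f g : aebmf f -> aebmf g -> aebmf (fun w => f w * g w).
Proof.
move=> [f' bf ff] [g' bg gg]; exists (fun w => f' w * g' w); first exact: bmfM.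
by apply: filterS2 ff gg => w -> ->.
Qed.

Lemma aeEPD f g : aebmf f -> aebmf g -> EP P (fun w => f w + g w) = EP P f + EP P g.
Proof.
move=> [f' bf ff] [g' bg gg]; rewrite (EP_ae ff) (EP_ae gg) -EPD//.
by apply: EP_ae; apply: filterS2 ff gg => w -> ->.
Qed.

Lemma aeEPB f g : aebmf f -> aebmf g -> EP P (fun w => f w - g w) = EP P f - EP P g.
Proof.
move=> [f' bf ff] [g' bg gg]; rewrite (EP_ae ff) (EP_ae gg) -EPB//.
by apply: EP_ae; apply: filterS2 ff gg => w -> ->.
Qed.

Lemma aeEPZ (c : R) f : aebmf f -> EP P (fun w => c * f w) = c * EP P f.
Proof.
move=> [f' bf ff]; rewrite (EP_ae ff) -EPZ//.
by apply: EP_ae; apply: filterS ff => w ->.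
Qed.

Lemma aele_EP f g : aebmf f -> aebmf g -> {ae P, forall w, f w <= g w} -> EP P f <= EP P g.
Proof.
move=> [f' bf ff] [g' bg gg] fg.
(* The representatives are ordered only almost everywhere; the maximum is another representative of
   [g] and dominates [f'] everywhere. *)
have bgf : bmf (fun w => Num.max (f' w) (g' w)).
  case: bf bg => [mf [C fC]] [mg [D gD]]; split; first exact: measurable_maxr.
  by exists (Num.max C D) => w; rewrite /Num.max; do 2!case: ifP => //=; have := fC w; have := gD w; lra.
have <- : EP P (fun w => Num.max (f' w) (g' w)) = EP P g.
  apply: EP_ae; apply: filterS3 ff gg fg => w -> ->; exact: max_r.
by rewrite (EP_ae ff); apply: le_EP => // w; rewrite le_max lexx.
Qed.

Lemma aeEP_dominated (f : nat -> T -> R) g (C : R) :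
  (forall n, aebmf (f n)) -> (forall n w, `|f n w| <= C) ->
  {ae P, forall w, f n w @[n --> \oo] --> g w} ->
  aebmf g /\ EP P (f n) @[n --> \oo] --> EP P g.
Proof.
move=> af fC fg; have [f' f'P] := choice (fun n => let: ex_intro2 f' bf ff := af n in
  ex_intro (fun f' => bmf f' /\ {ae P, forall w, f n w = f' w}) f' (conj bf ff)).
have ff : {ae P, forall w, forall n, f n w = f' n w}.
  by apply/ae_foralln => n; case: (f'P n).
have : {ae P, forall w, (forall n, f n w = f' n w) /\ f n w @[n --> \oo] --> g w}.
  by apply: filterS2 ff fg.
move=> [N [mN N0 subN]].
have good w : ~ N w -> (forall n, f n w = f' n w) /\ f n w @[n --> \oo] --> g w.
  by move=> Nw; apply: contrapT => h; apply: Nw; exact: subN.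
(* Multiplying by the indicator of the good set makes the functions measurable and the convergence
   valid everywhere, so that the limit is measurable too. *)
pose i : T -> R := \1_(~` N).
have mi : measurable_fun setT i by apply: measurable_indic; exact: measurableC.
have fi n : (fun w => f n w * i w) = (fun w => f' n w * i w).
  apply/funext => w; rewrite /i indicE; case: (boolP (w \in _)) => [|_]; rewrite ?mulr0//.
  by rewrite inE => /good[-> _].
have mf n : measurable_fun setT (fun w => f n w * i w).
  by rewrite fi; apply: measurable_funM => //; have [[]] := f'P n.
have fgi w : f n w * i w @[n --> \oo] --> g w * i w.
  rewrite /i indicE; case: (boolP (w \in _)) => [|_]; last first.
    by under eq_cvg do rewrite mulr0; rewrite mulr0; exact: cvg_cst.
  by rewrite inE => /good[_ h]; apply: cvgM => //; exact: cvg_cst.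
have fiC n w : `|f n w * i w| <= C.
  rewrite /i indicE; have := fC n w.
  by case: (_ \in _); rewrite ?mulr0 ?mulr1// normr0; exact: le_trans.
have mg : measurable_fun setT (fun w => g w * i w) by apply: measurable_fun_cvg mf _ => w _.
have ie (h : T -> R) : {ae P, forall w, h w = h w * i w}.
  exists N; split => // w /= hw; apply: contrapT => Nw; apply: hw.
  by rewrite /i indicE mem_set// mulr1.
split.
  exists (fun w => g w * i w) => //; split => //; exists C => w.
  have h := cvg_norm (fgi w) _; rewrite -(cvg_lim _ (h _))//.
  by apply: limr_le; [exact: cvgP (h _)|exact: nearW].
rewrite (EP_ae (ie g)); under eq_cvg do rewrite (EP_ae (ie _)).
by apply: (EP_dominated (C := C)) => //; apply: aeW.
Qed.

End almost_measurable.

(** * Lipschitz envelopes *)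

Section envelope.
Context {R : realType}.
Variables (C : (R -> R) -> Prop) (K : nat).
Implicit Types (Psi : (R -> R) -> R) (e f y : R -> R).

Definition close f y (s : R) := forall t, 0 <= t <= K%:R -> `|f t - y t| <= s.

Definition cont_at Psi f := forall eps : R, 0 < eps ->
  exists2 del : R, 0 < del &
    forall y, C y -> close f y del -> `|Psi f - Psi y| <= eps.

(* The largest [m]-Lipschitz function below [Psi] on [C]; the element [1] keeps
   the set nonempty when no [y] is uniformly close to [f]. *)
Definition envelope Psi (m : R) f : R :=
  inf [set v | v = 1 \/ exists (y : R -> R) (s : R), [/\ C y, 0 <= s, close f y s & v = Psi y + m * s]].

Variable Psi : (R -> R) -> R.
Hypothesis Psi01 : forall f, 0 <= Psi f <= 1.

Let Kge0 : (0 : R) <= 0 <= (K%:R : R). Proof. by rewrite lexx ler0n. Qed.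

Lemma envelope_ge (m : R) f (c : R) : 0 <= m -> c <= 1 ->
  (forall (y : R -> R) (s : R), C y -> 0 <= s -> close f y s -> c <= Psi y + m * s) -> c <= envelope Psi m f.
Proof.
move=> m0 c1 h; apply: lb_le_inf; first by exists 1; left.
by move=> v [->//|[y [s [py s0 fy ->]]]]; exact: h.
Qed.

Lemma envelope_lb (m : R) f : 0 <= m ->
  has_lbound [set v | v = 1 \/ exists (y : R -> R) (s : R), [/\ C y, 0 <= s, close f y s & v = Psi y + m * s]].
Proof.
move=> m0; exists 0 => v [->//|[y [s [py s0 fy ->]]]].
by have /andP[p0 _] := Psi01 y; rewrite addr_ge0// mulr_ge0.
Qed.

Lemma envelope_le (m : R) f y (s : R) : 0 <= m -> C y -> 0 <= s -> close f y s ->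
  envelope Psi m f <= Psi y + m * s.
Proof. by move=> m0 py s0 fy; apply: inf_lbound; [exact: envelope_lb|right; exists y, s]. Qed.

Lemma envelope01 (m : R) f : 0 <= m -> 0 <= envelope Psi m f <= 1.
Proof.
move=> m0; apply/andP; split.
  apply: envelope_ge => // y s _ s0 _.
  by have /andP[p0 _] := Psi01 y; rewrite addr_ge0// mulr_ge0.
by apply: inf_lbound; [exact: envelope_lb|left].
Qed.

Lemma lip_envelope (m : R) : 0 <= m -> lip K%:R m (envelope Psi m).
Proof.
move=> m0.
suff h (e e' : R -> R) (s : R) : (forall x : R, 0 <= x <= K%:R -> `|e x - e' x| <= s) ->
    envelope Psi m e - m * s <= envelope Psi m e'.
  move=> e e' s ee'; have h1 := h _ _ _ ee'.
  have h2 : envelope Psi m e' - m * s <= envelope Psi m e.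
    by apply: h => x xK; rewrite distrC; exact: ee'.
  by rewrite ler_norml; lra.
move=> ee'; have s0 : 0 <= s by apply: le_trans (ee' 0 Kge0).
have ms : 0 <= m * s by rewrite mulr_ge0.
have /andP[_ e1] := envelope01 e m0.
apply: envelope_ge => //; first by lra.
move=> y r py r0 e'y; have : envelope Psi m e <= Psi y + m * (r + s).
  apply: envelope_le => //; first by rewrite addr_ge0.
  move=> t tK; have := ee' t tK; have := e'y t tK.
  by have := ler_distD (e' t) (e t) (y t); lra.
by rewrite mulrDr; lra.
Qed.

Lemma envelope_le_self (m : R) f : 0 <= m -> C f -> envelope Psi m f <= Psi f.
Proof.
move=> m0 pf; rewrite -[leRHS]addr0 -(mulr0 m).
by apply: envelope_le => // t _; rewrite subrr normr0.
Qed.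

(** In the infimum, a competitor within [del] of [f] has nearly the same value by continuity; a
    farther one pays at least [n%:R * del >= 1], which already exceeds [Psi f]. *)
Lemma envelope_cvg f : C f -> cont_at Psi f ->
  envelope Psi n%:R f @[n --> \oo] --> Psi f.
Proof.
move=> pf cf; apply/cvgrPdist_le => /= eps' eps0; pose eps : R := eps'; rewrite -/eps.
have {}eps0 : 0 < eps by [].
have [del del0 h] := cf eps eps0.
exists (Num.truncn del^-1).+1 => // n /= nd.
have ndel : 1 <= n%:R * del.
  rewrite -ler_pdivrMr// div1r; apply: (le_trans (ltW (truncnS_gt _))).
  by rewrite ler_nat.
rewrite ger0_norm ?subr_ge0 ?envelope_le_self// lerBlDr addrC -lerBlDr.
have /andP[p0 p1] := Psi01 f.
apply: envelope_ge => //; first by lra.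
move=> y s py s0 fy; have /andP[y0 y1] := Psi01 y.
have [sd|ds] := leP s del.
  have : `|Psi f - Psi y| <= eps by apply: h => // t tK; exact: le_trans (fy t tK) sd.
  have ns : 0 <= n%:R * s by rewrite mulr_ge0.
  by rewrite ler_norml; lra.
have : n%:R * del <= n%:R * s by apply: ler_wpM2l => //; exact: ltW.
by lra.
Qed.

End envelope.

(** * The mapping theorem for Donsker's convergence *)

Section mapping.
Context {d : measure_display} {T : measurableType d} {R : realType}.
Variable P : probability T R.
Variables (B : R -> {RV P >-> R}) (K : nat).
Hypotheses (BM : standard_brownian_motion B) (K0 : (0 < K)%N).
Implicit Types (Psi : (R -> R) -> R) (e f y : R -> R).

Definition cpath f := {within `[0, K%:R], continuous f} /\ f 0 = 0.

Section one_sided.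
Variable Psi : (R -> R) -> R.
Hypothesis Psi01 : forall f, 0 <= Psi f <= 1.

Lemma path_bm w : cpath (fun t => B t w).
Proof. by split; [exact: bm_continuous BM _ _|exact: bm0 BM _]. Qed.

Lemma path_walk n w : cpath (walk_path n w).
Proof.
split; last by rewrite /walk_path mulr0 walk_le0// mul0r.
apply: continuous_subspaceT => t; rewrite /walk_path.
apply: cvgM; last exact: cvg_cst.
apply: (@continuous_comp _ _ _ (fun t : R => n%:R * t) (walk w)).
  by apply: cvgM; [exact: cvg_cst|exact: cvg_id].
exact: continuous_walk.
Qed.

Hypothesis cPsi : {ae P, forall w, cont_at cpath K Psi (fun t => B t w)}.

Lemma envelope_bm : aebmf P (fun w => Psi (fun t => B t w)) /\
  EP P (fun w => envelope cpath K Psi n%:R (fun t => B t w)) @[n --> \oo] -->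
    EP P (fun w => Psi (fun t => B t w)).
Proof.
apply: (aeEP_dominated (C := 1)) => //.
- move=> n; apply/aebmf_bmf/(@bmf_lip _ _ _ (fun t w => B t w) K _ n%:R) => //.
  + exact: lip_envelope.
  + by move=> w; exact: bm0 BM w.
  + by move=> w; exact: bm_continuous BM _ _.
  + by move=> e; exact: envelope01.
- by move=> n w; have /andP[? ?] := envelope01 cpath K Psi01 (fun t => B t w) (ler0n R n); rewrite ger0_norm.
- by apply: filterS cPsi => w; apply: (envelope_cvg Psi01) => //; exact: path_bm.
Qed.

(** A Lipschitz envelope lies below [Psi], so [donsker_lip] gives one inequality only; the other one
    follows by applying this to [1 - Psi]. *)
Lemma donsker_lower (eps : R) : 0 < eps ->
  \forall k \near \oo, \forall M \near \oo,
  EP P (fun w => Psi (fun t => B t w)) - eps <=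
  Ew (K * k * M.*2) (fun w => Psi (walk_path (k * M.*2) w)).
Proof.
move=> eps0.
have [_] := envelope_bm.
move=> /cvgrPdist_le/(_ (eps / 2)); rewrite divr_gt0// => /(_ isT)[n _ /(_ n (leqnn n))/=].
rewrite ler_norml => /andP[_ h1].
have n0 : 0 <= n%:R :> R by [].
have eps2 : 0 < eps / 2 by rewrite divr_gt0.
have := donsker_lip BM K0 n0 (fun e => envelope01 cpath K Psi01 e n0) (@lip_envelope _ cpath K _ Psi01 _ n0) eps2.
apply: filterS => k; apply: filterS => M; rewrite ler_norml => /andP[h2 _].
apply: (@le_trans _ _ (Ew (K * k * M.*2) (fun w => envelope cpath K Psi n%:R (walk_path (k * M.*2) w)))).
  by lra.
by apply: le_Ew => w _; apply: envelope_le_self => //; exact: path_walk.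
Qed.

End one_sided.

Lemma donsker Psi (eps : R) : (forall f, 0 <= Psi f <= 1) ->
  {ae P, forall w, cont_at cpath K Psi (fun t => B t w)} -> 0 < eps ->
  \forall k \near \oo, \forall M \near \oo,
  `|Ew (K * k * M.*2) (fun w => Psi (walk_path (k * M.*2) w)) -
    EP P (fun w => Psi (fun t => B t w))| <= eps.
Proof.
move=> Psi01 cPsi eps0.
have h1 := donsker_lower Psi01 cPsi eps0.
have Psi01' f : 0 <= 1 - Psi f <= 1 by have := Psi01 f; lra.
have cPsi' : {ae P, forall w, cont_at cpath K (fun f => 1 - Psi f) (fun t => B t w)}.
  apply: filterS cPsi => w cw e e0; have [del del0 h] := cw e e0.
  exists del => // y py wy; rewrite opprD addrACA subrr add0r -normrN opprD !opprK.
  exact: h.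
have h2 := @donsker_lower (fun f => 1 - Psi f) Psi01' cPsi' _ eps0.
apply: filterS2 h1 h2 => k; apply: filterS2 => M a1.
rewrite EwB Ew_cst aeEPB ?EP_cst; [|exact: aebmf_cst|by have [] := envelope_bm Psi01 cPsi].
by rewrite ler_norml; lra.
Qed.

End mapping.

(** * The excursion of a walk straddling a given time *)

Section straddling.
Context {R : realType}.
Implicit Types (F : seq bool -> R) (w v : seq bool) (f : R -> R) (h : (R -> R) -> R).

Lemma pexc_even v : pexc v -> ~~ odd (size v).
Proof.
move=> pv; have /pexcP[v0 _ _] := pv.
move: pv; rewrite -[v in pexc v]cats0 pexc_cat// => /andP[vpos /= e0].
by rewrite -odd_end_level//; case: end_level e0.
Qed.

Lemma pexc_negb v : pexc v -> ~~ pexc (map negb v).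
Proof. by case: v => [|[]]. Qed.

(** Heights move by at most 1, so the sign cannot change without a visit to 0. *)
Lemma hgt_pos w (p q : nat) : (forall j, (p <= j <= q)%N -> hgt (take j w) != 0) ->
  0 < hgt (take p w) -> forall j, (p <= j <= q)%N -> 0 < hgt (take j w).
Proof.
move=> nz p0; elim=> [|j IHj] /andP[pj jq].
  by move: pj p0; rewrite leqn0 => /eqP ->.
have := nz j.+1; rewrite pj jq => /(_ isT) j0.
move: pj; rewrite leq_eqVlt => /predU1P[<-//|pj].
have := IHj; rewrite -ltnS pj ltnW// => /(_ isT) hj.
have := norm_hgt_step w j; move: j0 hj; lia.
Qed.

Lemma interp_gt0 w (j : nat) (t : R) : j%:R <= t <= j.+1%:R ->
  0 <= hgt (take j w) -> 0 <= hgt (take j.+1 w) ->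
  (0 < hgt (take j w) /\ t < j.+1%:R) \/ (0 < hgt (take j.+1 w) /\ j%:R < t) ->
  0 < walk w t :> R.
Proof.
move=> jt; rewrite (walk_interp _ jt).
move: jt; rewrite -(@natr1 _ j) -!(ler_int R) -!(ltr_int R) mulr0z.
set a := (hgt _)%:~R; set b := (hgt _)%:~R; move=> /andP[t1 t2] a0 b0.
have s0 : 0 <= t - j%:R by lra.
have s1 : 0 <= 1 - (t - j%:R) by lra.
have h1 := mulr_ge0 s1 a0; have h2 := mulr_ge0 s0 b0.
case=> -[c0 c1].
  have s2 : 0 < 1 - (t - j%:R) by lra.
  have := mulr_gt0 s2 c0; lra.
have s2 : 0 < t - j%:R by lra.
have := mulr_gt0 s2 c0; lra.
Qed.

Lemma walk_gt0 w (p q : nat) (t : R) : (forall j, (p <= j <= q)%N -> 0 < hgt (take j w)) ->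
  p%:R <= t <= q%:R -> 0 < walk w t :> R.
Proof.
move=> pos /andP[pt]; rewrite le_eqVlt => /predU1P[tq|tq].
  by rewrite tq walk_nat ltr0z; apply: pos; rewrite leqnn andbT -(ler_nat R) -tq.
have t0 : 0 <= t by exact: le_trans pt.
have /andP[jt tj] := truncn_itv t0; set j := Num.truncn t in jt tj.
have jq : (j < q)%N by rewrite -(ltr_nat R) (le_lt_trans jt).
have pj : (p <= j)%N by rewrite -ltnS -(ltr_nat R) (le_lt_trans pt).
have hj : 0 < hgt (take j w) by apply: pos; rewrite pj ltnW.
apply: (@interp_gt0 w j); rewrite ?jt ?(ltW tj) ?(ltW hj)//.
  by rewrite ltW// pos// jq leqW.
by left.
Qed.

Lemma walk_gt0_open w (p q : nat) (t : R) : (p.+1 < q)%N ->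
  (forall j, (p < j < q)%N -> 0 < hgt (take j w)) ->
  0 <= hgt (take p w) -> 0 <= hgt (take q w) ->
  p%:R < t < q%:R -> 0 < walk w t :> R.
Proof.
move=> pq pos p0 q0 /andP[pt tq].
have t0 : 0 <= t by exact: le_trans (ltW pt).
have /andP[jt tj] := truncn_itv t0; set j := Num.truncn t in jt tj.
have jq : (j < q)%N by rewrite -(ltr_nat R) (le_lt_trans jt).
have pj : (p <= j)%N by rewrite -ltnS -(ltr_nat R) (lt_trans pt).
have hj : 0 <= hgt (take j w).
  by move: pj; rewrite leq_eqVlt => /predU1P[<-//|pj]; rewrite ltW// pos// pj.
have hj1 : 0 <= hgt (take j.+1 w).
  by move: jq; rewrite leq_eqVlt => /predU1P[->//|jq]; rewrite ltW// pos// jq ltnS pj.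
apply: (@interp_gt0 w j) => //; first by rewrite jt ltW.
move: pj; rewrite leq_eqVlt => /predU1P[ep|pj]; last by left; rewrite pos// pj.
right; rewrite -ep; split=> //; apply: pos; rewrite -ep in jq.
by rewrite ltnSn.
Qed.

Lemma walk_pexc_ge0 v (t : R) : pexc v -> 0 <= walk v t :> R.
Proof.
move=> pv; have [t0|t0] := leP t 0; first by rewrite walk_le0.
have /andP[jt tj] := trunc_itv (ltW t0).
rewrite (walk_interp _ (j := Num.truncn t)) ?jt//.
rewrite addr_ge0// mulr_ge0 ?ler0z ?pexc_hgt_ge0 ?subr_ge0//.
by move: tj; rewrite -(@natr1 _ (Num.truncn t)); lra.
Qed.

Lemma last_zeroN f : last_zero_before1 (fun t => - f t) = last_zero_before1 f.
Proof.
rewrite /last_zero_before1; congr sup; apply/seteqP; split=> t /= [t01].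
  by move=> /eqP; rewrite oppr_eq0 => /eqP.
by move=> ->; rewrite oppr0.
Qed.

Lemma first_zeroN f : first_zero_after1 (fun t => - f t) = first_zero_after1 f.
Proof.
rewrite /first_zero_after1; congr inf; apply/seteqP; split=> t /= [t01].
  by move=> /eqP; rewrite oppr_eq0 => /eqP.
by move=> ->; rewrite oppr0.
Qed.

Lemma straddlingN f : straddling_excursion (fun t => - f t) = straddling_excursion f.
Proof.
by apply/funext => x; rewrite /straddling_excursion last_zeroN first_zeroN normrN.
Qed.

Definition straddling_length f : R := first_zero_after1 f - last_zero_before1 f.

Lemma last_zeroE f (g : R) : 0 <= g <= 1 -> f g = 0 ->
  (forall t, g < t <= 1 -> f t != 0) -> last_zero_before1 f = g.
Proof.
move=> g01 fg nz; apply/le_anti/andP; split.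
  apply: ge_sup; first by exists g.
  move=> t /= [/andP[t0 t1] ft]; rewrite leNgt; apply/negP => gt.
  by have := nz t; rewrite gt t1 ft eqxx => /(_ isT).
by apply: ub_le_sup; [exists 1 => t /= [/andP[]]|split].
Qed.

Lemma first_zeroE f (g : R) : 1 <= g -> f g = 0 ->
  (forall t, 1 <= t < g -> f t != 0) -> first_zero_after1 f = g.
Proof.
move=> g1 fg nz; apply/le_anti/andP; split.
  by apply: ge_inf; [exists 1 => t /= []|split].
apply: lb_le_inf; first by exists g.
move=> t /= [t1 ft]; rewrite leNgt; apply/negP => gt.
by have := nz t; rewrite gt t1 ft eqxx => /(_ isT).
Qed.

Variables (n : nat).
Hypothesis n0 : (0 < n)%N.

Let nR : 0 < n%:R :> R. Proof. by rewrite ltr0n. Qed.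
Let nn0 : n%:R != 0 :> R. Proof. exact: lt0r_neq0. Qed.
Let sn : 0 < Num.sqrt n%:R :> R. Proof. by rewrite sqrtr_gt0. Qed.

Lemma walk_path_eq0 w (t : R) : (walk_path n w t == 0) = (walk w (n%:R * t) == 0).
Proof. by rewrite /walk_path mulf_eq0 invr_eq0 (gt_eqF sn) orbF. Qed.

Lemma walk_pathN w : walk_path n (map negb w) = (fun t : R => - walk_path n w t).
Proof. by apply/funext => t; rewrite /walk_path walk_negb mulNr. Qed.

Definition piece (a l : nat) w := take l (drop a w).

Lemma positive_piece (a l : nat) w : (a < n < a + l)%N -> (a + l <= size w)%N ->
  hgt (take a w) = 0 -> pexc (piece a l w) ->
  [/\ last_zero_before1 (walk_path n w) = a%:R / n%:R :> R,
      first_zero_after1 (walk_path n w) = (a + l)%:R / n%:R :> R &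
      forall x : R, 0 <= x <= 1 ->
        straddling_excursion (walk_path n w) x = exc (piece a l w) x].
Proof.
move=> /andP[an nal] alw ha pv; have lw : (l <= size (drop a w))%N by rewrite size_drop leq_subRL//; lia.
have sv : size (piece a l w) = l by rewrite size_takel.
have lev := pexc_even pv; rewrite sv in lev.
have l2 : (1 < l)%N by move: lev; case: l nal {alw pv lw sv} => [|[]]//; lia.
have [_ hv vpos] := (pexcP _).1 pv; rewrite sv in vpos.
have hpiece j : (j <= l)%N -> hgt (take (a + j) w) = hgt (take j (piece a l w)).
  by move=> jl; rewrite takeD hgt_cat ha add0r /piece take_takel.
have pos j : (a < j < a + l)%N -> 0 < hgt (take j w).
  move=> /andP[aj jal]; rewrite -(subnKC (ltnW aj)) hpiece; last by lia.
  by apply: vpos; lia.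
have hal : hgt (take (a + l) w) = 0.
  by rewrite hpiece// take_oversize ?sv// -hv.
have nz (t : R) : a%:R / n%:R < t < (a + l)%:R / n%:R -> walk_path n w t != 0.
  rewrite ltr_pdivrMr// ltr_pdivlMr// walk_path_eq0 ![t * _]mulrC => tt.
  by rewrite gt_eqF// (@walk_gt0_open w a (a + l))// ?ha ?hal//; lia.
have z0 (j : nat) : hgt (take j w) = 0 -> walk_path n w (j%:R / n%:R) = 0 :> R.
  by move=> hj; apply/eqP; rewrite walk_path_eq0 mulrC divfK// walk_nat hj.
have g01 : (0 : R) <= a%:R / n%:R <= (1 : R).
  by rewrite divr_ge0//= ler_pdivrMr// mul1r ler_nat ltnW.
have d1 : (1 : R) < (a + l)%:R / n%:R by rewrite ltr_pdivlMr// mul1r ltr_nat.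
have gE : last_zero_before1 (walk_path n w) = a%:R / n%:R :> R.
  apply: last_zeroE => //; first exact: z0.
  by move=> t /andP[at_ t1]; apply: nz; rewrite at_ (le_lt_trans t1).
have dE : first_zero_after1 (walk_path n w) = (a + l)%:R / n%:R :> R.
  apply: first_zeroE => //; [exact: ltW|exact: z0|].
  move=> t /andP[t1 td]; apply: nz; rewrite td (lt_le_trans _ t1)//.
  by rewrite ltr_pdivrMr// mul1r ltr_nat.
split=> // x /andP[x0 x1]; rewrite /straddling_excursion gE dE.
have lE : (a + l)%:R / n%:R - a%:R / n%:R = l%:R / n%:R :> R by rewrite natrD; lra.
rewrite lE /walk_path /exc sv.
have -> : n%:R * (a%:R / n%:R + x * (l%:R / n%:R)) = a%:R + l%:R * x :> R.
  by field; rewrite gt_eqF.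
have -> : walk w (a%:R + l%:R * x) = walk (piece a l w) (l%:R * x) :> R.
  have sa : size (take a w) = a by rewrite size_takel// (leq_trans _ alw)// leq_addr.
  rewrite -{1}(cat_take_drop a w) walk_cat walk_ge ?sa; last first.
    by rewrite lerDl mulr_ge0.
  rewrite ha mulr0z add0r addrAC subrr add0r /piece walk_take min_l//.
  by rewrite ler_piMr.
rewrite ger0_norm; last first.
  by rewrite divr_ge0 ?(ltW sn)// walk_pexc_ge0.
rewrite sqrtrM// sqrtrV// invfM invrK -!mulrA; congr (_ * _).
by field; rewrite !lt0r_neq0// sqrtr_gt0 ltr0n ltnW.
Qed.

Definition straddles (a l : nat) w : bool :=
  [&& (a < n < a + l)%N, (a + l <= size w)%N, hgt (take a w) == 0 &
      pexc (piece a l w) || pexc (map negb (piece a l w))].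

Definition abs_piece v := if pexc v then v else map negb v.

Lemma straddlesP (a l : nat) w : straddles a l w ->
  [/\ last_zero_before1 (walk_path n w) = a%:R / n%:R :> R,
      first_zero_after1 (walk_path n w) = (a + l)%:R / n%:R :> R &
      forall x : R, 0 <= x <= 1 ->
        straddling_excursion (walk_path n w) x = exc (abs_piece (piece a l w)) x].
Proof.
case/and4P => anl alw /eqP ha; rewrite /abs_piece; case: ifP => [pv _|_ /= pv].
  exact: positive_piece.
have := @positive_piece a l (map negb w) anl.
rewrite size_map -map_take hgt_negb ha oppr0 /piece -map_drop -map_take => /(_ alw erefl pv).
by rewrite walk_pathN last_zeroN first_zeroN straddlingN.
Qed.

(** If the walk vanishes at time 1, both endpoints are 1; if it has no zero after time 1, the
    infimum of the empty set is 0. The length is nonpositive in both cases, so a weight [phi]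
    vanishing on nonpositive numbers discards them. *)
Lemma no_straddle w : (n <= size w)%N -> (forall a l, ~~ straddles a l w) ->
  straddling_length (walk_path n w) <= 0 :> R.
Proof.
move=> nw nos; rewrite /straddling_length subr_le0.
have z0 (j : nat) : hgt (take j w) = 0 -> walk_path n w (j%:R / n%:R) = 0 :> R.
  by move=> hj; apply/eqP; rewrite walk_path_eq0 mulrC divfK// walk_nat hj.
have hasub : has_ubound [set t : R | 0 <= t <= 1 /\ walk_path n w t = 0].
  by exists 1 => t /= [/andP[]].
have haslb : has_lbound [set t : R | 1 <= t /\ walk_path n w t = 0].
  by exists 1 => t /= [].
have [hn|hn] := eqVneq (hgt (take n w)) 0.
  have f1 : walk_path n w 1 = 0 :> R by rewrite -[1](@divff _ n%:R)// z0.
  apply: (@le_trans _ _ 1); first by apply: ge_inf.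
  by apply: ub_le_sup => //; split=> //; rewrite ler01 lexx.
have g0 : (0 : R) <= last_zero_before1 (walk_path n w).
  apply: ub_le_sup => //; split; first by rewrite lexx ler01.
  by rewrite /walk_path mulr0 walk_le0// mul0r.
suff -> : first_zero_after1 (walk_path n w) = (0 : R) by [].
have exa : exists a, (hgt (take a w) == 0) && (a <= n)%N by exists 0%N; rewrite take0 hgt_nil.
case: (ex_maxnP exa (m := n)) => [i /andP[]//|a /andP[/eqP ha an] amax].
have an' : (a < n)%N by rewrite ltn_neqAle an andbT; apply: contra hn => /eqP <-; exact/eqP.
have anz j : (a < j <= n)%N -> hgt (take j w) != 0.
  move=> /andP[aj jn]; apply/negP => hj; have := amax j.
  by rewrite hj jn => /(_ isT); rewrite leqNgt aj.
have [|nob] := pselect (exists b, (hgt (take b w) == 0) && (n <= b <= size w)%N).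
  move=> exb; case: (ex_minnP exb) => b /andP[/eqP hb /andP[nb bw]] bmin; exfalso.
  have nb' : (n < b)%N by rewrite ltn_neqAle nb andbT; apply: contra hn => /eqP ->; exact/eqP.
  have bnz j : (n <= j < b)%N -> hgt (take j w) != 0.
    move=> /andP[nj jb]; apply/negP => hj; have := bmin j.
    by rewrite hj nj (ltnW (leq_trans jb bw)) => /(_ isT); rewrite leqNgt jb.
  have nz j : (a < j < b)%N -> hgt (take j w) != 0.
    move=> /andP[aj jb]; have [jn|nj] := leqP j n; first by apply: anz; rewrite aj.
    by apply: bnz; rewrite (ltnW nj).
  have := nos a (b - a)%N; rewrite /straddles subnKC ?(ltnW (ltn_trans an' nb'))//.
  rewrite an' nb' bw ha eqxx /= => /negP; apply.
  have sv : size (piece a (b - a) w) = (b - a)%N by rewrite size_takel// size_drop; lia.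
  have hpiece j : (j <= b - a)%N -> hgt (take j (piece a (b - a) w)) = hgt (take (a + j) w).
    by move=> jl; rewrite takeD hgt_cat ha add0r /piece take_takel.
  have hv : hgt (piece a (b - a) w) = 0.
    by rewrite -[piece _ _ _](@take_oversize _ (b - a)) ?sv// hpiece// subnKC//; lia.
  have [ep|en] := ltrP 0 (hgt (take a.+1 w)).
    apply/orP; left; apply/pexcP; rewrite sv; split=> //; first by lia.
    move=> j /andP[j0 jl]; rewrite hpiece ?(ltnW jl)//.
    by apply: (@hgt_pos _ a.+1 b.-1) => // [i|]; [move=> ?; apply: nz|]; lia.
  have en' : hgt (take a.+1 w) < 0.
    by rewrite lt_neqAle en andbT; apply: nz; lia.
  apply/orP; right; apply/pexcP; rewrite size_map sv hgt_negb hv oppr0; split=> //; first by lia.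
  move=> j /andP[j0 jl]; rewrite -map_take hgt_negb hpiece ?(ltnW jl)//.
  have := @hgt_pos (map negb w) a.+1 b.-1; rewrite -map_take hgt_negb => pos.
  have := pos _ _ (a + j)%N; rewrite -map_take hgt_negb; apply; [|by lia|by lia].
  by move=> i ii; rewrite -map_take hgt_negb oppr_eq0; apply: nz; lia.
rewrite /first_zero_after1 (_ : [set t | _] = set0) ?inf0//.
apply/seteqP; split=> // t /= [t1 ft].
have bnz j : (n <= j <= size w)%N -> hgt (take j w) != 0.
  by move=> jj; apply/negP => hj; apply: nob; exists j; rewrite hj.
have nt : n%:R <= n%:R * t by rewrite ler_peMr.
have [tw|wt] := leP (n%:R * t) (size w)%:R; last first.
  move/eqP: ft; rewrite walk_path_eq0 walk_ge ?(ltW wt)// intr_eq0.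
  by have := bnz (size w); rewrite nw leqnn take_size => /(_ isT)/negP.
have [ep|en] := ltrP 0 (hgt (take n w)).
  move/eqP: ft; rewrite walk_path_eq0 gt_eqF// (@walk_gt0 w n (size w)) ?nt ?tw//.
  exact: hgt_pos.
move/eqP: ft; rewrite walk_path_eq0 -oppr_eq0 -walk_negb gt_eqF//.
apply: (@walk_gt0 _ n (size w)) => //; last by rewrite nt tw.
apply: hgt_pos; last by rewrite -map_take hgt_negb; move: hn en; lia.
by move=> j jj; rewrite -map_take hgt_negb oppr_eq0; exact: bnz.
Qed.

Lemma straddles_uniq (a l a' l' : nat) w : straddles a l w -> straddles a' l' w -> a = a' /\ l = l'.
Proof.
move=> /straddlesP[g1 d1 _] /straddlesP[g2 d2 _].
have aa : a = a'.
  have : a%:R / n%:R = a'%:R / n%:R :> R by rewrite -g1 -g2.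
  by move=> /(mulIf _) /eqP; rewrite invr_eq0 => /(_ nn0); rewrite eqr_nat => /eqP.
have : (a + l)%:R / n%:R = (a' + l')%:R / n%:R :> R by rewrite -d1 -d2.
by move=> /(mulIf _) /eqP; rewrite invr_eq0 => /(_ nn0); rewrite eqr_nat => /eqP; lia.
Qed.

Definition depends_on_01 h := forall e e' : R -> R,
  (forall x : R, 0 <= x <= 1 -> e x = e' x) -> h e = h e'.

(** By [straddles_uniq] at most one pair of start and length contributes; if there is none, [phi]
    kills the left-hand side. *)
Lemma straddle_sum (phi : R -> R) h w : (n <= size w)%N ->
  (forall x : R, x <= 0 -> phi x = 0) -> depends_on_01 h ->
  phi (straddling_length (walk_path n w)) * h (straddling_excursion (walk_path n w)) =
  \sum_(a < n) \sum_(l < (size w).+1) (straddles a l w)%:R *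
    (phi (l%:R / n%:R) * h (exc (abs_piece (piece a l w)))).
Proof.
move=> nw phi0 loc; have [[a [l st]]|nost] := pselect (exists a l, straddles a l w); last first.
  have nos a l : ~~ straddles a l w by apply/negP => st; apply: nost; exists a, l.
  rewrite phi0 ?no_straddle// mul0r big1// => a _; rewrite big1// => l _.
  by rewrite (negbTE (nos _ _)) mul0r.
have [gE dE eE] := straddlesP st.
have an : (a < n)%N by case/and4P: st => /andP[].
have lw : (l < (size w).+1)%N.
  by case/and4P: st => _ alw _ _; rewrite ltnS (leq_trans _ alw)// leq_addl.
rewrite (bigD1 (Ordinal an))//= [X in _ + X]big1 ?addr0; last first.
  move=> a' aa'; rewrite big1// => l' _.
  case: (boolP (straddles a' l' w)) => st'; last by rewrite mul0r.
  by have [ea _] := straddles_uniq st st'; case/eqP: aa'; apply: val_inj; rewrite /= ea.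
rewrite (bigD1 (Ordinal lw))//= [X in _ + X]big1 ?addr0; last first.
  move=> l' ll'; case: (boolP (straddles a l' w)) => st'; last by rewrite mul0r.
  by have [_ el] := straddles_uniq st st'; case/eqP: ll'; apply: val_inj; rewrite /= el.
rewrite st mul1r; congr (phi _ * _); last exact: loc.
by rewrite /straddling_length gE dE natrD; lra.
Qed.

Lemma Ew_piece (a l N : nat) F G : (a + l <= N)%N ->
  Ew N (fun w => F (take a w) * G (piece a l w)) = Ew a F * Ew l G.
Proof.
move=> /subnKC <-; rewrite -addnA Ew_cat -EwZr; apply: eq_Ew => u su.
rewrite Ew_cat -EwZ; apply: eq_Ew => v sv.
rewrite -[RHS](Ew_cst (N - (a + l))); apply: eq_Ew => z sz.
by rewrite /piece take_size_cat// drop_size_cat// take_size_cat.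
Qed.

Lemma Ew_abs_piece (l : nat) h :
  Ew l (fun v => (pexc v || pexc (map negb v))%:R * h (exc (abs_piece v))) =
  2 * Ew l (fun v => (pexc v)%:R * h (exc v)) :> R.
Proof.
rewrite mulr2n mulrDl mul1r -{2}(Ew_negb l (fun v => (pexc v)%:R * h (exc v))) -EwD.
apply: eq_Ew => v _; rewrite /abs_piece; case: (boolP (pexc v)) => pv /=; last by rewrite mul0r add0r.
by rewrite (negbTE (pexc_negb pv)) mul0r addr0.
Qed.

(** Valid also for lengths without excursions, where both sides are 0; this lets the sum over
    lengths run over all of them. *)
Lemma Ew_pexc (l : nat) h : (forall e, 0 <= h e <= 1) ->
  Ew l (fun v => (pexc v)%:R * h (exc v)) = exc_mass l * Ex l (fun v => h (exc v)) :> R.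
Proof.
move=> h01; rewrite /Ex mulrC; have [e0|nz] := eqVneq (exc_mass l : R) 0; last by rewrite divfK.
rewrite e0 mulr0; apply/le_anti/andP; split.
  rewrite -e0; apply: le_Ew => v _; rewrite ler_piMr//.
  by have /andP[] := h01 (exc v).
by apply: Ew_ge0 => v _; rewrite mulr_ge0//; have /andP[] := h01 (exc v).
Qed.

Lemma exc_mass_odd (l : nat) : odd l -> exc_mass l = 0 :> R.
Proof.
move=> lo; rewrite -[RHS](Ew_cst l); apply: eq_Ew => v sv.
by case: (boolP (pexc v)) => // /pexc_even; rewrite sv lo.
Qed.

Definition straddle_weight (phi : R -> R) (N l : nat) : R :=
  phi (l%:R / n%:R) * (2 * exc_mass l) *
  \sum_(a < n | (n < a + l <= N)%N) Ew a (fun u => (hgt u == 0)%:R).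

(** The walk returns to 0 at step [a], and the next [l] steps are independent of this and form an
    excursion of either sign, hence the factor 2. The weight of [l] does not involve [h]: given its
    length, the straddling excursion is uniform. *)
Lemma Ew_straddling (phi : R -> R) h (N : nat) : (n <= N)%N ->
  (forall x : R, x <= 0 -> phi x = 0) -> depends_on_01 h -> (forall e, 0 <= h e <= 1) ->
  Ew N (fun w => phi (straddling_length (walk_path n w)) *
                 h (straddling_excursion (walk_path n w))) =
  \sum_(l < N.+1) straddle_weight phi N l * Ex l (fun v => h (exc v)).
Proof.
move=> nN phi0 loc h01.
rewrite (eq_Ew (G := fun w => \sum_(a < n) \sum_(l < N.+1) (straddles a l w)%:R *
    (phi (l%:R / n%:R) * h (exc (abs_piece (piece a l w)))))); last first.
  by move=> w sw; rewrite straddle_sum ?sw.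
rewrite Ew_sum; under eq_bigr do rewrite Ew_sum.
rewrite exchange_big; apply: eq_bigr => l _; rewrite /straddle_weight.
set S := \sum_(a < n | (n < a + l <= N)%N) _; set E := Ex l _.
have -> : phi (l%:R / n%:R) * (2 * exc_mass l) * S * E =
  phi (l%:R / n%:R) * (2 * (exc_mass l * E)) * S by ring.
rewrite /S /E -Ew_pexc//.
rewrite [RHS]mulr_sumr [RHS]big_mkcond; apply: eq_bigr => a _.
case: ifP => [/andP[nal alN]|nal]; last first.
  rewrite -[RHS](Ew_cst N); apply: eq_Ew => w sw; rewrite /straddles sw ltn_ord.
  by rewrite andTb andbA nal andFb mul0r.
rewrite -Ew_abs_piece -mulrA [Ew l _ * _]mulrC -(Ew_piece _ _ alN) -EwZ.
apply: eq_Ew => w sw; rewrite /straddles sw alN ltn_ord nal /=.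
by rewrite -mulnb natrM; ring.
Qed.

Lemma straddle_weight_ge0 (phi : R -> R) N l : (forall x, 0 <= phi x) ->
  0 <= straddle_weight phi N l.
Proof.
move=> p0; rewrite /straddle_weight !mulr_ge0//; first by apply: Ew_ge0.
by apply: sumr_ge0 => a _; apply: Ew_ge0.
Qed.

Lemma straddle_weight_neq0 (phi : R -> R) N l : straddle_weight phi N l != 0 ->
  phi (l%:R / n%:R) != 0 /\ ~~ odd l.
Proof.
rewrite /straddle_weight !mulf_eq0 !negb_or => /andP[/andP[-> /andP[_ m0]] _]; split=> //.
by apply: contra m0 => /exc_mass_odd ->.
Qed.

End straddling.

(** * Zeros of Brownian motion *)

Section anticoncentration.
Context {R : realType}.
Implicit Types (w u v : seq bool).

(** The square of the left-hand side times 2M + 1 equals 1 at M = 0 and is nonincreasing: each step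
    multiplies it by (2M + 1)(2M + 3) / (2M + 2)^2. *)
Lemma central_bin_le M : 'C(M.*2, M)%:R / 2 ^+ M.*2 <= (Num.sqrt M.*2.+1%:R)^-1 :> R.
Proof.
have c2 : ('C(M.*2, M)%:R / 2 ^+ M.*2) ^+ 2 * M.*2.+1%:R <= 1 :> R.
  elim: M => [|M IHM]; first by rewrite double0 bin0 expr0 divr1 expr1n mul1r.
  have rec : M.+1%:R * 'C(M.+1.*2, M.+1)%:R = 2 * M.*2.+1%:R * 'C(M.*2, M)%:R :> R.
    rewrite -!natrM; congr (_%:R); rewrite doubleS -mul_bin_diag.
    have h : (M.*2.+1 * 'C(M.*2, M) = M.+1 * 'C(M.*2.+1, M))%N.
      by have := mul_bin_down M.*2.+1 M; have -> : (M.*2.+1 - M = M.+1)%N by lia.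
    change (M.*2.+2 * 'C(M.*2.+1, M) = 2 * M.*2.+1 * 'C(M.*2, M))%N.
    rewrite -mulnA h mulnA; congr (_ * _)%N; lia.
  apply: le_trans IHM; have Mp : 0 < M.+1%:R :> R by rewrite ltr0n.
  have -> : 'C(M.+1.*2, M.+1)%:R = 2 * M.*2.+1%:R * 'C(M.*2, M)%:R / M.+1%:R :> R.
    by rewrite -rec mulrAC mulfV ?mul1r// lt0r_neq0.
  rewrite doubleS (exprS _ M.*2.+1) (exprS _ M.*2).
  set c := 'C(_, _)%:R; set p := 2 ^+ M.*2; have p0 : 0 < p by rewrite exprn_gt0.
  have -> : (2 * M.*2.+1%:R * c / M.+1%:R / (2 * (2 * p))) ^+ 2 * M.*2.+3%:R =
      ((c / p) ^+ 2 * M.*2.+1%:R) * (M.*2.+1%:R * M.*2.+3%:R / (2 * M.+1%:R) ^+ 2).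
    by field; rewrite !lt0r_neq0.
  apply: ler_piMr; first by rewrite mulr_ge0// sqr_ge0.
  rewrite ler_pdivrMr ?mul1r ?exprn_gt0 ?mulr_gt0//.
  have e1 : M.*2.+1%:R = 2 * M%:R + 1 :> R by rewrite -addn1 -mul2n natrD natrM.
  have e3 : M.*2.+3%:R = 2 * M%:R + 3 :> R by rewrite -addn3 -mul2n natrD natrM.
  by rewrite e1 e3 -(@natr1 _ M); nra.
have s0 : 0 < Num.sqrt M.*2.+1%:R :> R by rewrite sqrtr_gt0 ltr0n.
rewrite -[leRHS]mul1r ler_pdivlMr// -[leRHS]sqrtr1 -[leLHS]ger0_norm; last first.
  by rewrite mulr_ge0// ltW.
by rewrite -sqrtr_sqr ler_sqrt// exprMn sqr_sqrtr.
Qed.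

Lemma bin_le_central M k : ('C(M.*2, k) <= 'C(M.*2, M))%N.
Proof.
have up j : (j <= M)%N -> ('C(M.*2, M + j) <= 'C(M.*2, M))%N.
  move=> jM; rewrite -(ler_nat R); have := @binR_ub R M j jM; rewrite /binR addn0.
  move/le_trans; apply; apply: ler_piMr; first exact: ler0n.
  by rewrite expR_le1 oppr_le0 divr_ge0// sqr_ge0.
have [kM|Mk] := leqP k M.
  rewrite -bin_sub; last by lia.
  have -> : (M.*2 - k = M + (M - k))%N by lia.
  by apply: up; lia.
have [k2|k2] := leqP k M.*2; last by rewrite bin_small.
have -> : (k = M + (k - M))%N by lia.
by apply: up; lia.
Qed.

Lemma count_itv (r : nat) (x y : R) : x <= y ->
  \sum_(k < r) (x < k%:R < y)%R%:R <= y - x + 1 :> R.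
Proof.
(* Clamping to [x, y + 1]: each integer strictly between [x] and [y] contributes exactly 1 to the
   telescoping sum, the others at least 0. *)
move=> xy; pose G (t : R) := Num.max x (Num.min t (y + 1)).
have Gx t : x <= G t <= y + 1.
  by rewrite /G le_max lexx/= ge_max ge_min lexx orbT andbT; lra.
apply: (@le_trans _ _ (\sum_(0 <= k < r) (G k.+1%:R - G k%:R))).
  rewrite big_mkord; apply: ler_sum => k _.
  case: (boolP (_ < _ < _)) => [/andP[xk ky]|_].
    rewrite /G -(@natr1 _ k) min_l ?min_l; [|lra|lra].
    by rewrite !max_r /=; lra.
  rewrite mulr0n subr_ge0 /G -(@natr1 _ k) ge_max !le_max lexx /= le_min !ge_min.
  by rewrite lerDl ler01 lexx !orbT.
rewrite telescope_sumr//; have := Gx r%:R; have := Gx 0; lra.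
Qed.

(** Heights of a walk of even length are spaced by 2, so an interval contains at most (y - x) / 2 +
    1 of them, each with at most the central weight. *)
Lemma anticoncentration M (x y : R) : (0 < M)%N -> x <= y ->
  Ew M.*2 (fun w => (x < (hgt w)%:~R < y)%R%:R) <= ((y - x) / 2 + 1) / Num.sqrt M.*2%:R.
Proof.
move=> M0 xy; pose a := (x + M.*2%:R) / 2; pose b := (y + M.*2%:R) / 2.
have -> : Ew M.*2 (fun w => (x < (hgt w)%:~R < y)%R%:R) =
    Ew M.*2 (fun w => (a < (count id w)%:R < b)%R%:R) :> R.
  apply: eq_Ew => w wM; rewrite count_hgt wM intrB /= -!pmulrn /a /b -!muln2 !natrM.
  by rewrite !ltr_pdivrMr// !ltr_pdivlMr// ltrBrDr ltrBlDr.
rewrite (Ew_count _ (fun k => (a < k%:R < b)%R%:R)) mulr_sumr.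
apply: (@le_trans _ _ (\sum_(k < M.*2.+1) (Num.sqrt M.*2.+1%:R)^-1 * (a < k%:R < b)%R%:R)).
  apply: ler_sum => k _; rewrite mulrA; apply: ler_wpM2r => //.
  apply: le_trans (central_bin_le M); rewrite mulrC ler_pM2r ?invr_gt0 ?exprn_gt0//.
  by rewrite ler_nat bin_le_central.
rewrite -mulr_sumr mulrC; apply: ler_pM.
- by apply: sumr_ge0.
- by rewrite invr_ge0 sqrtr_ge0.
- apply: le_trans (count_itv _ _) _; first by rewrite /a /b; lra.
  by rewrite /a /b; lra.
- by rewrite lef_pV2 ?posrE ?sqrtr_gt0 ?ltr0n ?double_gt0// ler_sqrt// ler_nat.
Qed.

End anticoncentration.

Lemma Ew_swap {R : realType} m n (F : seq bool -> seq bool -> R) :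
  Ew m (fun u => Ew n (F u)) = Ew n (fun v => Ew m (F^~ v)).
Proof.
elim: m F => [|m IHm] F //=.
by rewrite !IHm -EwD -EwZr.
Qed.

(** * Scaling and symmetry of the normal distribution *)

Section gaussian_cdf.
Context {R : realType}.

(** Both sides are limits, by de Moivre-Laplace, of the probability of the same event for the
    walk. *)
Lemma Phi_scale (c sigma a : R) : 0 < c -> 0 < sigma -> Phi (c * sigma) (c * a) = Phi sigma a.
Proof.
move=> c0 s0; have cs0 : 0 < c * sigma by rewrite mulr_gt0.
apply/eqP; rewrite -subr_eq0 -normr_le0; apply/ler_addgt0Pr => e e0; rewrite add0r.
have e2 : 0 < e / 2 by rewrite divr_gt0.
have [M1 h1] := de_moivre_laplace a s0 e2; have [M2 h2] := de_moivre_laplace (c * a) cs0 e2.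
have := h1 (M1 + M2)%N (leq_addr _ _); have := h2 (M1 + M2)%N (leq_addl _ _).
rewrite (@eq_Ew _ _ _ (fun w => (sigma * (hgt w)%:~R / Num.sqrt (M1 + M2).*2%:R < a)%R%:R)); last first.
  by move=> w _; rewrite -!mulrA ltr_pM2l.
move: (Ew _ _) (Phi _ _) (Phi _ _) => E x y; rewrite !ler_norml; lra.
Qed.

Lemma normal_peakZ (c : R) : 0 < c -> normal_peak c = normal_peak 1 / c.
Proof.
move=> c0; rewrite /normal_peak expr1n mul1r -mulrnAr sqrtrM ?sqr_ge0// sqrtr_sqr.
by rewrite gtr0_norm// invfM mulrC.
Qed.

(** The symmetry of the walk under [negb] passes to the limit; [Phi_half_ge] uses it in the same
    way. *)
Lemma Phi_half_le (sigma : R) : 0 < sigma -> Phi sigma 0 <= 2^-1.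
Proof.
move=> s0; apply/ler_addgt0Pr => e e0.
have [M h] := de_moivre_laplace 0 s0 e0; have := h M (leqnn _).
set E := Ew _ _ => h1; suff h2 : E <= 2^-1 by move: h1; rewrite ler_norml; lra.
suff h3 : E + E <= 1 by lra.
rewrite {2}/E -Ew_negb /E -EwD; apply: Ew_le_cst => w _; rewrite hgt_negb intrN mulrN mulNr.
by rewrite oppr_lt0; case: ltgtP => _ /=; lra.
Qed.

Lemma Phi_half_ge (sigma e : R) : 0 < sigma -> 0 < e -> 2^-1 <= Phi sigma e.
Proof.
move=> s0 e0; apply/ler_addgt0Pr => k k0.
have [M h] := de_moivre_laplace e s0 k0; have := h M (leqnn _).
set E := Ew _ _ => h1; suff h2 : 2^-1 <= E by move: h1; rewrite ler_norml; lra.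
suff h3 : 1 <= E + E by lra.
rewrite {2}/E -Ew_negb /E -EwD -[leLHS](Ew_cst M.*2); apply: le_Ew => w _.
rewrite hgt_negb intrN mulrN mulNr; set z := _ / _.
have [ze|ze] := ltP z e; have [nze|nze] := ltP (- z) e; rewrite /=; lra.
Qed.

Lemma Phi_opp_ge (sigma c : R) : 0 < sigma -> 0 < c ->
  2^-1 - normal_peak sigma * c <= Phi sigma (- c).
Proof.
move=> s0 c0; apply/ler_addgt0Pr => e e0.
have p0 := normal_peak_ge0 sigma.
pose x := e / (normal_peak sigma + 1).
have x0 : 0 < x by rewrite divr_gt0// ltr_wpDl.
have px : normal_peak sigma * x <= e.
  rewrite /x mulrA ler_pdivrMr ?ltr_wpDl//; nra.
have := Phi_half_ge s0 x0.
have : Phi sigma x - Phi sigma (- c) <= normal_peak sigma * (x - - c) by apply: Phi_lip => //; lra.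
by rewrite opprK mulrDr; lra.
Qed.

Lemma Phi_le (sigma c : R) : 0 < sigma -> 0 < c ->
  Phi sigma c <= 2^-1 + normal_peak sigma * c.
Proof.
move=> s0 c0; have := Phi_half_le s0.
have := Phi_lip s0 (ltW c0); rewrite subr0; lra.
Qed.

End gaussian_cdf.

(** * Brownian motion does not touch 0 without crossing, nor keep its sign *)

Section no_touching.
Context {d : measure_display} {T : measurableType d} {R : realType}.
Variable P : probability T R.
Variables (B : R -> {RV P >-> R}).
Hypothesis BM : standard_brownian_motion B.
Implicit Types (f : R -> R).

(** The floor at -1 keeps the infimum finite for every function; minima close to 0 are
    unaffected. *)
Definition floor_min (q q' : R) f : R := inf [set Num.max (f t) (-1) | t in `[q, q']].

(** A Lipschitz majorant of the event that the minimum on [q, q'] is within [eta] of 0; it vanishes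
    once the minimum is [2 * eta] away from 0. *)
Definition touch (q q' eta : R) f : R := clip (2 - `|floor_min q q' f| / eta).

Lemma floor_min_le (q q' : R) f (t : R) : q <= t <= q' -> floor_min q q' f <= Num.max (f t) (-1).
Proof.
move=> tq; apply: ge_inf; first by exists (-1) => _ [s _ <-]; rewrite le_max lexx orbT.
by exists t.
Qed.

Lemma floor_min_ge (q q' c : R) f : q <= q' ->
  (forall t, q <= t <= q' -> c <= Num.max (f t) (-1)) -> c <= floor_min q q' f.
Proof.
move=> qq h; apply: lb_le_inf; first by exists (Num.max (f q) (-1)); exists q => //=; rewrite in_itv/= lexx.
by move=> _ [t /= tq <-]; apply: h; rewrite in_itv/= in tq.
Qed.

Lemma lip_touch (q q' eta K : R) : 0 <= q -> q <= q' -> q' <= K -> 0 < eta ->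
  lip K eta^-1 (touch q q' eta).
Proof.
move=> q0 qq qK eta0 e e' s ee'; rewrite /touch.
apply: le_trans (clip_lip _ _) _.
have half (f f' : R -> R) : (forall t : R, 0 <= t <= K -> `|f t - f' t| <= s) ->
    floor_min q q' f - s <= floor_min q q' f'.
  move=> ff; apply: floor_min_ge => // t tq; have := floor_min_le f tq.
  have := ff t; have -> : 0 <= t <= K by move: tq => /andP[? ?]; apply/andP; split; lra.
  move=> /(_ isT); rewrite ler_norml => /andP[h1 h2].
  by rewrite !le_max => /orP[h3|h3]; apply/orP; [left|right]; lra.
have h1 := half _ _ ee'.
have h2 : floor_min q q' e' - s <= floor_min q q' e by apply: half => t tK; rewrite distrC ee'.
have -> : 2 - `|floor_min q q' e| / eta - (2 - `|floor_min q q' e'| / eta) =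
    (`|floor_min q q' e'| - `|floor_min q q' e|) / eta by lra.
rewrite normrM [`|_^-1|]gtr0_norm ?invr_gt0// mulrC ler_pM2l ?invr_gt0//.
by apply: le_trans (ler_dist_dist _ _) _; rewrite ler_norml; lra.
Qed.

(** Shifting a path shifts its minimum, and both minima are within [2 * eta] of 0. The bound on
    [eta] keeps them above the floor at -1. *)
Lemma touch_gt0 (q q' eta c c' : R) f : 0 < eta <= 2^-1 -> q <= q' ->
  touch q q' eta (fun t => c + f t) != 0 -> touch q q' eta (fun t => c' + f t) != 0 ->
  c' < c + 4 * eta.
Proof.
move=> /andP[eta0 eta1] qq.
have near g : touch q q' eta g != 0 -> `|floor_min q q' g| < 2 * eta.
  move=> tg; rewrite ltNge; apply: contra tg => h; apply/eqP/clip_le0.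
  by rewrite subr_le0 ler_pdivlMr.
move=> /near h1 /near h2; rewrite ltNge; apply/negP => cc.
suff : 2 * eta <= floor_min q q' (fun t => c' + f t).
  by move: h2; rewrite ltr_norml => /andP[_ ?]; rewrite leNgt => /negP; apply.
apply: floor_min_ge => // t tq; have := floor_min_le (fun t => c + f t) tq.
move: h1; rewrite ltr_norml => /andP[h1 _].
by rewrite !le_max /Num.max; case: ltP => h3 h4; [exfalso; lra|apply/orP; left; lra].
Qed.

(** Given the steps after time a / b, the minimum is the height at that time plus a fixed number, so
    it can be close to 0 only for heights in a short interval, and anticoncentration applies. As [b]
    divides [k], the time a / b falls on an even step. *)
Lemma Ew_touch (a b k M : nat) (q' eta : R) (K : nat) : (0 < a)%N -> (0 < b)%N -> (0 < k)%N -> (0 < M)%N ->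
  (b %| k)%N -> a%:R / b%:R <= q' -> q' <= K%:R -> 0 < eta <= 2^-1 ->
  Ew (K * k * M.*2) (fun w => touch (a%:R / b%:R) q' eta (walk_path (k * M.*2) w)) <=
  (4 * eta + (Num.sqrt (k * M.*2)%:R)^-1) / Num.sqrt (a%:R / b%:R).
Proof.
move=> a0 b0 k0 M0 bk qq qK eta01; have /andP[eta0 eta1] := eta01.
have bR : 0 < b%:R :> R by rewrite ltr0n.
have aR : 0 < a%:R :> R by rewrite ltr0n.
set n := (k * M.*2)%N; pose s := (a * (k %/ b) * M)%N.
have n0 : (0 < n)%N by rewrite /n muln_gt0 k0 double_gt0.
have nR : 0 < n%:R :> R by rewrite ltr0n.
have kb0 : (0 < k %/ b)%N by rewrite divn_gt0// dvdn_leq.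
have s0 : (0 < s)%N by rewrite /s !muln_gt0 a0 kb0.
have sE : s.*2%:R = n%:R * (a%:R / b%:R) :> R.
  have kE : k%:R = (k %/ b)%:R * b%:R :> R by rewrite -natrM divnK.
  rewrite /n /s -!muln2 !natrM kE; field; exact: lt0r_neq0.
have qR : 0 < a%:R / b%:R :> R by rewrite divr_gt0.
have aKb : (a <= K * b)%N.
  by rewrite -(ler_nat R) natrM -ler_pdivrMr// (le_trans qq).
have sN : (s.*2 <= K * k * M.*2)%N.
  have -> : (K * k * M.*2 = (K * b * (k %/ b) * M).*2)%N.
    by rewrite -doubleMr -[(_ * b * _)%N]mulnA [(b * _)%N]mulnC divnK.
  by rewrite leq_double /s !leq_mul.
have sn0 : 0 < Num.sqrt n%:R :> R by rewrite sqrtr_gt0.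
rewrite -(subnKC sN) Ew_cat Ew_swap.
apply: Ew_le_cst => v _.
pose f (t : R) := walk v (n%:R * t - s.*2%:R) / Num.sqrt n%:R.
have split u (us : size u = s.*2) : touch (a%:R / b%:R) q' eta (walk_path n (u ++ v)) =
    touch (a%:R / b%:R) q' eta (fun t => (hgt u)%:~R / Num.sqrt n%:R + f t).
  congr (clip (2 - `|inf _| / _)); apply: eq_imagel => t /=; rewrite in_itv/= => /andP[qt _].
  congr Num.max; rewrite /walk_path walk_cat walk_ge ?us ?mulrDl//.
  by rewrite sE ler_pM2l.
have [[u0 us0 t0]|none] := pselect (exists2 u0, size u0 = s.*2 &
    touch (a%:R / b%:R) q' eta (fun t => (hgt u0)%:~R / Num.sqrt n%:R + f t) != 0); last first.
  rewrite (eq_Ew (G := fun=> 0)) ?Ew_cst; last first.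
    move=> u us; rewrite split//; apply: contrapT => /eqP h; apply: none.
    by exists u.
  by rewrite divr_ge0 ?sqrtr_ge0// addr_ge0 ?invr_ge0 ?sqrtr_ge0// mulr_ge0 ?ltW.
set z := (hgt u0)%:~R in t0.
pose del := 4 * eta * Num.sqrt n%:R.
have del0 : 0 < del by rewrite !mulr_gt0.
apply: (@le_trans _ _ (Ew s.*2 (fun u => (z - del < (hgt u)%:~R < z + del)%R%:R))).
  apply: le_Ew => u us; rewrite split//.
  have [->//|tu] := eqVneq (touch (a%:R / b%:R) q' eta (fun t => (hgt u)%:~R / Num.sqrt n%:R + f t)) 0.
  rewrite (_ : _ && _ = true) ?clip_le1//.
  have := touch_gt0 eta01 qq t0 tu; have := touch_gt0 eta01 qq tu t0.
  rewrite -(ltr_pM2r sn0) mulrDl !divfK ?lt0r_neq0// -/del => h1.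
  rewrite -(ltr_pM2r sn0) mulrDl !divfK ?lt0r_neq0// -/del => h2.
  by apply/andP; split; lra.
apply: le_trans (anticoncentration s0 _) _; first by lra.
rewrite sE sqrtrM// invfM mulrA; apply: ler_wpM2r; first by rewrite invr_ge0 sqrtr_ge0.
have -> : z + del - (z - del) = del * 2 by lra.
rewrite mulfK// mulrDl mul1r lerD2r /del mulfK//; exact: lt0r_neq0.
Qed.

Lemma negligible_small (A : set T) : (forall e : R, 0 < e ->
  exists2 E, measurable E & A `<=` E /\ (P E <= e%:E)%E) -> P.-negligible A.
Proof.
move=> small; have h (n : nat) : exists E, measurable E /\ (A `<=` E /\ (P E <= (n.+1%:R^-1 : R)%:E)%E).
  have [|E mE AE] := small n.+1%:R^-1; first by rewrite invr_gt0 ltr0n.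
  by exists E.
have {h}[E EP] := choice h.
exists (\bigcap_n E n); split.
- by apply: bigcap_measurable => // n _; case: (EP n).
- apply/eqP; rewrite eq_le measure_ge0 andbT; apply/lee_addgt0Pr => e e0; rewrite add0e.
  pose n := Num.truncn e^-1; have [mE [_ PE]] := EP n.
  apply: (@le_trans _ _ (P (E n))).
    by apply: le_measure; rewrite ?inE//; [apply: bigcap_measurable => // i _; case: (EP i)|exact: bigcap_inf].
  apply: (le_trans PE); rewrite lee_fin -[leRHS]invrK lef_pV2 ?posrE ?invr_gt0//.
  exact/ltW/truncnS_gt.
- by move=> w Aw n _; case: (EP n) => _ [AE _]; exact: AE.
Qed.

Lemma markov_event (f : T -> R) (c : R) : measurable_fun setT f -> (forall w, 0 <= f w <= 1) ->
  EP P f <= c -> let A := [set w | 1 <= f w] in measurable A /\ (P A <= c%:E)%E.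
Proof.
move=> mf f01 fc A; have mA : measurable A.
  rewrite (_ : A = f @^-1` `[1, +oo[); last first.
    by apply/seteqP; split=> w /=; rewrite in_itv/= andbT.
  by rewrite -[X in measurable X]setTI; exact: mf.
split=> //; rewrite -(@fineK _ (P _)) ?fin_num_measure// lee_fin.
rewrite -EP_indic//; apply: le_trans fc; apply: le_EP; [|exact: bmf01|].
  by apply: bmf01 => // w; rewrite indicE; case: (_ \in _); rewrite ?lexx ?ler01.
move=> w; have /andP[f0 f1] := f01 w; rewrite indicE; case: (boolP (_ \in _)) => //.
by rewrite inE.
Qed.

Lemma touch01 (q q' eta : R) f : 0 <= touch q q' eta f <= 1.
Proof. by rewrite /touch clip_ge0 clip_le1. Qed.

Lemma touch_sign (s : bool) (q q' eta : R) (n : nat) N : 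
  Ew N (fun w => touch q q' eta (fun t => (-1) ^+ s * walk_path n w t)) =
  Ew N (fun w => touch q q' eta (walk_path n w)).
Proof.
case: s; last by apply: eq_Ew => w _; congr touch; apply/funext => t; rewrite mul1r.
rewrite -[RHS]Ew_negb; apply: eq_Ew => w _; congr touch; apply/funext => t.
by rewrite walk_pathN expr1 mulN1r.
Qed.

Lemma EP_touch (s : bool) (a b : nat) (q' : R) : (0 < a)%N -> (0 < b)%N -> a%:R / b%:R <= q' ->
  exists C : R, forall eta, 0 < eta <= 2^-1 ->
  EP P (fun w => touch (a%:R / b%:R) q' eta (fun t => (-1) ^+ s * B t w)) <= C * eta.
Proof.
(* The 6 is 4 from [Ew_touch], 1 from its term in the number of steps, taken large enough, and 1
   from the error in Donsker's theorem. *)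
move=> a0 b0 qq; exists (6 / Num.sqrt (a%:R / b%:R)) => eta eta01; have /andP[eta0 eta1] := eta01.
have q0 : 0 < a%:R / b%:R :> R by rewrite divr_gt0 ?ltr0n.
have sq0 : 0 < Num.sqrt (a%:R / b%:R) :> R by rewrite sqrtr_gt0.
pose K := (Num.truncn q').+1; have qK : q' <= K%:R by exact/ltW/truncnS_gt.
pose L f := touch (a%:R / b%:R) q' eta (fun t => (-1) ^+ s * f t).
have lipL : lip K%:R eta^-1 L.
  move=> e e' r ee'; apply: (lip_touch (ltW q0) qq qK eta0) => x xK.
  by rewrite -mulrBr normrM normrX normrN1 expr1n mul1r ee'.
have eta'0 : 0 <= eta^-1 by rewrite invr_ge0 ltW.
have eps0 : 0 < eta / Num.sqrt (a%:R / b%:R) by rewrite divr_gt0.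
have [k1 _ hk] := donsker_lip BM (ltn0Sn (Num.truncn q')) eta'0 (fun e => touch01 _ _ _ _) lipL eps0.
pose k := (b * k1.+1)%N; have kk1 : (k1 <= k)%N by rewrite /k; nia.
have k0 : (0 < k)%N by rewrite muln_gt0 b0.
have [M1 _ hM] := hk k kk1.
have [M2 hM2] := sqrt_ge_near (eta^-1).
pose M := (M1 + M2).+1.
have := hM M; rewrite /= => /(_ _); rewrite ler_norml => /(_ _)/andP[|h1 _]; first by rewrite /M; lia.
have h2 := @Ew_touch a b k M q' eta K a0 b0 k0 (ltn0Sn _) (dvdn_mulr _ (dvdnn b)) qq qK eta01.
rewrite -(touch_sign s) in h2.
have kM0 : (0 < k * M.*2)%N by rewrite muln_gt0 k0.
have h3 : (Num.sqrt (k * M.*2)%:R)^-1 <= eta.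
  rewrite -[leRHS]invrK lef_pV2 ?posrE ?invr_gt0 ?sqrtr_gt0 ?ltr0n//.
  apply: hM2; apply: leq_trans (leq_pmull _ k0); apply: leq_trans (leq_addl M1 M2) _.
  by rewrite /M -addnn; exact: leq_trans (leqnSn _) (leq_addr _ _).
have h4 : (4 * eta + (Num.sqrt (k * M.*2)%:R)^-1) / Num.sqrt (a%:R / b%:R) <=
    5 * eta / Num.sqrt (a%:R / b%:R).
  by rewrite ler_pM2r ?invr_gt0//; lra.
rewrite /L in h1; set v := Num.sqrt (a%:R / b%:R) in h1 h2 h4 *.
have -> : 6 / v * eta = 5 * eta / v + eta / v by lra.
by lra.
Qed.

Definition touches (s : bool) (q q' : R) f := (forall t, q <= t <= q' -> 0 <= (-1) ^+ s * f t) /\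
  exists2 t, q <= t <= q' & f t = 0.

(** Touching makes the minimum exactly 0, hence [touch] equal to 1 for every [eta]; Markov's
    inequality and [EP_touch] bound the probability by a multiple of [eta]. *)
Lemma no_touching (s : bool) (a b : nat) (q' : R) : (0 < a)%N -> (0 < b)%N -> a%:R / b%:R <= q' ->
  {ae P, forall w, ~ touches s (a%:R / b%:R) q' (fun t => B t w)}.
Proof.
move=> a0 b0 qq; have [C hC] := EP_touch s a0 b0 qq.
have q0 : 0 <= a%:R / b%:R :> R by rewrite divr_ge0.
suff h : P.-negligible [set w | touches s (a%:R / b%:R) q' (fun t => B t w)].
  by apply: negligibleS h => w /= /contrapT.
apply: negligible_small => e e0.
have C1 : 0 < `|C| + 1 by rewrite ltr_wpDl.
pose eta := Num.min 2^-1 (e / (`|C| + 1)).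
have eta01 : 0 < eta <= 2^-1 by rewrite ge_min lexx lt_min invr_gt0 ltr0n divr_gt0.
have /andP[eta0 eta1] := eta01.
have Ce : C * eta <= e.
  have h1 : eta <= e / (`|C| + 1) by rewrite ge_min lexx orbT.
  have h2 : eta * (`|C| + 1) <= e by rewrite -ler_pdivlMr.
  have : eta * C <= eta * `|C| by rewrite ler_pM2l// ler_norm.
  by lra.
pose K := (Num.truncn q').+1; have qK : q' <= K%:R by exact/ltW/truncnS_gt.
pose L f := touch (a%:R / b%:R) q' eta (fun t => (-1) ^+ s * f t).
have lipL : lip K%:R eta^-1 L.
  move=> f f' r ee'; apply: (lip_touch q0 qq qK eta0) => x xK.
  by rewrite -mulrBr normrM normrX normrN1 expr1n mul1r ee'.
have mL : measurable_fun setT (fun w => L (fun t => B t w)).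
  apply: (@measurable_lip _ _ _ (fun t w => B t w) K L eta^-1) => //.
  - by rewrite invr_ge0 ltW.
  - by move=> w; exact: bm0 BM w.
  - by move=> w; exact: bm_continuous BM _ _.
have [mE PE] := markov_event mL (fun w => touch01 _ _ _ _) (le_trans (hC _ eta01) Ce).
exists [set w | 1 <= L (fun t => B t w)] => //; split=> // w /= [pos [t tq ft]].
rewrite /L /touch.
have -> : floor_min (a%:R / b%:R) q' (fun t => (-1) ^+ s * B t w) = 0.
  apply/le_anti/andP; split.
    have := floor_min_le (fun t => (-1) ^+ s * B t w) tq; rewrite ft mulr0 max_l//; lra.
  by apply: floor_min_ge => // r rq; rewrite le_max pos.
by rewrite normr0 mul0r subr0 clip_ge1//; lra.
Qed.

Lemma bmf_sum (I : Type) (l : seq I) (F : I -> T -> R) : (forall i, bmf (F i)) ->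
  bmf (fun w => \sum_(i <- l) F i w).
Proof.
move=> bF; elim: l => [|i l IHl].
  by under eq_fun do rewrite big_nil; exact: bmf_cst.
by under eq_fun do rewrite big_cons; exact: bmfD.
Qed.

Definition signed_side (s : bool) (c : R) : set R := [set x | - c < (-1) ^+ s * x].

Lemma measurable_signed_side s (c : R) : measurable (signed_side s c).
Proof.
case: s; rewrite /signed_side.
  rewrite (_ : [set x | _] = `]-oo, c[%classic) //.
  by apply/seteqP; split=> x /=; rewrite in_itv/= mulN1r ltrN2.
rewrite (_ : [set x | _] = `]-c, +oo[%classic) //.
by apply/seteqP; split=> x /=; rewrite in_itv/= andbT mul1r.
Qed.

Lemma normal_prob_compl (sigma c : R) :
  normal_prob 0 sigma (~` `]-oo, c[) = (1 - Phi sigma c)%:E.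
Proof. by rewrite probability_setC// EFinB /Phi fineK// normal_prob_fin. Qed.

Lemma signed_side_mass s (sigma c : R) : 0 < sigma -> 0 < c ->
  (normal_prob 0 sigma (signed_side s c) <= (2^-1 + normal_peak sigma * c)%:E)%E.
Proof.
move=> s0 c0; case: s.
  have -> : signed_side true c = `]-oo, c[%classic.
    by apply/seteqP; split=> x; rewrite /signed_side /= in_itv/= mulN1r ltrN2.
  have <- : (Phi sigma c)%:E = normal_prob 0 sigma `]-oo, c[ by rewrite /Phi fineK// normal_prob_fin.
  by rewrite lee_fin Phi_le.
apply: (@le_trans _ _ (normal_prob 0 sigma (~` `]-oo, (- c)[))).
  apply: le_measure; rewrite ?inE; [exact: measurable_signed_side|exact: measurableC|].
  by move=> x; rewrite /signed_side /= in_itv/= mul1r => cx; apply/negP; rewrite -leNgt ltW.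
rewrite normal_prob_compl lee_fin; have := Phi_opp_ge s0 c0; lra.
Qed.

Lemma measurable_bm t (A : set R) : measurable A -> measurable ((B t : T -> R) @^-1` A).
Proof. by move=> mA; rewrite -[X in measurable X]setTI; exact: measurable_funP. Qed.

Lemma bm_tail (t A : R) : 0 < t -> 0 < A ->
  P ((B t : T -> R) @^-1` (~` `[- (A * Num.sqrt t), A * Num.sqrt t[%classic)) =
    (1 - (Phi 1 A - Phi 1 (- A)))%:E.
Proof.
move=> t0 A0; have st : 0 < Num.sqrt t by rewrite sqrtr_gt0.
have -> : (B t : T -> R) = (fun w => B t w - B 0 w).
  by apply/funext => w; rewrite (bm0 BM) subr0.
rewrite bm_increment ?subr0//; last exact: measurableC.
have As : - (A * Num.sqrt t) <= A * Num.sqrt t by have := mulr_gt0 A0 st; lra.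
apply: (etrans (probability_setC _ _)) => //; rewrite [RHS]EFinB; congr (1 - _)%E.
apply: (etrans (Phi_diff _ As)).
have := Phi_scale A st (ltr01); have := Phi_scale (- A) st ltr01.
by rewrite mulr1 mulrN [Num.sqrt t * A]mulrC => -> ->.
Qed.

(** Along geometric times, unless the path is unusually far out, keeping its sign forces each
    increment to avoid a half-line of probability at least 1/4, and increments are independent. By
    scaling, [r] and [I] can be chosen before [t0], so the lemma serves both near 0 and near
    infinity. *)
Lemma no_return (s : bool) (kap : R) : 0 < kap -> exists r : R, exists I : nat, 1 < r /\
  forall t0, 0 < t0 -> exists2 E, measurable E &
  [set w | forall i, (i <= I)%N -> 0 < (-1) ^+ s * B (t0 * r ^+ i) w] `<=` E /\ (P E <= kap%:E)%E.
Proof.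
move=> kap0; have kap2 : 0 < kap / 2 by rewrite divr_gt0.
have [I hI] : exists I : nat, (3 / 4 : R) ^+ I <= kap / 2.
  have := @cvg_expr R (3 / 4); rewrite ger0_norm; last by lra.
  have -> : 3 / 4 < 1 :> R by lra.
  move=> /(_ isT)/cvgrPdist_le/(_ _ kap2)[I _ /(_ I (leqnn I))/=].
  by rewrite sub0r normrN ger0_norm ?exprn_ge0// => h; exists I.
have I1 : 0 < I.+1%:R :> R by rewrite ltr0n.
have kI : 0 < kap / 4 / I.+1%:R by rewrite !divr_gt0.
have [A0 hA] := Phi_tails 1 kI.
pose A := Num.max A0 1; have A1 : 0 < A by rewrite lt_max ltr01 orbT.
have [hA1 hA2] : Phi 1 (- A) <= kap / 4 / I.+1%:R /\ 1 - kap / 4 / I.+1%:R <= Phi 1 A.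
  by apply: hA; rewrite le_max lexx.
pose pk : R := normal_peak 1; have pk0 : 0 <= pk by exact: normal_peak_ge0.
(* This gives [pk * A / v <= 4^-1]: an increment of standard deviation [v * Num.sqrt t] exceeds
   [- A * Num.sqrt t] with probability at most 1/2 + 1/4, whence the 3/4. The ratio 1 + v^2 produces
   that standard deviation. *)
pose v : R := 4 * A * pk + 1; have v0 : 0 < v by rewrite ltr_wpDl// !mulr_ge0// ltW.
exists (1 + v ^+ 2), I; split; first by rewrite ltrDl exprn_gt0.
set r := 1 + v ^+ 2; have r1 : 1 < r by rewrite ltrDl exprn_gt0.
have r0 : 0 < r by lra.
move=> t0 t00; pose t i : R := t0 * r ^+ i.
have tpos i : 0 < t i by rewrite mulr_gt0// exprn_gt0.
have stpos i : 0 < Num.sqrt (t i) by rewrite sqrtr_gt0.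
have tS i : t i.+1 - t i = t i * v ^+ 2 by rewrite /t exprS /r; ring.
have tlt i : t i < t i.+1 by rewrite -subr_gt0 tS mulr_gt0// exprn_gt0.
pose X i w := B (t i.+1) w - B (t i) w.
have mX i : measurable_fun setT (X i) by apply: measurable_funB.
pose S i := signed_side s (A * Num.sqrt (t i)).
have mXS i : measurable (X i @^-1` S i).
  by rewrite -[Y in measurable Y]setTI; apply: mX => //; exact: measurable_signed_side.
pose F i := (B (t i) : T -> R) @^-1` ~` `[- (A * Num.sqrt (t i)), A * Num.sqrt (t i)[.
have mF i : measurable (F i) by apply: measurable_bm; exact: measurableC.
pose G := \bigcap_(i in [set: 'I_I]) (X i @^-1` S i).
have mG : measurable G by apply: fin_bigcap_measurable => // i _; exact: mXS.
pose E := [set w | forall i, (i <= I)%N -> 0 < (-1) ^+ s * B (t i) w].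
(* Either some position is outside [A] standard deviations, or every increment lies on the required
   side. *)
have EFG w : E w -> (exists2 i, (i < I)%N & F i w) \/ G w.
  move=> Ew_; have [|nF] := pselect (exists2 i, (i < I)%N & F i w); first by left.
  right=> i _; rewrite /S /signed_side /X /=.
  have : ~ F i w by move=> Fi; apply: nF; exists i.
  rewrite /F /= => /contrapT; rewrite in_itv/= => /andP[b1 b2].
  have := Ew_ i.+1 (ltn_ord i); rewrite mulrBr; case: (s); rewrite ?mulN1r ?mul1r; lra.
have PG : (P G <= ((3 / 4) ^+ I)%:E)%E.
  have -> : P G = (\prod_(i < I) P (X i @^-1` S i))%E.
    case: BM => _ _ _ /(_ I t); apply => //; first exact: ltW.
      move=> a b; elim: b => [|b IHb]; first by rewrite leqn0 => /eqP ->.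
      rewrite leq_eqVlt => /predU1P[->//|]; rewrite ltnS => /IHb /le_trans; apply.
      exact/ltW/tlt.
    by move=> i; exact: measurable_signed_side.
  have -> : (\prod_(i < I) P (X i @^-1` S i))%E = (\prod_(i < I) fine (P (X i @^-1` S i)))%:E.
    by rewrite -prodEFin; apply: eq_bigr => i _; rewrite fineK// fin_num_measure.
  rewrite lee_fin -[in leRHS](card_ord I) -prodr_const; apply: ler_prod => i _.
  rewrite fine_ge0//= -lee_fin fineK ?fin_num_measure//.
  rewrite /X bm_increment//; [|exact: ltW|exact: measurable_signed_side].
  rewrite tS sqrtrM ?(ltW (tpos i))// sqrtr_sqr (gtr0_norm v0).
  have s0 : 0 < Num.sqrt (t i) * v by rewrite mulr_gt0.
  have c0 : 0 < A * Num.sqrt (t i) by rewrite mulr_gt0.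
  apply: le_trans (signed_side_mass s s0 c0) _; rewrite lee_fin.
  rewrite (normal_peakZ s0) -/pk.
  have -> : pk / (Num.sqrt (t i) * v) * (A * Num.sqrt (t i)) = pk * A / v.
    by field; rewrite !lt0r_neq0.
  have : pk * A / v <= 4^-1 by rewrite ler_pdivrMr// /v; lra.
  lra.
have EP1 (C : set T) : measurable C -> bmf (\1_C : T -> R).
  by move=> mC; apply: bmf01 => // w; rewrite indicE; case: (_ \in _); rewrite ?lexx ?ler01.
have mE : measurable E.
  rewrite (_ : E = \bigcap_(i in [set j | (j <= I)%N]) ((B (t i) : T -> R) @^-1` signed_side s 0)).
    by apply: bigcap_measurable => [|i _]; [exists 0%N|apply: measurable_bm; exact: measurable_signed_side].
  apply/seteqP; split=> w /= h i; first by move=> iI; rewrite /signed_side /= oppr0; exact: h.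
  by move=> iI; have := h i iI; rewrite /signed_side /= oppr0.
exists E => //; split=> //; rewrite -(@fineK _ (P E)) ?fin_num_measure// lee_fin -EP_indic//.
apply: (@le_trans _ _ (EP P (fun w => \sum_(i < I) \1_(F i) w + \1_G w))).
  apply: le_EP; [exact: EP1| |].
    by apply: bmfD; [apply: bmf_sum => i|]; exact: EP1.
  move=> w; rewrite indicE; case: (boolP (w \in E)) => [|_]; last first.
    by rewrite addr_ge0// sumr_ge0.
  rewrite inE => /EFG[[i iI Fi]|Gw].
    rewrite (bigD1 (Ordinal iI))//= indicE mem_set// -addrA lerDl addr_ge0//.
    by rewrite sumr_ge0.
  by rewrite [\1_G w]indicE mem_set// lerDr sumr_ge0.
rewrite EPD; [|by apply: bmf_sum => i; exact: EP1|exact: EP1].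
rewrite EP_sum; last by move=> i; exact: EP1.
have : EP P \1_G <= kap / 2.
  by rewrite EP_indic// (le_trans _ hI)// -lee_fin fineK ?fin_num_measure.
have : \sum_(i < I) EP P (\1_(F i)) <= kap / 2.
  apply: (@le_trans _ _ (\sum_(i < I) kap / 2 / I.+1%:R)).
    apply: ler_sum => i _; rewrite EP_indic// /F bm_tail//=.
    have -> : kap / 2 / I.+1%:R = kap / 4 / I.+1%:R + kap / 4 / I.+1%:R by field; exact: lt0r_neq0.
    by move: (kap / 4 / _) hA1 hA2 => q; move: (Phi 1 A) (Phi 1 (- A)) => x y; lra.
  rewrite sumr_const card_ord -[leLHS]mulr_natl mulrA ler_pdivrMr// mulrC ler_pM2l//.
  by rewrite ler_nat.
lra.
Qed.

End no_touching.

(** * Continuity of the straddling excursion *)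

Section good_paths.
Context {R : realType}.
Variable K : nat.
Hypothesis K1 : (1 <= K)%N.
Implicit Types (f y : R -> R).

Let KR : 1 <= K%:R :> R. Proof. by rewrite ler1n. Qed.

Lemma path_within f (a b : R) : cpath K f -> 0 <= a -> b <= K%:R -> {within `[a, b], continuous f}.
Proof.
move=> [cf _] a0 bK; apply: continuous_subspaceW cf => x /=.
by rewrite !in_itv/= => /andP[ax xb]; rewrite (le_trans a0)//= (le_trans xb).
Qed.

Lemma zero_between f (a b : R) : cpath K f -> 0 <= a -> a <= b -> b <= K%:R -> f a * f b <= 0 ->
  exists2 c, a <= c <= b & f c = 0.
Proof.
move=> pf a0 ab bK ff; have := @IVT R f a b 0 ab (path_within pf a0 bK).
case.
  rewrite ge_min le_max; case: (ltP 0 (f a)) => fa; case: (ltP 0 (f b)) => fb; rewrite ?orbT ?(ltW fa) ?(ltW fb) ?orbT//.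
    by have := mulr_gt0 fa fb; lra.
  have [->|fa0] := eqVneq (f a) 0; first by rewrite lexx.
  have [->|fb0] := eqVneq (f b) 0; first by rewrite lexx orbT.
  have : 0 < f a * f b by rewrite nmulr_rgt0 ?lt_neqAle ?fa0 ?fb0.
  by lra.
by move=> c; rewrite in_itv/= => cab fc; exists c.
Qed.

Lemma last_zero_spec f : cpath K f -> f 1 != 0 ->
  [/\ 0 <= last_zero_before1 f < 1, f (last_zero_before1 f) = 0 &
    forall t, last_zero_before1 f < t <= 1 -> 0 < f t * f 1].
Proof.
move=> pf f1; have [cf f0] := pf; rewrite /last_zero_before1; set Z := [set t | _]; set g := sup Z.
have Z0 : Z 0 by split; rewrite ?lexx ?ler01.
have ubZ : has_ubound Z by exists 1 => t [/andP[]].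
have supZ : has_sup Z by split=> //; exists 0.
have g0 : 0 <= g by apply: ub_le_sup.
have g1 : g <= 1 by apply: ge_sup; [exists 0|move=> t [/andP[]]].
have fg : f g = 0.
  apply/eqP; apply: contraT => fg; have e0 : 0 < `|f g| / 2 by rewrite divr_gt0 ?normr_gt0.
  have gK : `[0, K%:R]%classic g by rewrite /= in_itv/= g0 (le_trans g1).
  have [del del0 h] := within_eps cf gK e0.
  have [z [/andP[z0 z1] fz] gz] := sup_adherent del0 supZ.
  have zg : z <= g by apply: ub_le_sup => //; split=> //; rewrite z0.
  have := h z; rewrite /= in_itv/= z0 (le_trans z1)//= fz subr0 ger0_norm ?subr_ge0//.
  have gzd : g - z < del by rewrite -/g in gz; lra.
  by move=> /(_ isT gzd); lra.
have g1' : g < 1.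
  by rewrite lt_neqAle g1 andbT; apply: contra f1 => /eqP <-; rewrite fg.
split=> //; first by rewrite g0.
move=> t /andP[gt t1]; rewrite ltNge; apply/negP => ft.
have [c /andP[tc c1] fc] := zero_between pf (le_trans g0 (ltW gt)) t1 KR ft.
have : c <= g by apply: ub_le_sup => //; split=> //; rewrite c1 andbT (le_trans g0)// (le_trans (ltW gt)).
by lra.
Qed.

Lemma first_zero_lt f (t : R) : 1 <= t -> t < first_zero_after1 f -> f t != 0.
Proof.
move=> t1; apply: contraTneq => ft; rewrite -leNgt; apply: ge_inf; last by split.
by exists 1 => s [].
Qed.

Lemma first_zero_spec f (z : R) : cpath K f -> f 1 != 0 -> 1 <= z <= K%:R -> f z = 0 ->
  [/\ 1 < first_zero_after1 f <= z, f (first_zero_after1 f) = 0 &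
    forall t, 1 <= t < first_zero_after1 f -> 0 < f t * f 1].
Proof.
move=> pf f1 /andP[z1 zK] fz; have [cf f0] := pf.
rewrite /first_zero_after1; set Z := [set t | _]; set g := inf Z.
have Zz : Z z by [].
have lbZ : has_lbound Z by exists 1 => t [].
have infZ : has_inf Z by split=> //; exists z.
have g1 : 1 <= g by apply: lb_le_inf; [exists z|move=> t []].
have gz : g <= z by apply: ge_inf.
have fg : f g = 0.
  apply/eqP; apply: contraT => fg; have e0 : 0 < `|f g| / 2 by rewrite divr_gt0 ?normr_gt0.
  have gK : `[0, K%:R]%classic g by rewrite /= in_itv/= (le_trans gz)// andbT; lra.
  have [del del0 h] := within_eps cf gK e0.
  have [s [s1 fs] sg] := inf_adherent del0 infZ.
  have [sz|zs] := leP s z.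
    have gs : g <= s by apply: ge_inf.
    have := h s; rewrite /= in_itv/= (le_trans sz)// andbT fs subr0 distrC ger0_norm ?subr_ge0//.
    have -> : 0 <= s by lra.
    have sgd : s - g < del by rewrite -/g in sg; lra.
    by move=> /(_ isT sgd); lra.
  have := h z; rewrite /= in_itv/= zK andbT fz subr0 distrC ger0_norm ?subr_ge0//.
  have -> : 0 <= z by lra.
  have zgd : z - g < del by rewrite -/g in sg; lra.
  by move=> /(_ isT zgd); lra.
have g1' : 1 < g.
  by rewrite lt_neqAle g1 andbT; apply: contra f1 => /eqP ->; rewrite fg.
split=> //; first by rewrite g1'.
move=> t /andP[t1 tg]; rewrite ltNge; apply/negP => ft.
rewrite mulrC in ft.
have [c /andP[c1 ct] fc] := zero_between pf ler01 t1 (le_trans (ltW tg) (le_trans gz zK)) ft.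
have : g <= c by apply: ge_inf.
by lra.
Qed.

(** Opposite signs arbitrarily close to the endpoints, outside the excursion, force zeros of every
    uniformly close path nearby; this is what makes the endpoints continuous at [f]. *)
Definition good f := [/\ f 1 != 0, exists2 t, 1 <= t & f t = 0,
  forall e, 0 < e -> exists t : R, [/\ 0 <= t, last_zero_before1 f - e < t,
    t < last_zero_before1 f & f t * f 1 < 0] &
  forall e, 0 < e -> exists t : R, [/\ first_zero_after1 f < t,
    t < first_zero_after1 f + e & f t * f 1 < 0]].

Lemma same_sign (a b c : R) : `|a - b| < `|a| -> 0 < a * c -> 0 < b * c.
Proof.
move=> ab ac; have c0 : 0 < `|c| by rewrite normr_gt0; apply: contraTneq ac => ->; rewrite mulr0 ltxx.
have h1 : `|a - b| * `|c| < a * c by rewrite -(gtr0_norm ac) normrM ltr_pM2r.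
have h2 : (a - b) * c <= `|a - b| * `|c| by rewrite -normrM ler_norm.
by rewrite mulrBl in h2; lra.
Qed.

Lemma opposite_sign (a b c : R) : `|a - b| < `|a| -> a * c < 0 -> b * c < 0.
Proof. by rewrite -oppr_gt0 -mulrN => h1 h2; rewrite -oppr_gt0 -mulrN; exact: same_sign h2. Qed.

Lemma opposite_zero y (a b c : R) : cpath K y -> 0 <= a -> a <= b -> b <= K%:R ->
  (y a * c) * (y b * c) < 0 -> exists2 z, a <= z <= b & y z = 0.
Proof.
move=> py a0 ab bK yab; apply: zero_between => //.
have c0 : c != 0 by apply: contraTneq yab => ->; rewrite !mulr0 ltxx.
have c2 : 0 < c * c by rewrite -expr2 lt0r sqr_ge0 andbT sqrf_eq0.
rewrite -(ler_pM2r c2) mul0r; have -> : y a * y b * (c * c) = (y a * c) * (y b * c) by ring.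
exact: ltW.
Qed.

Lemma abs_min f (a b : R) : cpath K f -> 0 <= a -> a <= b -> b <= K%:R ->
  (forall t, a <= t <= b -> f t != 0) ->
  exists2 mu : R, 0 < mu & forall t, a <= t <= b -> mu <= `|f t|.
Proof.
move=> pf a0 ab bK nz.
have cf : {within `[a, b], continuous (fun t => `|f t|)}.
  move=> t; apply: (@continuous_comp _ _ _ (f : subspace _ -> R) (fun x : R => `|x|)).
    exact: (path_within pf a0 bK).
  exact: norm_continuous.
have [c] := EVT_min ab cf; rewrite in_itv/= => cab cmin.
exists `|f c|; first by rewrite normr_gt0 nz.
by move=> t tab; apply: cmin; rewrite in_itv.
Qed.

Lemma abs_max f : cpath K f -> exists2 mu : R, 0 < mu & forall t, 0 <= t <= K%:R -> `|f t| <= mu.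
Proof.
move=> pf.
have cf : {within `[0, K%:R], continuous (fun t => `|f t|)}.
  move=> t; apply: (@continuous_comp _ _ _ (f : subspace _ -> R) (fun x : R => `|x|)).
    exact: (path_within pf _ _).
  exact: norm_continuous.
have [c _ cmax] := EVT_max (ler0n R K) cf.
exists (`|f c| + 1); first by rewrite ltr_wpDl.
by move=> t tK; rewrite (le_trans (cmax t _)) ?lerDl// in_itv.
Qed.

(** A path [y] close to [f] keeps the sign of [f] on the middle of the excursion and the opposite
    sign at [t1] and [t2]; the intermediate value theorem traps the endpoints of [y] in between. *)
Lemma endpoints_close f (e : R) : cpath K f -> good f -> first_zero_after1 f < K%:R -> 0 < e ->
  exists2 del : R, 0 < del & forall y, cpath K y -> close K f y del ->
  [/\ `|last_zero_before1 f - last_zero_before1 y| <= e,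
      `|first_zero_after1 f - first_zero_after1 y| <= e,
      0 <= last_zero_before1 y <= 1 & 1 <= first_zero_after1 y <= K%:R].
Proof.
move=> pf [f1 [z z1 fz] gl gr] dK e0.
have zK : exists2 z', 1 <= z' <= K%:R & f z' = 0.
  have haslb : has_lbound [set t : R | 1 <= t /\ f t = 0] by exists 1 => t [].
  have infZ : has_inf [set t : R | 1 <= t /\ f t = 0] by split=> //; exists z.
  have dK0 : 0 < K%:R - first_zero_after1 f by rewrite subr_gt0.
  have [s [s1 fs] sK] := inf_adherent dK0 infZ; exists s => //.
  by rewrite s1 ltW//; move: sK; rewrite -/(first_zero_after1 f); lra.
case: zK => z' z'K fz'; have [/andP[g0 g1] fg gpos] := last_zero_spec pf f1.
have [/andP[d1 dz] fd dpos] := first_zero_spec pf f1 z'K fz'.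
move: gl gr; set g := last_zero_before1 f in g0 g1 fg gpos *.
set d := first_zero_after1 f in dK d1 dz fd dpos * => gl gr.
(* This keeps [g + e1 < 1 < d - e1], so that the zeros found lie on the right side of time 1, and
   [d + e1 <= K]. *)
pose e1 := Num.min (Num.min e ((1 - g) / 2)) (Num.min ((d - 1) / 2) (K%:R - d)).
have e10 : 0 < e1 by rewrite !lt_min e0 !divr_gt0//; lra.
have [le1 le2 le3 le4] : [/\ e1 <= e, e1 <= (1 - g) / 2, e1 <= (d - 1) / 2 & e1 <= K%:R - d].
  by rewrite /e1 !ge_min !lexx !orbT.
have [t1 [t10 t1g t1g' ft1]] := gl _ e10.
have [t2 [t2d t2d' ft2]] := gr _ e10.
have mid t : g + e1 <= t <= d - e1 -> 0 < f t * f 1.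
  move=> /andP[tg td]; have [t1'|t1'] := leP t 1; first by apply: gpos; rewrite t1' andbT; lra.
  by apply: dpos; rewrite ltW//=; lra.
have [] := @abs_min f (g + e1) (d - e1) pf; [lra|lra|lra| |].
  by move=> t /mid; apply: contraTneq => ->; rewrite mul0r ltxx.
move=> mu mu0 hmu.
have at1 : 0 < `|f t1| by rewrite normr_gt0; apply: contraTneq ft1 => ->; rewrite mul0r ltxx.
have at2 : 0 < `|f t2| by rewrite normr_gt0; apply: contraTneq ft2 => ->; rewrite mul0r ltxx.
pose del := Num.min mu (Num.min `|f t1| `|f t2|) / 2.
have m0 : 0 < Num.min mu (Num.min `|f t1| `|f t2|) by rewrite !lt_min mu0 at1.
have del0 : 0 < del by rewrite divr_gt0.
have [dmu d1' d2'] : [/\ del < mu, del < `|f t1| & del < `|f t2|].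
  have : del < Num.min mu (Num.min `|f t1| `|f t2|) by rewrite /del; lra.
  by rewrite !lt_min => /and3P[].
exists del => // y py fy.
have mid' t : g + e1 <= t <= d - e1 -> 0 < y t * f 1.
  move=> tt; apply: same_sign (mid t tt); apply: le_lt_trans (fy t _) _.
    by case/andP: tt => ? ?; apply/andP; split; lra.
  exact: lt_le_trans (hmu t tt).
have yt1 : y t1 * f 1 < 0.
  apply: opposite_sign ft1; apply: le_lt_trans (fy t1 _) _ => //.
  by rewrite t10 /=; lra.
have yt2 : y t2 * f 1 < 0.
  apply: opposite_sign ft2; apply: le_lt_trans (fy t2 _) _ => //.
  by apply/andP; split; lra.
have ge1 : 0 < y (g + e1) * f 1 by apply: mid'; apply/andP; split; lra.
have de1 : 0 < y (d - e1) * f 1 by apply: mid'; apply/andP; split; lra.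
clear del m0 del0 dmu d1' d2' fy at1 at2 mu mu0 hmu mid ft1 ft2 gl gr fd fg gpos dpos dz z'K fz'.
clearbody e1.
have [|||z1' /andP[z1a z1b] yz1] := opposite_zero (a := t1) (b := g + e1) (c := f 1) py t10.
- by lra.
- by lra.
- by rewrite nmulr_rlt0.
have [||||z2' /andP[z2a z2b] yz2] := opposite_zero (a := d - e1) (b := t2) (c := f 1) py.
- by lra.
- by lra.
- by lra.
- by rewrite pmulr_rlt0.
have ubG : has_ubound [set t : R | 0 <= t <= 1 /\ y t = 0] by exists 1 => t [/andP[]].
have lbD : has_lbound [set t : R | 1 <= t /\ y t = 0] by exists 1 => t [].
have Gge : z1' <= last_zero_before1 y by apply: ub_le_sup => //; split=> //; apply/andP; split; lra.
have Gle : last_zero_before1 y <= g + e1.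
  apply: ge_sup; first by exists z1'; split=> //; apply/andP; split; lra.
  move=> t [/andP[t0 t11] yt]; rewrite leNgt; apply/negP => gt.
  have : 0 < y t * f 1 by apply: mid'; apply/andP; split; lra.
  by rewrite yt mul0r ltxx.
have Dle : first_zero_after1 y <= z2' by apply: ge_inf => //; split=> //; lra.
have Dge : d - e1 <= first_zero_after1 y.
  apply: lb_le_inf; first by exists z2'; split=> //; lra.
  move=> t [t11 yt]; rewrite leNgt; apply/negP => gt.
  have : 0 < y t * f 1 by apply: mid'; apply/andP; split; lra.
  by rewrite yt mul0r ltxx.
clear mid' yt1 yt2 ge1 de1 yz1 yz2 ubG lbD.
by split; rewrite ?ler_norml; apply/andP; split; lra.
Qed.

Lemma straddling_close f (e : R) : cpath K f -> good f -> first_zero_after1 f < K%:R -> 0 < e ->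
  exists2 del : R, 0 < del & forall y, cpath K y -> close K f y del ->
  `|straddling_length f - straddling_length y| <= e /\
  forall x : R, 0 <= x <= 1 -> `|straddling_excursion f x - straddling_excursion y x| <= e.
Proof.
move=> pf gf dK e0; have [f1 [z z1 fz] gl gr] := gf.
have [/andP[g0 g1] fg gpos] := last_zero_spec pf f1.
have d1 : 1 <= first_zero_after1 f by apply: lb_le_inf; [exists z|move=> t []].
rewrite /straddling_length /straddling_excursion.
pose g := last_zero_before1 f; pose d := first_zero_after1 f; rewrite -/g -/d.
rewrite -/g in g0 g1; rewrite -/d in d1 dK.
have L0 : 0 < d - g by lra.
have [mu mu0 hmu] := abs_max pf.
pose rt (s : R) := (Num.sqrt s)^-1.
have rtc : rt s @[s --> d - g] --> rt (d - g).
  apply: cvgV; first by rewrite gt_eqF// sqrtr_gt0.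
  exact: sqrt_continuous.
have rt0 s : 0 <= rt s by rewrite invr_ge0 sqrtr_ge0.
pose e1 := Num.min 1 (e / (2 * mu)).
have e10 : 0 < e1 by rewrite lt_min ltr01 divr_gt0// mulr_gt0.
have me1 : mu * e1 <= e / 2.
  apply: (@le_trans _ _ (mu * (e / (2 * mu)))); first by rewrite ler_pM2l// ge_min lexx orbT.
  by rewrite le_eqVlt; apply/orP; left; apply/eqP; field; exact: lt0r_neq0.
have /cvgrPdist_le/(_ _ e10)[rho /= rho0 hrho] := rtc.
pose e2 := e / (4 * (rt (d - g) + 1)).
have r1 : 0 < rt (d - g) + 1 by rewrite ltr_wpDl.
have e20 : 0 < e2 by rewrite divr_gt0// mulr_gt0.
have e2r : (e2 + e2) * (rt (d - g) + 1) <= e / 2.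
  by rewrite le_eqVlt; apply/orP; left; apply/eqP; rewrite /e2; field; exact: lt0r_neq0.
have [del2 del20 hf] := heine (proj1 pf) e20.
pose e3 := Num.min (Num.min del2 (rho / 4)) (e / 2).
have e30 : 0 < e3 by rewrite !lt_min del20 !divr_gt0.
have [l1 l2 l3] : [/\ e3 <= del2, e3 <= rho / 4 & e3 <= e / 2] by rewrite /e3 !ge_min !lexx !orbT.
have [del3 del30 hy] := endpoints_close pf gf dK e30.
exists (Num.min del3 e2); first by rewrite lt_min del30.
move=> y py fy.
have fy3 : close K f y del3 by move=> t tK; apply: le_trans (fy t tK) _; rewrite ge_min lexx.
have fy2 : close K f y e2 by move=> t tK; apply: le_trans (fy t tK) _; rewrite ge_min lexx orbT.
have [] := hy y py fy3; rewrite -/g -/d.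
set g' := last_zero_before1 y; set d' := first_zero_after1 y => gg dd /andP[g'0 g'1] /andP[d'1 d'K].
move: (gg) (dd); rewrite !ler_norml => /andP[gg1 gg2] /andP[dd1 dd2].
have LL : `|(d - g) - (d' - g')| <= e3 + e3 by rewrite ler_norml; apply/andP; split; lra.
split; first by lra.
move=> x /andP[x0 x1].
pose u := g + x * (d - g); pose u' := g' + x * (d' - g'); rewrite -/u -/u'.
have x1' : 0 <= 1 - x by lra.
have conv (p q : R) : p + x * (q - p) = (1 - x) * p + x * q by ring.
have uK : 0 <= u <= K%:R.
  rewrite /u conv addr_ge0 ?mulr_ge0//=; last by lra.
  have : (1 - x) * g <= (1 - x) * K%:R by apply: ler_wpM2l => //; lra.
  have : x * d <= x * K%:R by apply: ler_wpM2l => //; lra.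
  by lra.
have u'K : 0 <= u' <= K%:R.
  rewrite /u' conv addr_ge0 ?mulr_ge0//=; last by lra.
  have : (1 - x) * g' <= (1 - x) * K%:R by apply: ler_wpM2l => //; lra.
  have : x * d' <= x * K%:R by apply: ler_wpM2l => //; lra.
  by lra.
have uu : `|u - u'| <= del2.
  apply: le_trans l1.
  have -> : u - u' = (1 - x) * (g - g') + x * (d - d') by rewrite /u /u'; ring.
  apply: le_trans (ler_normD _ _) _; rewrite !normrM (ger0_norm x0) (ger0_norm x1').
  have : (1 - x) * `|g - g'| <= (1 - x) * e3 by apply: ler_wpM2l.
  have : x * `|d - d'| <= x * e3 by apply: ler_wpM2l.
  by lra.
have ab : `| `|f u| - `|y u'| | <= e2 + e2.
  apply: le_trans (ler_dist_dist _ _) _; apply: le_trans (ler_distD (f u') _ _) _.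
  by apply: lerD; [exact: hf|exact: fy2].
have rr : `|rt (d - g) - rt (d' - g')| <= e1.
  apply: hrho; rewrite /ball /=; apply: le_lt_trans LL _; lra.
have rr1 : rt (d' - g') <= rt (d - g) + 1.
  have : e1 <= 1 by rewrite /e1 ge_min lexx.
  by move: rr; rewrite ler_norml => /andP[? ?]; lra.
rewrite -/(rt (d - g)) -/(rt (d' - g')).
set a := `|f u| in ab *; set b := `|y u'| in ab *; set p := rt (d - g) in rr rr1 e2r *.
set q := rt (d' - g') in rr rr1 *.
have -> : a * p - b * q = a * (p - q) + (a - b) * q by ring.
apply: le_trans (ler_normD _ _) _; rewrite !normrM.
have h1 : `|a| * `|p - q| <= mu * e1.
  by apply: ler_pM => //; rewrite /a normr_id; exact: hmu.
have h2 : `|a - b| * `|q| <= (e2 + e2) * (p + 1).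
  by apply: ler_pM => //; rewrite /q ger0_norm.
by lra.
Qed.

Lemma straddling_cont (phi : R -> R) (h : (R -> R) -> R) (m c : R) f :
  (forall x, 0 <= phi x <= 1) -> continuous phi -> (forall x, x <= 0 -> phi x = 0) ->
  (forall x, c <= x -> phi x = 0) -> c + 2 <= K%:R -> 0 <= c ->
  (forall e, 0 <= h e <= 1) -> 0 <= m -> lip 1 m h -> cpath K f -> good f ->
  cont_at (cpath K) K (fun f => phi (straddling_length f) * h (straddling_excursion f)) f.
Proof.
move=> phi01 cphi phi0 phic cK c0 h01 m0 lipL pf gf eps eps0.
have [dK|Kd] := ltP (first_zero_after1 f) K%:R.
  have eps2 : 0 < eps / 2 by rewrite divr_gt0.
  have /cvgrPdist_le/(_ _ eps2)[rho /= rho0 hrho] := cphi (straddling_length f).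
  pose e := Num.min (rho / 2) (eps / (2 * (m + 1))).
  have m1 : 0 < m + 1 by rewrite ltr_wpDl.
  have e0 : 0 < e by rewrite lt_min !divr_gt0// mulr_gt0.
  have [e1 e2] : e <= rho / 2 /\ e <= eps / (2 * (m + 1)) by rewrite /e !ge_min !lexx orbT.
  have me : m * e <= eps / 2.
    have : e * (2 * (m + 1)) <= eps by rewrite -ler_pdivlMr// mulr_gt0.
    by lra.
  have [del del0 hy] := straddling_close pf gf dK e0.
  exists del => // y py fy; have [hl hs] := hy y py fy.
  have h1 : `|phi (straddling_length f) - phi (straddling_length y)| <= eps / 2.
    by apply: hrho; rewrite /ball/=; apply: le_lt_trans hl _; lra.
  have h2 := lipL _ _ _ hs.
  have /andP[p0 p1] := phi01 (straddling_length f).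
  have /andP[q0 q1] := h01 (straddling_excursion y).
  set p := phi (straddling_length f) in h1 p0 p1 *; set p' := phi (straddling_length y) in h1 *.
  set q := h (straddling_excursion y) in h2 q0 q1 *; set q' := h (straddling_excursion f) in h2 *.
  have -> : p * q' - p' * q = p * (q' - q) + (p - p') * q by ring.
  apply: le_trans (ler_normD _ _) _; rewrite !normrM (ger0_norm p0) (ger0_norm q0).
  have : p * `|q' - q| <= 1 * `|q' - q| by apply: ler_wpM2r.
  have : `|p - p'| * q <= `|p - p'| * 1 by apply: ler_wpM2l.
  by lra.
(* Here the first zero of [f] after 1 is at least [K], and [phi] vanishes at [f]. Nearby paths have
   no zero in [1, K - 1/2]: their length is at least [c], or nonpositive if they have no zero after
   1, and [phi] vanishes again. *)
have lenf : c <= straddling_length f.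
  have [f1 _ _ _] := gf; have [/andP[_ g1] _ _] := last_zero_spec pf f1.
  by rewrite /straddling_length; lra.
rewrite phic//; have [||||mu mu0 hmu] := @abs_min f 1 (K%:R - 2^-1) pf; [lra|lra|lra| |].
  by move=> t /andP[t1 tK]; apply: first_zero_lt => //; lra.
exists (mu / 2); first by rewrite divr_gt0.
move=> y py fy.
have ynz t : 1 <= t <= K%:R - 2^-1 -> y t != 0.
  move=> /andP[t1 tK]; apply/eqP => yt.
  have : `|f t - y t| <= mu / 2 by apply: fy; apply/andP; split; lra.
  have : mu <= `|f t| by apply: hmu; rewrite t1.
  by rewrite yt subr0; lra.
suff -> : phi (straddling_length y) = 0 by rewrite !mul0r subrr normr0 ltW.
have ubG : has_ubound [set t : R | 0 <= t <= 1 /\ y t = 0] by exists 1 => t [/andP[]].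
have G0 : 0 <= last_zero_before1 y.
  by apply: ub_le_sup => //; case: py => _ ?; split=> //; rewrite lexx ler01.
have G1 : last_zero_before1 y <= 1.
  apply: ge_sup; last by move=> t [/andP[]].
  by case: py => _ ?; exists 0; split=> //; rewrite lexx ler01.
have [[z [z1 yz]]|noz] := pselect (exists z, 1 <= z /\ y z = 0).
  apply: phic; have : K%:R - 2^-1 <= first_zero_after1 y.
    apply: lb_le_inf; first by exists z.
    move=> t [t1 yt]; rewrite leNgt; apply/negP => tK.
    by have := ynz t; rewrite t1 ltW//= yt eqxx => /(_ isT).
  by rewrite /straddling_length; lra.
apply: phi0; rewrite /straddling_length /first_zero_after1.
rewrite (_ : [set t | _] = set0) ?inf0; first by lra.
by apply/seteqP; split=> // t ht; apply: noz; exists t.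
Qed.

End good_paths.

(** * Almost every Brownian path is good *)

Section good_almost_surely.
Context {d : measure_display} {T : measurableType d} {R : realType}.
Variable P : probability T R.
Variables (B : R -> {RV P >-> R}).
Hypothesis BM : standard_brownian_motion B.

Lemma nat_fraction (x y : R) : 0 <= x -> x < y ->
  exists a b : nat, [/\ (0 < a)%N, (0 < b)%N, x < a%:R / b%:R & a%:R / b%:R < y].
Proof.
move=> x0 xy; have yx : 0 < y - x by rewrite subr_gt0.
pose b := (Num.truncn (y - x)^-1).+1; have bR : 0 < b%:R :> R by rewrite ltr0n.
have by1 : b%:R^-1 < y - x.
  by rewrite -[ltRHS]invrK ltf_pV2 ?posrE ?invr_gt0//; exact: truncnS_gt.
have xb0 : 0 <= x * b%:R by rewrite mulr_ge0.
have /andP[h1 h2] := truncn_itv xb0.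
exists (Num.truncn (x * b%:R)).+1, b; split=> //; first by rewrite ltr_pdivlMr.
apply: (@le_lt_trans _ _ (x + b%:R^-1)); last by lra.
by rewrite -(@natr1 _ (Num.truncn _)) mulrDl mul1r lerD2r ler_pdivrMr.
Qed.

Lemma ae_no_touching : {ae P, forall w, forall (s : bool) (a b a' b' : nat),
  [&& (0 < a)%N, (0 < b)%N & a%:R / b%:R <= a'%:R / b'%:R :> R] ->
  ~ touches s (a%:R / b%:R) (a'%:R / b'%:R) (fun t => B t w)}.
Proof.
suff h s : {ae P, forall w, forall a b a' b' : nat,
    [&& (0 < a)%N, (0 < b)%N & a%:R / b%:R <= a'%:R / b'%:R :> R] ->
    ~ touches s (a%:R / b%:R) (a'%:R / b'%:R) (fun t => B t w)}.
  by apply: filterS2 (h true) (h false) => w h1 h2 [].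
do 4!apply/ae_foralln => ?.
case: and3P => [[a0 b0 ab]|_]; last exact: aeW.
by apply: filterS (no_touching BM s a0 b0 ab) => w.
Qed.

Lemma ae_bm1 : {ae P, forall w, B 1 w != 0}.
Proof.
suff h : P.-negligible [set w | B 1 w = 0].
  by apply: negligibleS h => w /= /negP; rewrite negbK => /eqP.
apply: negligible_small => e e0.
pose p : R := normal_peak 1; have p0 : 0 <= p by exact: normal_peak_ge0.
pose k := e / (2 * (p + 1)); have k0 : 0 < k by rewrite divr_gt0// mulr_gt0// ltr_wpDl.
exists ((fun w => B 1 w - B 0 w) @^-1` `[- k, k[%classic).
  by rewrite -[X in measurable X]setTI; apply: measurable_funB.
split=> [w /= Bw|]; first by rewrite in_itv/= Bw (bm0 BM) subr0 k0 oppr_le0 ltW.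
have kk : - k <= k by lra.
rewrite bm_increment// subr0 sqrtr1; apply: (@le_trans _ _ (Phi 1 k - Phi 1 (- k))%:E).
  by rewrite -Phi_diff.
rewrite lee_fin; apply: le_trans (Phi_lip ltr01 kk) _; rewrite -/p.
have : k * (2 * (p + 1)) = e by rewrite divfK// lt0r_neq0// mulr_gt0// ltr_wpDl.
by lra.
Qed.

Lemma ae_sign_after (s : bool) :
  {ae P, forall w, ~ forall t : R, 1 <= t -> 0 < (-1) ^+ s * B t w}.
Proof.
suff h : P.-negligible [set w | forall t : R, 1 <= t -> 0 < (-1) ^+ s * B t w].
  by apply: negligibleS h => w /= /contrapT.
apply: negligible_small => e e0; have [r [I [r1 h]]] := no_return BM s e0.
have [E mE [AE PE]] := h 1 ltr01; exists E => //; split=> // w Aw; apply: AE => i _.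
by apply: Aw; rewrite mul1r exprn_ege1// ltW.
Qed.

(** Since [r] and [I] do not depend on the first time, that time can be chosen so that the last of
    the geometric times is 1. *)
Lemma ae_sign_before (s : bool) :
  {ae P, forall w, ~ forall t : R, 0 < t <= 1 -> 0 < (-1) ^+ s * B t w}.
Proof.
suff h : P.-negligible [set w | forall t : R, 0 < t <= 1 -> 0 < (-1) ^+ s * B t w].
  by apply: negligibleS h => w /= /contrapT.
apply: negligible_small => e e0; have [r [I [r1 h]]] := no_return BM s e0.
have r0 : 0 < r by lra.
have rI : 0 < (r ^+ I)^-1 by rewrite invr_gt0 exprn_gt0.
have [E mE [AE PE]] := h _ rI; exists E => //; split=> // w Aw; apply: AE => i iI.
apply: Aw; rewrite mulr_gt0 ?exprn_gt0//= mulrC ler_pdivrMr ?exprn_gt0// mul1r.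
by rewrite ler_eXn2l.
Qed.

Lemma ae_and (A C : T -> Prop) : {ae P, forall w, A w} -> {ae P, forall w, C w} ->
  {ae P, forall w, A w /\ C w}.
Proof. by apply: filterS2. Qed.

Lemma ae_good : {ae P, forall w, good (fun t => B t w)}.
Proof.
have h1 := ae_and (ae_sign_after true) (ae_sign_after false).
have h2 := ae_and (ae_sign_before true) (ae_sign_before false).
have h3 := ae_and ae_bm1 ae_no_touching.
apply: filterS3 h1 h2 h3 => w [ap an] [bp bn] [B1 nt].
pose f t := B t w; rewrite -/f.
have pf K : cpath K f by exact: path_bm BM w.
have sgn (t : R) (s : bool) : s = (f 1 < 0) -> 0 < f t * f 1 -> 0 < (-1) ^+ s * f t.
  move=> ->; case: (ltP (f 1) 0) => [f1|f1]; first by rewrite nmulr_lgt0// (_ : (-1) ^+ true = -1 :> R)// mulN1r oppr_gt0.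
  by rewrite pmulr_lgt0 ?expr0 ?mul1r// lt_neqAle eq_sym B1.
have zafter : exists2 t, 1 <= t & f t = 0.
  apply: contrapT => noz.
  have pos t : 1 <= t -> 0 < f t * f 1.
    move=> t1; rewrite ltNge; apply/negP; rewrite mulrC => ft.
    pose K := (Num.truncn t).+1; have tK : t <= K%:R by exact/ltW/truncnS_gt.
    have [c /andP[c1 _] fc] := zero_between (pf K) ler01 t1 tK ft.
    by apply: noz; exists c.
  case: (boolP (f 1 < 0)) => f1.
    by apply: ap => t /pos; apply: (sgn t true); rewrite f1.
  by apply: an => t /pos; apply: (sgn t false); rewrite (negbTE f1).
have zbefore : exists2 t, 0 < t <= 1 & f t = 0.
  apply: contrapT => noz.
  have pos t : 0 < t <= 1 -> 0 < f t * f 1.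
    move=> /andP[t0 t1]; rewrite ltNge; apply/negP => ft.
    have [c /andP[c1 c2] fc] := zero_between (pf 1%N) (ltW t0) t1 (lexx _) ft.
    by apply: noz; exists c => //; rewrite c2 andbT (lt_le_trans t0).
  case: (boolP (f 1 < 0)) => f1.
    by apply: bp => t /pos; apply: (sgn t true); rewrite f1.
  by apply: bn => t /pos; apply: (sgn t false); rewrite (negbTE f1).
have [z z1 fz] := zafter.
pose K := (Num.truncn z).+1; have zK : 1 <= z <= K%:R by rewrite z1 ltW// truncnS_gt.
have [/andP[g0 g1] fg gpos] := last_zero_spec (leqnn 1) (pf 1%N) B1.
have [/andP[d1 dz] fd dpos] := first_zero_spec (pf K) B1 zK fz.
(* A positive rational time has to fit to the left of this zero. *)
have g0' : 0 < last_zero_before1 f.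
  have [t /andP[t0 t1] ft] := zbefore; apply: (lt_le_trans t0).
  by apply: ub_le_sup; [exists 1 => ? [/andP[]]|split=> //; rewrite ltW].
(* Rational times on either side of the zero reduce a touching on ]x, y[ to the countably many
   intervals excluded by [nt]. *)
have notouch (x y z' : R) : 0 <= x -> x < z' -> z' < y -> f z' = 0 ->
    (forall t, x < t < y -> 0 <= f t * f 1) -> False.
  move=> x0 xz zy fz' pos.
  have [a [b [a0 b0 xa az]]] := nat_fraction x0 xz.
  have [a' [b' [_ _ za ay]]] := nat_fraction (le_trans x0 (ltW xz)) zy.
  apply: (nt (f 1 < 0) a b a' b'); first by rewrite a0 b0/= ltW// (lt_trans az).
  split; last by exists z' => //; rewrite !ltW.
  move=> t /andP[t1 t2]; have := pos t; rewrite (lt_le_trans xa t1) (le_lt_trans t2 ay).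
  move=> /(_ isT); case: (ltP (f 1) 0) => f1; first by rewrite nmulr_lge0// (_ : (-1) ^+ true = -1 :> R)// mulN1r oppr_ge0.
  by rewrite pmulr_lge0 ?expr0 ?mul1r// lt_neqAle eq_sym B1.
split=> //.
- move=> e e0; apply: contrapT => no.
  apply: (notouch (Num.max 0 (last_zero_before1 f - e)) 1 (last_zero_before1 f)) => //.
  + by rewrite le_max lexx.
  + by rewrite gt_max g0'/=; lra.
  move=> t /andP[]; rewrite gt_max => /andP[t0 te] t1.
  have [tg|] := ltP t (last_zero_before1 f).
    rewrite leNgt; apply/negP => ft; apply: no; exists t; split=> //; exact: ltW.
  rewrite le_eqVlt => /predU1P[<-|gt]; first by rewrite fg mul0r.
  by apply/ltW/gpos; rewrite gt ltW.
- move=> e e0; apply: contrapT => no.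
  apply: (notouch 1 (first_zero_after1 f + e) (first_zero_after1 f)) => //.
  + by lra.
  move=> t /andP[t1 te].
  have [td|] := ltP (first_zero_after1 f) t.
    rewrite leNgt; apply/negP => ft; apply: no; exists t; split=> //.
  rewrite le_eqVlt => /predU1P[->|dt]; first by rewrite fd mul0r.
  by apply/ltW/dpos; rewrite dt ltW.
Qed.

End good_almost_surely.

(** * Uniform excursions *)

Section excursion_limit.
Context {d : measure_display} {T : measurableType d} {R : realType}.
Variable P : probability T R.
Variables (B : R -> {RV P >-> R}).
Hypothesis BM : standard_brownian_motion B.
Implicit Types (h : (R -> R) -> R) (phi : R -> R).

Let str w := straddling_excursion (fun t => B t w).
Let len w := straddling_length (fun t => B t w).

Lemma lip_depends h (m : R) : lip 1 m h -> depends_on_01 h.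
Proof.
move=> lh e e' ee; apply/eqP; rewrite -subr_eq0 -normr_le0 -(mulr0 m).
by apply: lh => x x01; rewrite ee// subrr normr0.
Qed.

Lemma good_length f : cpath 1 f -> good f -> 0 < straddling_length f :> R.
Proof.
move=> pf [f1 [z z1 fz] _ _]; have [/andP[_ g1] _ _] := last_zero_spec (leqnn 1) pf f1.
rewrite /straddling_length subr_gt0; apply: (lt_le_trans g1).
by apply: lb_le_inf; [exists z|move=> t []].
Qed.

Section one_window.
Variables (phi : R -> R) (c : R).
Hypotheses (phi01 : forall x, 0 <= phi x <= 1) (cphi : continuous phi).
Hypotheses (phi0 : forall x, x <= 0 -> phi x = 0) (phic : forall x, c <= x -> phi x = 0).
Hypothesis c0 : 0 <= c.

Let K := (Num.truncn (c + 2)).+1.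
Let cK : c + 2 <= K%:R. Proof. exact/ltW/truncnS_gt. Qed.

Section functional.
Variables (h : (R -> R) -> R) (m : R).
Hypotheses (h01 : forall e, 0 <= h e <= 1) (m0 : 0 <= m) (lh : lip 1 m h).

Let Psi f := phi (straddling_length f) * h (straddling_excursion f).

Let Psi01 f : 0 <= Psi f <= 1.
Proof.
have /andP[p0 p1] := phi01 (straddling_length f).
have /andP[q0 q1] := h01 (straddling_excursion f).
by rewrite /Psi mulr_ge0//= mulr_ile1.
Qed.

Let cPsi : {ae P, forall w, cont_at (cpath K) K Psi (fun t => B t w)}.
Proof.
apply: filterS (ae_good BM) => w gw.
by apply: (@straddling_cont R K _ phi h m c) => //; exact: path_bm BM w.
Qed.

Lemma aebmf_window : aebmf P (fun w => phi (len w) * h (str w)).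
Proof. by have [] := envelope_bm BM (ltn0Sn _) Psi01 cPsi. Qed.

Lemma window_donsker (e : R) : 0 < e -> \forall k \near \oo, \forall M \near \oo,
  `|\sum_(l < (K * k * M.*2).+1) straddle_weight (k * M.*2) phi (K * k * M.*2) l *
       Ex l (fun v => h (exc v)) - EP P (fun w => phi (len w) * h (str w))| <= e.
Proof.
move=> e0; have := donsker BM (ltn0Sn _) Psi01 cPsi e0.
move=> H; have k0 : \forall k \near \oo, (0 < k)%N by exists 1%N.
apply: filterS2 H k0 => k HM k0.
have M0 : \forall M \near \oo, (0 < M)%N by exists 1%N.
apply: filterS2 HM M0 => M; rewrite -/K => HM M0.
rewrite -Ew_straddling//.
- by rewrite muln_gt0 k0 double_gt0.
- by rewrite -mulnA leq_pmull.
- exact: lip_depends lh.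
Qed.

End functional.

(** One [k] must serve three functionals at once: the tested one, its modulus of continuity and the
    constant 1. *)
Lemma near_exists (A C D : nat -> nat -> Prop) :
  (\forall k \near \oo, \forall M \near \oo, A k M) ->
  (\forall k \near \oo, \forall M \near \oo, C k M) ->
  (\forall k \near \oo, \forall M \near \oo, D k M) ->
  exists2 k, (0 < k)%N & exists M0, forall M, (M0 <= M)%N -> [/\ A k M, C k M & D k M].
Proof.
move=> [k1 _ h1] [k2 _ h2] [k3 _ h3]; pose k := (k1 + k2 + k3).+1.
have [|M1 _ g1] := h1 k; first by rewrite /= /k; lia.
have [|M2 _ g2] := h2 k; first by rewrite /= /k; lia.
have [|M3 _ g3] := h3 k; first by rewrite /= /k; lia.
exists k => //; exists (M1 + M2 + M3)%N => M MM.
by split; [apply: g1|apply: g2|apply: g3]; rewrite /=; lia.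
Qed.

Lemma window_arith (x A e E1 Eh Eb S1 Sh Sb : R) : 0 <= x -> x <= 1 -> 0 <= A ->
  `|x * S1 - Sh| <= A * S1 + 4 * Sb -> `|Sh - Eh| <= e -> `|Sb - Eb| <= e -> `|S1 - E1| <= e ->
  `|x * E1 - Eh| <= A * E1 + 4 * Eb + (A + 6) * e.
Proof.
move=> x0 x1 A0 key Hh Hb H1.
have t1 : `|x * E1 - x * S1| <= e.
  rewrite -mulrBr normrM (ger0_norm x0) distrC -[leRHS]mul1r.
  by apply: ler_pM.
have t2 : A * S1 <= A * (E1 + e).
  by apply: ler_wpM2l => //; move: H1; rewrite ler_norml => /andP[_ ?]; lra.
move: key Hh Hb t1 t2; rewrite mulrDr (mulrDl A); move: (x * E1) (x * S1) (A * S1) (A * E1) (A * e).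
move=> a b c' f g; by rewrite !ler_norml; lra.
Qed.

(** For a large even [N], the scale of the walk is chosen so that the window of lengths starts just
    above [N]. Every length of nonzero weight is then within a factor [1 + eps] of [N], and [cmp]
    lets the expectation at [N] leave the sum. *)
Lemma window_limit h (m eta kap d0 eps c1 : R) (N0 : nat) (e : R) :
  (forall e, 0 <= h e <= 1) -> lip 1 m h -> 0 <= m -> 0 < eta -> 0 < kap -> 0 <= d0 -> 0 < eps -> 0 < c1 ->
  (forall N N' : nat, (N0 <= N)%N -> ~~ odd N -> ~~ odd N' -> (N <= N')%N ->
     N'%:R <= (1 + eps) * N%:R ->
     `|Ex N (fun v => h (exc v)) - Ex N' (fun v => h (exc v))| <=
     6 * m * eta + 3 * kap + 4 * Ex N' (fun v => beta d0 eta (exc v))) ->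
  (forall x, phi x != 0 -> c1 < x) -> c <= (1 + eps / 2) * c1 -> 0 < e ->
  exists N1, forall N, (N1 <= N)%N -> ~~ odd N ->
  `|Ex N (fun v => h (exc v)) * EP P (fun w => phi (len w)) - EP P (fun w => phi (len w) * h (str w))| <=
  (6 * m * eta + 3 * kap) * EP P (fun w => phi (len w)) +
  4 * EP P (fun w => phi (len w) * beta d0 eta (str w)) + (6 * m * eta + 3 * kap + 6) * e.
Proof.
move=> h01 lh m0 eta0 kap0 d00 eps0 c10 cmp phic1 cc1 e0.
set A := 6 * m * eta + 3 * kap.
have A0 : 0 <= A by rewrite addr_ge0 ?mulr_ge0// ltW.
have b01 f : 0 <= beta d0 eta f <= 1 by rewrite beta_ge0 ?beta_le1.
have lb := lip_beta d00 eta0.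
have eta2 : 0 <= 2 / eta by rewrite divr_ge0// ltW.
have one01 (f : R -> R) : (0 : R) <= 1 <= (1 : R) by rewrite ler01 lexx.
have lone : lip 1 0 (fun=> 1 : R) by move=> f f' s _; rewrite subrr normr0 mul0r.
have [k k0 [M0 hM]] := near_exists (window_donsker h01 m0 lh e0)
  (window_donsker b01 eta2 lb e0) (window_donsker one01 (lexx _) lone e0).
have kR : 0 < k%:R :> R by rewrite ltr0n.
(* As [M] varies, the left end of the window, [c1] times the scale [k * M.*2], moves in steps of
   [q], so it can be placed at most [q] above [N]. The half of [eps] that the width of the window
   leaves free absorbs this overshoot. *)
pose q : R := 2 * c1 * k%:R; have q0 : 0 < q by rewrite !mulr_gt0.
pose N1 := (Num.truncn (q * M0%:R + (1 + eps / 2) * q / (eps / 2))).+1.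
exists (maxn N0 N1).+1 => N; rewrite gtn_max => /andP[/ltnW N0N N1N'] Nev.
have N1N := ltnW N1N'; have N0' : (0 < N)%N by exact: leq_ltn_trans N1N'.
have NR : 0 < N%:R :> R by rewrite ltr0n.
have N1R : q * M0%:R + (1 + eps / 2) * q / (eps / 2) <= N%:R.
  by apply: (le_trans (ltW (truncnS_gt _))); rewrite ler_nat.
have s1 : 0 <= q * M0%:R by rewrite mulr_ge0// ltW.
have s2 : 0 <= (1 + eps / 2) * q / (eps / 2).
  by rewrite divr_ge0 ?mulr_ge0 ?addr_ge0 ?divr_ge0// ltW.
have Neps : (1 + eps / 2) * q <= eps / 2 * N%:R.
  rewrite [leRHS]mulrC -ler_pdivrMr ?divr_gt0//.
  by apply: le_trans N1R; rewrite lerDr.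
have NM : M0%:R <= N%:R / q.
  by rewrite ler_pdivlMr// mulrC; apply: le_trans N1R; rewrite lerDl.
pose M := (Num.truncn (N%:R / q)).+1.
have Nq0 : 0 <= N%:R / q by rewrite divr_ge0// ltW.
have /andP[Mlo Mhi] := truncn_itv Nq0; rewrite -/M in Mhi.
have MM0 : (M0 <= M)%N by rewrite -(ler_nat R) (le_trans NM)// ltW.
have Mlo' : M%:R <= N%:R / q + 1 by rewrite /M -(@natr1 _ (Num.truncn _)) lerD2r.
have nE : c1 * (k * M.*2)%:R = q * M%:R by rewrite -muln2 !natrM /q; ring.
have n1 : N%:R <= c1 * (k * M.*2)%:R.
  by rewrite nE mulrC -ler_pdivrMr// ltW.
have n2 : c1 * (k * M.*2)%:R <= N%:R + q.
  rewrite nE -lerBlDr -[X in _ - X](mulr1 q) -mulrBr mulrC -ler_pdivlMr// lerBlDr.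
  exact: Mlo'.
have [Hh Hb H1] := hM M MM0.
set n := (k * M.*2)%N in n1 n2 Hh Hb H1 *; set N' := (K * k * M.*2)%N in Hh Hb H1.
have nR : 0 < n%:R :> R by rewrite ltr0n /n muln_gt0 k0 double_gt0.
pose om l := straddle_weight n phi N' l.
have om0 l : 0 <= om l by apply: straddle_weight_ge0 => x; have /andP[] := phi01 x.
have oml l : om l != 0 -> [/\ ~~ odd l, (N < l)%N & l%:R <= (1 + eps) * N%:R :> R].
  move=> /straddle_weight_neq0[pl lev]; split => //.
    rewrite -(ltr_nat R) (le_lt_trans n1)// -ltr_pdivlMr//; exact: phic1.
  have : l%:R / n%:R <= c by rewrite leNgt; apply: contra pl => /ltW /phic ->.
  rewrite ler_pdivrMr// => /le_trans; apply.
  apply: (@le_trans _ _ ((1 + eps / 2) * (c1 * n%:R))); first by rewrite mulrA ler_pM2r.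
  apply: (@le_trans _ _ ((1 + eps / 2) * (N%:R + q))).
    by rewrite ler_pM2l// ltr_wpDr// divr_ge0// ltW.
  rewrite mulrDr; move: Neps; move: (_ * q) (N%:R) => Y Z Neps'.
  have -> : (1 + eps) * Z = (1 + eps / 2) * Z + eps / 2 * Z by field.
  by rewrite lerD2l.
have cst1 l : om l * Ex l (fun=> 1) = om l.
  have [->|/oml[lev Nl _]] := eqVneq (om l) 0; first by rewrite mul0r.
  by rewrite Ex_cst ?mulr1// (leq_ltn_trans _ Nl).
rewrite (eq_bigr (fun l : 'I_N'.+1 => om l)) in H1; last by move=> l _; exact: cst1.
have e1E : EP P (fun w => phi (len w) * 1) = EP P (fun w => phi (len w)).
  by congr EP; apply/funext => w; rewrite mulr1.
rewrite e1E in H1.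
set S1 := \sum_(l < N'.+1) om l in H1.
set Sh := \sum_(l < N'.+1) _ in Hh; set Sb := \sum_(l < N'.+1) _ in Hb.
have [EN0 EN1] : 0 <= Ex N (fun v => h (exc v)) /\ Ex N (fun v => h (exc v)) <= 1.
  split; [apply: Ex_ge0|apply: Ex_le1] => // v _ _.
    by have /andP[] := h01 (exc v).
  by have /andP[] := h01 (exc v).
have key : `|Ex N (fun v => h (exc v)) * S1 - Sh| <= A * S1 + 4 * Sb.
  rewrite /S1 /Sh mulr_sumr -sumrB; apply: le_trans (ler_norm_sum _ _ _) _.
  rewrite !mulr_sumr -big_split; apply: ler_sum => l _ /=; rewrite -/(om l).
  rewrite [Ex N _ * _]mulrC -mulrBr normrM (ger0_norm (om0 l)).
  have -> : A * om l + 4 * (om l * Ex l (fun v => beta d0 eta (exc v))) =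
    om l * (A + 4 * Ex l (fun v => beta d0 eta (exc v))) by ring.
  have [->|/oml[lev Nl lN]] := eqVneq (om l) 0; first by rewrite !mul0r.
  by apply: ler_wpM2l => //; apply: cmp => //; exact: ltnW.
exact: window_arith EN0 EN1 A0 key Hh Hb H1.
Qed.

End one_window.

(** A trapezoid supported on [I / r, (J + 1) / r]; those with J = I + 1 telescope into a partition
    of unity. *)
Definition cut (I J : nat) (r x : R) : R := clip (r * x - I%:R) - clip (r * x - J%:R).

Lemma clip_homo (x y : R) : x <= y -> clip x <= clip y.
Proof.
move=> xy; rewrite /clip ge_max !le_max lexx /= le_min !ge_min lexx /= xy.
by rewrite !orbT.
Qed.

Lemma cut01 I J r x : (I <= J)%N -> 0 <= cut I J r x <= 1.
Proof.
move=> IJ; have := clip_ge0 (r * x - J%:R); have := clip_le1 (r * x - I%:R).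
have : clip (r * x - J%:R) <= clip (r * x - I%:R) by apply: clip_homo; rewrite lerD2l lerN2 ler_nat.
by rewrite /cut; lra.
Qed.

Lemma continuous_cut I J r : continuous (cut I J r).
Proof.
move=> x; apply: cvgB; apply: (@continuous_comp _ _ _ (fun x : R => r * x - _) clip);
  [|exact: continuous_clip| |exact: continuous_clip];
  by apply: cvgB; [apply: cvgM; [exact: cvg_cst|exact: cvg_id]|exact: cvg_cst].
Qed.

Lemma cut_eq0 I J r x : 0 < r -> (I <= J)%N -> x <= I%:R / r \/ J.+1%:R / r <= x -> cut I J r x = 0.
Proof.
move=> r0 IJ; rewrite ler_pdivlMr// ler_pdivrMr// [x * r]mulrC /cut => -[h|h].
  have IJ' : I%:R <= J%:R :> R by rewrite ler_nat.
  by rewrite !clip_le0 ?subrr//; lra.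
have IJ' : I%:R <= J%:R :> R by rewrite ler_nat.
by move: h; rewrite -(@natr1 _ J) => h; rewrite !clip_ge1 ?subrr//; lra.
Qed.

Lemma sum_cut I J r x : (I <= J)%N ->
  \sum_(I <= i < J) cut i i.+1 r x = cut I J r x.
Proof.
move=> IJ; rewrite /cut -[RHS]opprB -(telescope_sumr (fun i => clip (r * x - i%:R)))//.
by rewrite -sumrN; apply: eq_bigr => i _; rewrite opprB.
Qed.

(** The plateau ends move away: the lower one, (I + 1) / (n + 1), to 0, and the upper one, at least
    n + 1, to infinity. *)
Lemma cut_cvg I x : 0 < x -> cut I (n.+1 * n.+1 + I) n.+1%:R x @[n --> \oo] --> (1 : R).
Proof.
move=> x0; apply/cvgrPdist_le => e e0.
exists (Num.truncn (x + (I%:R + 1) / x)).+1 => // n /= nn.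
have nR : x + (I%:R + 1) / x <= n.+1%:R.
  by apply: (le_trans (ltW (truncnS_gt _))); rewrite ler_nat leqW.
have n0 : 0 < n.+1%:R :> R by rewrite ltr0n.
have I0 : 0 <= (I%:R + 1) / x by rewrite divr_ge0 ?addr_ge0// ltW.
have h1 : I%:R + 1 <= n.+1%:R * x by rewrite -ler_pdivrMr//; lra.
have h2 : n.+1%:R * x <= n.+1%:R * n.+1%:R by rewrite ler_pM2l//; lra.
have h3 : 0 <= I%:R :> R by [].
rewrite /cut clip_ge1; last by lra.
rewrite clip_le0; last by rewrite natrD natrM; lra.
by rewrite subr0 subrr normr0 ltW.
Qed.

Lemma good_ae : {ae P, forall w, good (fun t => B t w) /\ 0 < len w}.
Proof.
apply: filterS (ae_good BM) => w gw; split=> //.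
by apply: good_length => //; exact: path_bm BM w.
Qed.

Lemma aebmf_cut h (m : R) (I J : nat) (r : R) : (I <= J)%N -> 0 < r ->
  (forall e, 0 <= h e <= 1) -> 0 <= m -> lip 1 m h ->
  aebmf P (fun w => cut I J r (len w) * h (str w)).
Proof.
move=> IJ r0 h01 m0 lh; apply: (@aebmf_window (cut I J r) (J.+1%:R / r) _ _ _ _ _ h m) => //.
- by move=> x; exact: cut01.
- exact: continuous_cut.
- by move=> x x0; apply: cut_eq0 => //; left; rewrite (le_trans x0)// divr_ge0// ltW.
- by move=> x x0; apply: cut_eq0 => //; right.
- by rewrite divr_ge0// ltW.
Qed.

Lemma lip_one : lip 1 0 (fun=> 1 : R).
Proof. by move=> f f' s _; rewrite subrr normr0 mul0r. Qed.

Lemma one01 (f : R -> R) : (0 : R) <= 1 <= (1 : R). Proof. by rewrite ler01 lexx. Qed.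

Lemma aebmf_cut1 (I J : nat) (r : R) : (I <= J)%N -> 0 < r ->
  aebmf P (fun w => cut I J r (len w)).
Proof.
move=> IJ r0; have := aebmf_cut IJ r0 one01 (lexx 0) lip_one.
by under eq_fun do rewrite mulr1.
Qed.

Lemma cut_total (I : nat) :
  EP P (fun w => cut I (n.+1 * n.+1 + I) n.+1%:R (len w)) @[n --> \oo] --> (1 : R).
Proof.
rewrite -[X in _ --> X](EP_cst P); apply: (aeEP_dominated (C := 1) _ _ _).2.
- by move=> n; apply: aebmf_cut1; rewrite ?leq_addl.
- move=> n w; have /andP[c0 c1] := cut01 n.+1%:R (len w) (leq_addl (n.+1 * n.+1) I).
  by rewrite ger0_norm.
- by apply: filterS good_ae => w [_ l0]; exact: cut_cvg.
Qed.

(** Without a window the functional is not covered by [straddling_cont]; it is the limit of windowed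
    ones because the length is almost surely positive. *)
Lemma aebmf_str h (m : R) : (forall e, 0 <= h e <= 1) -> 0 <= m -> lip 1 m h ->
  aebmf P (fun w => h (str w)).
Proof.
move=> h01 m0 lh; apply: (aeEP_dominated (C := 1)
  (f := fun n w => cut 0 (n.+1 * n.+1 + 0) n.+1%:R (len w) * h (str w)) _ _ _).1.
- by move=> n; apply: aebmf_cut lh.
- move=> n w; have /andP[c0 c1] := cut01 n.+1%:R (len w) (leq_addl (n.+1 * n.+1) 0).
  have /andP[q0 q1] := h01 (str w).
  by rewrite ger0_norm ?mulr_ge0// mulr_ile1.
- apply: filterS good_ae => w [_ l0]; rewrite -[X in _ --> X]mul1r.
  by apply: cvgM; [exact: cut_cvg|exact: cvg_cst].
Qed.

(** The straddling excursion of a good path is uniformly continuous, so its modulus vanishes.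
    Starting at 1/4 respects the bound on [d] in [exc_compare]. *)
Lemma beta_cvg (eta : R) w : 0 < eta -> good (fun t => B t w) ->
  beta (n.+4%:R^-1) eta (str w) @[n --> \oo] --> (0 : R).
Proof.
move=> eta0 gw; have L0 : 0 < len w by apply: good_length => //; exact: path_bm BM w.
have [f1 [z z1 fz] _ _] := gw.
have [/andP[g0 g1] _ _] := last_zero_spec (leqnn 1) (path_bm 1 BM w) f1.
have d1 : 1 <= first_zero_after1 (fun t => B t w) by apply: lb_le_inf; [exists z|move=> t []].
pose K := (Num.truncn (first_zero_after1 (fun t => B t w))).+1.
have dK : first_zero_after1 (fun t => B t w) <= K%:R by exact/ltW/truncnS_gt.
have sL : 0 < Num.sqrt (len w) by rewrite sqrtr_gt0.
apply/cvgrPdist_le => e e0.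
have ee : 0 < e * eta * Num.sqrt (len w) by rewrite !mulr_gt0.
have [del del0 osc] := heine (proj1 (path_bm K BM w)) ee.
exists (Num.truncn (len w / del)).+1 => // n /= nn.
have nR : len w / del <= n.+4%:R.
  by apply: (le_trans (ltW (truncnS_gt _))); rewrite ler_nat; apply: leq_trans nn _; rewrite -addn4 leq_addr.
have n0 : 0 < n.+4%:R :> R by rewrite ltr0n.
have n0' : 0 <= n.+4%:R^-1 :> R by rewrite invr_ge0.
rewrite sub0r normrN ger0_norm ?beta_ge0//.
apply: beta_le => // x y /andP[x0 x1] /andP[y0 y1] xy.
rewrite ge_min; apply/orP; right; rewrite ler_pdivrMr//.
rewrite /str /straddling_excursion -mulrBl normrM [`|_^-1|]gtr0_norm ?invr_gt0//.
rewrite ler_pdivrMr//; apply: le_trans (ler_dist_dist _ _) _.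
have inK (s : R) : 0 <= s -> s <= 1 -> 0 <= last_zero_before1 (fun t => B t w) +
    s * (first_zero_after1 (fun t => B t w) - last_zero_before1 (fun t => B t w)) <= K%:R.
  move=> s0 s1; have h1 : 0 <= s * len w by rewrite mulr_ge0// ltW.
  have h2 : s * len w <= len w by rewrite ler_piMl// ltW.
  by move: h1 h2; rewrite /len /straddling_length; lra.
apply: osc; [exact: inK|exact: inK|].
rewrite opprD addrACA subrr add0r -mulrBl normrM -/(straddling_length (fun t => B t w)) -/(len w).
rewrite (gtr0_norm L0) mulrC; apply: (@le_trans _ _ (len w * n.+4%:R^-1)).
  by rewrite ler_pM2l.
by rewrite ler_pdivrMr// mulrC -ler_pdivrMr.
Qed.

Lemma beta_small (eta e : R) : 0 < eta -> 0 < e -> exists2 d0 : R, 0 < d0 <= 4^-1 &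
  EP P (fun w => beta d0 eta (str w)) <= e.
Proof.
move=> eta0 e0.
have n0 n : 0 <= n.+4%:R^-1 :> R by rewrite invr_ge0.
have : EP P (fun w => beta (n.+4%:R^-1) eta (str w)) @[n --> \oo] --> (0 : R).
  rewrite -[X in _ --> X](EP_cst P); apply: (aeEP_dominated (C := 1) _ _ _).2.
  - move=> n; apply: (aebmf_str (m := 2 / eta)).
    + by move=> f; rewrite beta_ge0 ?beta_le1.
    + by rewrite divr_ge0// ltW.
    + exact: lip_beta.
  - by move=> n w; rewrite ger0_norm ?beta_ge0 ?beta_le1.
  - by apply: filterS good_ae => w [gw _]; exact: beta_cvg.
move=> /cvgrPdist_le/(_ e e0)[n _ /(_ n (leqnn n))/=]; rewrite sub0r normrN => h.
exists n.+4%:R^-1; last by apply: le_trans h; exact: ler_norm.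
by rewrite invr_gt0 ltr0n/= lef_pV2 ?posrE// ler_nat.
Qed.

Lemma aeEP_sum (s : seq nat) (F : nat -> T -> R) : (forall i, aebmf P (F i)) ->
  EP P (fun w => \sum_(i <- s) F i w) = \sum_(i <- s) EP P (F i).
Proof.
move=> aF; suff [] : aebmf P (fun w => \sum_(i <- s) F i w) /\
  EP P (fun w => \sum_(i <- s) F i w) = \sum_(i <- s) EP P (F i) by [].
elim: s => [|i s [as_ IHs]].
  under eq_fun do rewrite big_nil; rewrite big_nil EP_cst; split => //.
  exact: aebmf_cst.
under eq_fun do rewrite big_cons; rewrite big_cons aeEPD// IHs; split => //.
exact: aebmfD.
Qed.

Lemma combine_arith (x A X1 Xh Xb Eh e : R) : 0 <= x -> x <= 1 -> 0 <= A -> A <= e / 8 ->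
  1 - e / 16 <= X1 -> X1 <= 1 -> Xh <= Eh -> Eh <= Xh + (1 - X1) -> Xb <= e / 64 ->
  `|x * X1 - Xh| <= A * X1 + 4 * Xb + e / 16 -> `|x - Eh| <= e.
Proof.
move=> x0 x1 A0 A8 X11 X12 h1 h2 hb key.
have t1 : 0 <= x * (1 - X1) by rewrite mulr_ge0// subr_ge0.
have t2 : x * (1 - X1) <= 1 * (1 - X1) by apply: ler_wpM2r => //; rewrite subr_ge0.
have t3 : A * X1 <= A * 1 by apply: ler_wpM2l.
move: key t1 t2; rewrite mulrBr mulr1; move: (x * X1) (A * X1) t3 => a b t3.
by rewrite !ler_norml; lra.
Qed.

Lemma excursion_expectation_limit h (m e : R) : (forall e, 0 <= h e <= 1) -> 0 <= m -> lip 1 m h ->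
  0 < e -> exists N1, forall N, (N1 <= N)%N -> ~~ odd N ->
  `|Ex N (fun v => h (exc v)) - EP P (fun w => h (str w))| <= e.
Proof.
move=> h01 m0 lh e0; have m1 : 0 < m + 1 by rewrite ltr_wpDl.
pose eta := e / (96 * (m + 1)); have eta0 : 0 < eta by rewrite divr_gt0// mulr_gt0.
have meta : 6 * m * eta <= e / 16.
  have : eta * (96 * (m + 1)) = e by rewrite divfK// lt0r_neq0// mulr_gt0.
  lra.
pose kap := Num.min 1 (e / 48).
have kap01 : 0 < kap <= 1 by rewrite lt_min ltr01 divr_gt0//= ge_min lexx.
have kape : 3 * kap <= e / 16.
  have : kap <= e / 48 by rewrite ge_min lexx orbT.
  lra.
have [kap0 kap1] := andP kap01.
set A := 6 * m * eta + 3 * kap.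
have A0 : 0 <= A by apply: addr_ge0; apply: mulr_ge0; rewrite ?(ltW eta0) ?(ltW kap0)// mulr_ge0.
have A8 : A <= e / 8 by rewrite /A; lra.
have [d0 d01 hd0] : exists2 d0 : R, 0 < d0 <= 4^-1 & EP P (fun w => beta d0 eta (str w)) <= e / 64.
  by apply: beta_small => //; rewrite divr_gt0.
have [d00 d04] := andP d01.
have [eps eps0 [N0 cmp]] := exc_compare h01 lh m0 eta0 kap01 d01.
(* The window of index i covers lengths from i / r to (i + 2) / r, whose ratio is 1 + 2 / i;
   starting at 4 / eps makes it at most [1 + eps / 2]. *)
pose I := (Num.truncn (4 / eps)).+1.
have Ieps : 4 / eps <= I%:R by exact/ltW/truncnS_gt.
have e16 : 0 < e / 16 by rewrite divr_gt0.
(* The windows from [I] to [J] miss lengths of total mass at most [e / 16]. *)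
have /cvgrPdist_le/(_ _ e16)[n _ /(_ n (leqnn n))/=] := cut_total I.
set J := (n.+1 * n.+1 + I)%N; set r : R := n.+1%:R => /ler_normlW tot.
have r0 : 0 < r by rewrite ltr0n.
have IJ : (I <= J)%N by exact: leq_addl.
have JR : 0 < J%:R :> R by rewrite ltr0n.
(* Each of at most [J] windows contributes an error [(A + 6) * e'], together at most [e / 16]. *)
pose e' := e / 16 / (A + 6) / J%:R.
have A6 : 0 < A + 6 by rewrite ltr_wpDl.
have e'0 : 0 < e' by rewrite !divr_gt0.
have b01 f : 0 <= beta d0 eta f <= 1 by rewrite beta_ge0 ?beta_le1// ltW.
have eta2 : 0 <= 2 / eta by rewrite divr_ge0// ltW.
have lb := lip_beta (ltW d00) eta0.
have win i : exists N1, (I <= i)%N -> forall N, (N1 <= N)%N -> ~~ odd N ->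
  `|Ex N (fun v => h (exc v)) * EP P (fun w => cut i i.+1 r (len w)) -
    EP P (fun w => cut i i.+1 r (len w) * h (str w))| <=
  A * EP P (fun w => cut i i.+1 r (len w)) +
  4 * EP P (fun w => cut i i.+1 r (len w) * beta d0 eta (str w)) + (A + 6) * e'.
  have [Ii|_] := leqP I i; last by exists 0%N.
  have iR : 0 < i%:R :> R by rewrite ltr0n; exact: leq_trans Ii.
  have eps4 : 4 <= i%:R * eps.
    by rewrite -ler_pdivrMr// (le_trans Ieps)// ler_nat.
  have [||||||||N1 hN1] := @window_limit (cut i i.+1 r) (i.+2%:R / r) _ _ _ _ _ h m eta kap d0 eps
    (i%:R / r) N0 e' h01 lh m0 eta0 kap0 (ltW d00) eps0 (divr_gt0 iR r0) cmp.
  - by move=> x; exact: cut01.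
  - exact: continuous_cut.
  - by move=> x x0; apply: cut_eq0 => //; left; rewrite (le_trans x0)// divr_ge0// ltW.
  - by move=> x x0; apply: cut_eq0 => //; right.
  - by rewrite divr_ge0// ltW.
  - by move=> x; rewrite ltNge; apply: contra => xi; apply/eqP/cut_eq0 => //; left.
  - rewrite mulrA ler_pM2r ?invr_gt0// -addn2 natrD mulrDl mul1r lerD2l.
    by rewrite mulrAC ler_pdivlMr// mulrC; lra.
  - exact: e'0.
  by exists N1.
have [Nf hNf] := choice win.
exists (\sum_(I <= i < J) Nf i).+1 => N NN Nev.
have N0' : (0 < N)%N by exact: leq_trans NN.
have sumE : `|Ex N (fun v => h (exc v)) * EP P (fun w => cut I J r (len w)) -
    EP P (fun w => cut I J r (len w) * h (str w))| <=
  A * EP P (fun w => cut I J r (len w)) +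
  4 * EP P (fun w => cut I J r (len w) * beta d0 eta (str w)) + e / 16.
  have sE (g : T -> R) (C : forall i, aebmf P (fun w => cut i i.+1 r (len w) * g w)) :
      EP P (fun w => cut I J r (len w) * g w) =
      \sum_(I <= i < J) EP P (fun w => cut i i.+1 r (len w) * g w).
    by rewrite -aeEP_sum//; congr EP; apply/funext => w; rewrite -mulr_suml sum_cut.
  have s1E : EP P (fun w => cut I J r (len w)) =
      \sum_(I <= i < J) EP P (fun w => cut i i.+1 r (len w)).
    rewrite -aeEP_sum; last by move=> i; exact: aebmf_cut1.
    by congr EP; apply/funext => w; rewrite sum_cut.
  rewrite s1E !sE; [|by move=> i; exact: aebmf_cut lb|by move=> i; exact: aebmf_cut lh].
  rewrite mulr_sumr -sumrB; apply: le_trans (ler_norm_sum _ _ _) _.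
  have -> : e / 16 = \sum_(I <= i < J) (e / 16 / (J - I)%:R).
    rewrite sumr_const_nat -[RHS]mulr_natr divfK// pnatr_eq0 subn_eq0 -ltnNge.
    by rewrite /J -[X in (X < _)%N]add0n ltn_add2r muln_gt0.
  rewrite !mulr_sumr -!big_split; apply: ler_sum_nat => i /andP[Ii iJ] /=.
  apply: le_trans (hNf i Ii N _ Nev) _.
    apply: leq_trans (ltnW NN); rewrite (bigD1_seq i) ?mem_index_iota ?iota_uniq ?Ii//=.
    exact: leq_addr.
  rewrite lerD2l /e'; have -> : (A + 6) * (e / 16 / (A + 6) / J%:R) = e / 16 / J%:R.
    by field; rewrite !lt0r_neq0.
  rewrite ler_pM2l// lef_pV2 ?posrE ?ler_nat ?leq_subr ?ltr0n// subn_gt0.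
  by rewrite /J -[X in (X < _)%N]add0n ltn_add2r muln_gt0.
have cI w := cut01 r (len w) IJ.
have ah := aebmf_str h01 m0 lh; have ab := aebmf_str b01 eta2 lb.
have ac := aebmf_cut1 IJ r0; have ach := aebmf_cut IJ r0 h01 m0 lh.
have acb := aebmf_cut IJ r0 b01 eta2 lb.
apply: (combine_arith _ _ A0 A8 _ _ _ _ _ sumE).
- by apply: Ex_ge0 => // v _ _; have /andP[] := h01 (exc v).
- by apply: Ex_le1 => // v _ _; have /andP[] := h01 (exc v).
- by move: tot; rewrite /r; lra.
- rewrite -[leRHS](EP_cst P); apply: aele_EP => //; first exact: aebmf_cst.
  by apply: aeW => w; have /andP[] := cI w.
- apply: aele_EP => //; apply: aeW => w; rewrite ler_piMl//.
    by have /andP[] := h01 (str w).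
  by have /andP[] := cI w.
- rewrite -[X in _ + (X - _)](EP_cst P) -aeEPB//; last exact: aebmf_cst.
  have a1c : aebmf P (fun w => 1 - cut I J r (len w)) by apply: aebmfB => //; exact: aebmf_cst.
  rewrite -aeEPD//; apply: aele_EP => //; first exact: aebmfD.
  apply: aeW => w; have /andP[c0 c1] := cI w; have /andP[q0 q1] := h01 (str w).
  by move: (cut _ _ _ _) (h _) c0 c1 q0 q1 => x y; nra.
- apply: le_trans hd0; apply: aele_EP => //; apply: aeW => w; rewrite ler_piMl//.
    by have /andP[] := b01 (str w).
  by have /andP[] := cI w.
Qed.

End excursion_limit.

(** * Parking functions and excursions *)

Section parking_words.
Implicit Types (w u v : seq bool) (s : seq nat).

(* A letter [true] stands for a car, whose preference is one plus the number of
   letters [false] before it. *)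
Fixpoint dec (c : nat) w : seq nat :=
  if w is b :: w' then (if b then c :: dec c w' else dec c.+1 w') else [::].

(** Inverse of [dec] on sorted sequences: [N] is the length of the word, [c] the current spot, and
    down steps fill the word once the cars are exhausted. *)
Fixpoint enc (N c : nat) s : seq bool :=
  if N is N'.+1 then
    if s is x :: s' then
      if (x <= c)%N then true :: enc N' c s' else false :: enc N' c.+1 s
    else false :: enc N' c.+1 s
  else [::].

Lemma size_enc N c s : size (enc N c s) = N.
Proof.
elim: N c s => [|N IHN] c [|x s] //=; first by rewrite IHN.
by case: ifP => _ /=; rewrite IHN.
Qed.

Lemma size_dec c w : size (dec c w) = count id w.
Proof. by elim: w c => [|[] w IHw] c //=; rewrite IHw. Qed.

Lemma dec_cat c u v : dec c (u ++ v) = dec c u ++ dec (c + count negb u) v.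
Proof.
elim: u c => [|[] u IHu] c /=; first by rewrite addn0.
  by rewrite IHu add0n.
by rewrite IHu add1n addSnnS.
Qed.

Lemma dec_ge c w x : x \in dec c w -> (c <= x)%N.
Proof.
elim: w c => [|[] w IHw] c //=; last by move=> /IHw/ltnW.
by rewrite inE => /predU1P[->//|/IHw].
Qed.

Lemma dec_le c w x : x \in dec c w -> (x <= c + count negb w)%N.
Proof.
elim: w c => [|[] w IHw] c //=; last by move=> /IHw; rewrite addSnnS.
by rewrite inE => /predU1P[->|/IHw//]; rewrite leq_addr.
Qed.

Lemma sorted_dec c w : sorted leq (dec c w).
Proof.
elim: w c => [|[] w IHw] c //=.
by rewrite path_min_sorted ?IHw//; apply/allP => x /dec_ge.
Qed.

Lemma dec_inj c u v : size u = size v -> dec c u = dec c v -> u = v.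
Proof.
elim: u v c => [|a u IHu] [|b v] c //= [uv].
case: a; case: b => //; first by move=> [/(IHu _ _ uv) ->].
- move=> e; have : c \in dec c.+1 v by rewrite -e mem_head.
  by move=> /dec_ge; rewrite ltnn.
- move=> e; have : c \in dec c.+1 u by rewrite e mem_head.
  by move=> /dec_ge; rewrite ltnn.
- by move=> /(IHu _ _ uv) ->.
Qed.

(** The word needs one letter per car and one down step for each spot passed on the way from [c] to
    the upper bound [m] of the entries. *)
Lemma encK N c s m : sorted leq s -> (forall x, x \in s -> (c <= x <= m)%N) ->
  (size s + (m - c) <= N)%N -> dec c (enc N c s) = s.
Proof.
elim: N c s => [|N IHN] c [|x s] //=.
  by move=> _ _ h; apply: IHN => //=; lia.
move=> xs cm h; have /andP[cx xm] := cm x (mem_head _ _).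
case: (leqP x c) => xc /=.
  have -> : dec c (enc N c s) = s.
    apply: IHN; [exact: path_sorted xs| |by move: h; rewrite addSn ltnS].
    by move=> y ys; apply: cm; rewrite inE ys orbT.
  by congr (_ :: _); apply/eqP; rewrite eqn_leq cx xc.
apply: IHN => //=; last by lia.
move=> y; rewrite inE => /predU1P[->|ys]; first by rewrite xc.
have /andP[_ ->] : (c <= y <= m)%N by apply: cm; rewrite inE ys orbT.
by rewrite andbT (leq_trans xc)//; move: xs; rewrite (path_sortedE leq_trans) => /andP[/allP/(_ y ys)].
Qed.

Lemma count_dec c u v :
  count (leq^~ (c + count negb u)) (dec c (u ++ false :: v)) = count id u.
Proof.
rewrite dec_cat count_cat -(size_dec c u) /=.
have -> : count (leq^~ (c + count negb u)) (dec c u) = size (dec c u).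
  by apply/eqP; rewrite -all_count; apply/allP => x /dec_le.
have -> : count (leq^~ (c + count negb u)) (dec (c + count negb u).+1 v) = 0%N.
  apply/eqP; rewrite -leqn0 leqNgt -has_count; apply/hasPn => x /dec_ge /=.
  by rewrite -ltnNge.
by rewrite addn0.
Qed.

Lemma split_false v k : (k < count negb v)%N ->
  exists u r, v = u ++ false :: r /\ count negb u = k.
Proof.
elim: v k => [|[] v IHv] k //=.
  by rewrite add0n => /IHv[u [r [-> <-]]]; exists (true :: u), r.
case: k => [|k]; first by exists [::], v.
by rewrite add1n ltnS => /IHv[u [r [-> <-]]]; exists (false :: u), r.
Qed.

Lemma count_negb w : (count id w + count negb w = size w)%N.
Proof. by rewrite -(count_predC id w); congr addn; apply: eq_count. Qed.

(** The letters up to the k-th down step contain exactly the cars of preference at most [k]. This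
    identifies the heights of the path with the values of the parking process. *)
Lemma hgt_at v k : (k <= count negb v)%N ->
  let U := count (leq^~ k) (dec 1 v) in
  hgt (take (U + k).+1 (true :: v)) = 1 + U%:Z - k%:Z.
Proof.
case: k => [|k] kv /=.
  have -> : count (leq^~ 0%N) (dec 1 v) = 0%N.
    apply/eqP; rewrite -leqn0 leqNgt -has_count; apply/hasPn => x /dec_ge /=.
    by rewrite -ltnNge.
  by rewrite take0 hgt_cons hgt_nil.
have [u [r [-> uk]]] := split_false kv; rewrite -uk.
have -> : count (leq^~ (count negb u).+1) (dec 1 (u ++ false :: r)) = count id u.
  exact: count_dec 1 u r.
have us : size u = (count id u + count negb u)%N by rewrite count_negb.
have -> : (count id u + (count negb u).+1 = (size u).+1)%N by rewrite us addnS.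
rewrite -cat_rcons take_size_cat ?size_rcons// hgt_cons count_hgt size_rcons -cats1 count_cat.
by rewrite /= us; lia.
Qed.

End parking_words.

Arguments enc : simpl never.

(** * Increasing parking functions as positive excursions *)

Section parking_tuples.
Variable n : nat.
Hypothesis n0 : (0 < n)%N.
Implicit Types (p : n.-tuple 'I_n.+1) (w : seq bool).

Definition prefs p : seq nat := map val p.

Lemma card_tnth p (a : pred nat) : #|[pred i | a (tnth p i)]| = count a (prefs p).
Proof. by rewrite count_map -sum1_card -sum1_count big_tuple. Qed.

Lemma ipfP p : p \in increasing_parking_functions n <->
  [/\ forall x, x \in prefs p -> (0 < x)%N, sorted leq (prefs p) &
      forall k, (0 < k <= n)%N -> (k <= count (leq^~ k) (prefs p))%N].
Proof.
have sp : size (prefs p) = n by rewrite size_map size_tuple.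
rewrite inE; split.
  move=> /andP[/andP[/forallP h1 /forallP h2] /forallP h3]; split.
  - by move=> x /mapP[y /tnthP[i ->] ->]; exact: h1.
  - apply/(sortedP 0%N) => i; rewrite sp => iS.
    have iS' := ltnW iS.
    rewrite !(nth_map ord0) ?size_tuple//.
    have := forallP (h3 (Ordinal iS')) (Ordinal iS).
    by rewrite !(tnth_nth ord0)/= leqnSn.
  - move=> k /andP[k0 kn]; have kn' : (k < n.+1)%N by [].
    by have := h2 (Ordinal kn'); rewrite /= k0 (card_tnth p (leq^~ k)).
move=> [h1 h2 h3]; apply/andP; split; [apply/andP; split|].
- apply/forallP => i; apply: h1; apply: map_f; exact: mem_tnth.
- apply/forallP => k; apply/implyP => k0; rewrite (card_tnth p (leq^~ k)).
  by apply: h3; rewrite k0 /= -ltnS ltn_ord.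
- apply/forallP => i; apply/forallP => j; apply/implyP => ij.
  have := sorted_leq_nth leq_trans leqnn 0%N h2 i j.
  rewrite !inE sp !ltn_ord => /(_ isT isT ij).
  by rewrite !(nth_map ord0) ?size_tuple// !(tnth_nth ord0).
Qed.

(** The up step in front, balanced by one more down step at the end, makes the path strictly
    positive inside; [n] cars and [n.+1] down steps follow it. *)
Definition word_of p : seq bool := true :: enc n.*2.+1 1 (prefs p).

Lemma size_word_of p : size (word_of p) == n.*2.+2.
Proof. by rewrite /= size_enc. Qed.

Definition parking_of w : n.-tuple 'I_n.+1 :=
  [tuple inord (nth 0%N (dec 1 (behead w)) i) | i < n].

Lemma prefs_parking_of w : size (dec 1 (behead w)) = n ->
  (forall x, x \in dec 1 (behead w) -> (x <= n)%N) ->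
  prefs (parking_of w) = dec 1 (behead w).
Proof.
move=> sw wn; apply: (@eq_from_nth _ 0%N); first by rewrite size_map size_tuple.
move=> i; rewrite size_map size_tuple => i_n.
rewrite (nth_map ord0) ?size_tuple//.
have -> : nth ord0 (parking_of w) i = tnth (parking_of w) (Ordinal i_n) by rewrite (tnth_nth ord0).
by rewrite tnth_mktuple /= inordK// ltnS wn// mem_nth// sw.
Qed.

Lemma prefs_inj : injective prefs.
Proof. by move=> p q /(inj_map val_inj) pq; exact: val_inj. Qed.

Lemma word_count w : size w = n.*2.+1 -> hgt (true :: w) = 0 ->
  count id w = n /\ count negb w = n.+1.
Proof.
move=> sw; rewrite hgt_cons count_hgt sw; have := count_negb w; rewrite sw /=; lia.
Qed.

Lemma parking_of_ipf w : size w = n.*2.+2 -> pexc w ->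
  prefs (parking_of w) = dec 1 (behead w) /\
  parking_of w \in increasing_parking_functions n.
Proof.
case: w => // -[] // v [sv] pv; have [_ h0 hpos] := (pexcP _).1 pv.
have [ct cf] := word_count sv h0.
have park k : (0 < k <= n)%N -> (k <= count (leq^~ k) (dec 1 v))%N.
  move=> /andP[k0 kn]; have kf : (k <= count negb v)%N by rewrite cf leqW.
  have := hgt_at kf; set U := count _ _ => hU.
  have Un : (U <= n)%N by rewrite -ct -(size_dec 1); exact: count_size.
  (* Just after the k-th down step, strict positivity 1 + U - k > 0 is the parking condition U >=
     k. *)
  have := hpos (U + k).+1; rewrite hU /= sv => h; have : 0 < 1 + U%:Z - k%:Z.
    by apply: h; lia.
  lia.
have sz : size (dec 1 v) = n by rewrite size_dec.
have le_n x : x \in dec 1 v -> (x <= n)%N.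
  have := park n; rewrite n0 leqnn => /(_ isT) h.
  have : all (leq^~ n) (dec 1 v) by rewrite all_count eqn_leq count_size sz.
  by move=> /allP; exact.
have e := @prefs_parking_of (true :: v) sz le_n; split => //.
apply/ipfP; rewrite e /=; split=> //; last exact: sorted_dec.
by move=> x /dec_ge.
Qed.

Lemma word_of_pexc p : p \in increasing_parking_functions n ->
  pexc (word_of p) /\ dec 1 (behead (word_of p)) = prefs p.
Proof.
move=> /ipfP[h1 h2 h3]; have sp : size (prefs p) = n by rewrite size_map size_tuple.
have len x : x \in prefs p -> (x <= n)%N by move=> /mapP[y _ ->]; exact: (ltn_ord y).
have e : dec 1 (enc n.*2.+1 1 (prefs p)) = prefs p.
  apply: (@encK _ _ _ n) => //; last by rewrite sp; lia.
  by move=> x xp; rewrite h1// len.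
split=> //; apply/pexcP; rewrite /word_of; set v := enc _ _ _ in e *.
have sv : size v = n.*2.+1 by rewrite size_enc.
have ct : count id v = n by rewrite -(size_dec 1) e.
have cf : count negb v = n.+1 by have := count_negb v; rewrite sv ct; lia.
split=> //.
  by rewrite hgt_cons count_hgt sv ct /=; lia.
move=> [|j] //; rewrite /= ltnS sv => jn; rewrite hgt_cons count_hgt size_takel ?sv 1?ltnW//.
have sj : size (take j v) = j by rewrite size_takel// sv ltnW.
have cj := count_negb (take j v); rewrite sj in cj.
(* Later up steps only raise the path, so it suffices to use the parking condition at the last down
   step before [j]; [u] is the part preceding it. *)
case b : (count negb (take j v)) => [|k]; first by rewrite b in cj; rewrite /=; lia.
have [|u [r [ev uk]]] := @split_false (take j v) k; first by rewrite b.
have Uk : count (leq^~ k.+1) (prefs p) = count id u.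
  have <- : count (leq^~ k.+1) (dec 1 (u ++ false :: (r ++ drop j v))) = count id u.
    by rewrite -uk; exact: count_dec 1 u _.
  by rewrite -e -[in dec 1 v](cat_take_drop j v) ev -catA cat_cons.
have cu : (count id u <= count id (take j v))%N by rewrite ev count_cat leq_addr.
have kf : (k.+1 <= n.+1)%N by rewrite -b -cf -[in leqRHS](cat_take_drop j v) count_cat leq_addr.
have [kn|nk] := leqP k.+1 n.
  by have := h3 k.+1; rewrite kn Uk /= => /(_ isT); rewrite b in cj; rewrite /=; lia.
have : count (leq^~ k.+1) (prefs p) = n.
  apply/eqP; rewrite -[X in _ == X]sp -all_count; apply/allP => x /len.
  by move=> /leq_trans; apply; exact: ltnW.
by rewrite Uk; rewrite b in cj; lia.
Qed.

Lemma parking_word_sum {R : realType} (F : seq bool -> R) :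
  \sum_(t : n.*2.+2.-tuple bool | pexc t) F t =
  \sum_(p in increasing_parking_functions n) F (word_of p).
Proof.
rewrite (reindex_onto (fun p => Tuple (size_word_of p)) parking_of) /=; last first.
  move=> t pt; apply: val_inj => /=; have st := size_tuple t.
  have [e ip] := parking_of_ipf st pt; have [pw ew] := word_of_pexc ip.
  move: pt st e ip pw ew; case: (tval t) => // -[] // v _ [sv] e _ _ ew.
  congr (_ :: _); apply: (@dec_inj 1); first by rewrite size_enc.
  by rewrite ew e.
apply: eq_bigl => p; apply/idP/idP => [/andP[pw /eqP <-]|pA].
  by have [] := @parking_of_ipf (word_of p) (eqP (size_word_of p)) pw.
have [pw e] := word_of_pexc pA; apply/andP; split; first exact: pw.
apply/eqP/prefs_inj.
by have [-> _] := parking_of_ipf (eqP (size_word_of p)) pw.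
Qed.

Lemma Ex_parking {R : realType} (F : seq bool -> R) :
  Ex n.*2.+2 F = (\sum_(p in increasing_parking_functions n) F (word_of p)) /
    #|increasing_parking_functions n|%:R.
Proof.
have sumE (G : seq bool -> R) : Ew n.*2.+2 (fun w => (pexc w)%:R * G w) =
    (2 ^+ n.*2.+2)^-1 * \sum_(p in increasing_parking_functions n) G (word_of p).
  rewrite Ew_tuple -parking_word_sum [in RHS]big_mkcond; congr (_ * _).
  by apply: eq_bigr => t _; case: (pexc t); rewrite ?mul1r ?mul0r.
rewrite /Ex sumE; have -> : exc_mass n.*2.+2 = (2 ^+ n.*2.+2)^-1 * #|increasing_parking_functions n|%:R :> R.
  rewrite -sum1_card natr_sum -(sumE (fun=> 1)); apply: eq_Ew => w _.
  by rewrite mulr1.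
by rewrite -mulf_div mulfV ?mul1r// invr_eq0 expf_neq0// pnatr_eq0.
Qed.

(** * Uniform distance from the parking process to the rescaled excursion *)

Section distance.
Context {R : realType}.
Implicit Types (x eta del : R).

Lemma parking_cdfE p x : 0 <= x ->
  parking_cdf p x = (count (leq^~ (Num.truncn (n%:R * x))) (prefs p))%:R / n%:R :> R.
Proof.
move=> x0; rewrite /parking_cdf (card_tnth p (fun v => v%:R <= n%:R * x)).
congr (_%:R / _); apply: eq_count => v /=.
by rewrite truncn_ge_nat// mulr_ge0.
Qed.

(** Here [q] and [Q] are the square roots of 2n and 2n + 2, [y] is nx with integer part [k] and
    fractional part [t], [U] counts the cars of preference at most [k], and [H] is the rescaled
    height just after the k-th down step. The conclusions compare heights, then times. *)
Lemma distance_arith (H C q Q y t k U : R) : 1 <= q -> q <= Q -> Q ^+ 2 = q ^+ 2 + 2 ->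
  `|H| <= C -> H * Q = 1 + U - k -> y = k + t -> 0 <= t -> t <= 1 -> 0 <= k -> 2 * k <= q ^+ 2 ->
  `|(U - y) / q - H| <= (2 * C + 4) / q /\
  `|(U + k + 1) / Q ^+ 2 - y / (q ^+ 2 / 2)| <= (2 * C + 4) / q.
Proof.
move=> q1 qQ QQ HC HQ yE t0 t1 k0 kq.
have q0 : 0 < q by lra.
have Q0 : 0 < Q by lra.
have C0 : 0 <= C by apply: le_trans HC.
have q2 : q <= q ^+ 2 by rewrite expr2 ler_peMl// ltW.
have Qq : Q * q <= q ^+ 2 + 1.
  have := sqr_ge0 (Q - q); rewrite sqrrB QQ; lra.
split.
  have -> : (U - y) / q - H = (H * (Q - q) - (1 + t)) / q.
    by rewrite yE mulrBr HQ; field; exact: lt0r_neq0.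
  rewrite normrM [`|_^-1|]gtr0_norm ?invr_gt0// ler_pM2r ?invr_gt0//.
  apply: le_trans (ler_normB _ _) _; rewrite normrM (ger0_norm (_ : 0 <= Q - q)); last by lra.
  rewrite (ger0_norm (_ : 0 <= 1 + t)); last by lra.
  have Q1 : Q - q <= 1.
    rewrite -(ler_pM2r q0) mulrBl mul1r -expr2; lra.
  have : `|H| * (Q - q) <= C * 1 by apply: ler_pM => //; lra.
  lra.
have -> : U + k + 1 = 2 * k + H * Q by lra.
have -> : (2 * k + H * Q) / Q ^+ 2 - y / (q ^+ 2 / 2) =
    H / Q - (4 * k / (Q ^+ 2 * q ^+ 2) + 2 * t / q ^+ 2).
  rewrite yE; have -> : 4 * k / (Q ^+ 2 * q ^+ 2) = 2 * k * (Q ^+ 2 - q ^+ 2) / (Q ^+ 2 * q ^+ 2).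
    by rewrite QQ; congr (_ / _); ring.
  by field; rewrite !lt0r_neq0.
apply: le_trans (ler_normB _ _) _.
have h1 : `|H / Q| <= C / q.
  rewrite normrM [`|_^-1|]gtr0_norm ?invr_gt0//; apply: ler_pM => //.
    by rewrite invr_ge0 ltW.
  by rewrite lef_pV2 ?posrE.
have h2 : 4 * k / (Q ^+ 2 * q ^+ 2) <= 2 / q.
  have -> : 2 / q = 2 * q / q ^+ 2 by field; exact: lt0r_neq0.
  rewrite invfM mulrA ler_pM2r ?invr_gt0 ?exprn_gt0// ler_pdivrMr ?exprn_gt0//.
  apply: (@le_trans _ _ (2 * q ^+ 2)); first by lra.
  apply: (@le_trans _ _ (2 * Q ^+ 2)); first by lra.
  by rewrite -mulrA ler_pM2l// ler_peMl// sqr_ge0.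
have h3 : 2 * t / q ^+ 2 <= 2 / q.
  apply: ler_pM; rewrite ?mulr_ge0 ?invr_ge0 ?sqr_ge0//; first by lra.
  by rewrite lef_pV2 ?posrE ?exprn_gt0.
have h4 : 0 <= 4 * k / (Q ^+ 2 * q ^+ 2).
  by apply: divr_ge0; rewrite mulr_ge0 ?sqr_ge0.
have h5 : 0 <= 2 * t / q ^+ 2 by apply: divr_ge0; [rewrite mulr_ge0|rewrite sqr_ge0].
rewrite (ger0_norm (addr_ge0 h4 h5)).
have -> : (2 * C + 4) / q = C / q + C / q + 2 / q + 2 / q by field; exact: lt0r_neq0.
have : 0 <= C / q by rewrite divr_ge0// ltW.
lra.
Qed.

(** At time [s], just after the k-th down step, the excursion matches the process at [x] up to
    rounding. Since heights are O(sqrt n), cars and spots are balanced enough for [s] to be within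
    [del] of [x], and the modulus of continuity does the rest. *)
Lemma parking_close p eta del : p \in increasing_parking_functions n ->
  0 < eta -> 0 < del -> ~~ (1 <= beta del eta (exc (word_of p))) ->
  (2 * (eta * (del^-1 + 1)) + 4) / Num.sqrt n.*2%:R <= Num.min eta del ->
  forall x, 0 <= x <= 1 ->
    `|parking_process p x - exc (word_of p) x| <= 2 * eta.
Proof.
move=> pA eta0 del0 b1; rewrite le_min => /andP[small1 small2] x /andP[x0 x1].
have [pw ew] := word_of_pexc pA.
have nR : 0 < n%:R :> R by rewrite ltr0n.
set v := enc n.*2.+1 1 (prefs p) in ew; have sv : size v = n.*2.+1 by rewrite size_enc.
have ct : count id v = n by rewrite -(size_dec 1) ew size_map size_tuple.
have cf : count negb v = n.+1 by have := count_negb v; rewrite sv ct -addnn -addnS => /addnI.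
pose k := Num.truncn (n%:R * x); pose U := count (leq^~ k) (prefs p).
have y0 : 0 <= n%:R * x by rewrite mulr_ge0.
have /andP[ky yk] := truncn_itv y0; rewrite -/k -(@natr1 _ k) in ky yk.
have kn : (k <= n)%N by rewrite -(ler_nat R) (le_trans ky)// ler_piMr.
have Un : (U <= n)%N by rewrite /U -[X in (_ <= X)%N](size_tuple p) -(size_map val) count_size.
have hk : hgt (take (U + k).+1 (word_of p)) = 1 + U%:Z - k%:Z.
  by have := @hgt_at v k; rewrite cf ew => /(_ (leqW kn)).
pose q : R := Num.sqrt n.*2%:R; pose Q : R := Num.sqrt n.*2.+2%:R.
have q2 : q ^+ 2 = 2 * n%:R by rewrite sqr_sqrtr// -mul2n natrM.
have Q2 : Q ^+ 2 = 2 * n%:R + 2 by rewrite sqr_sqrtr// -addn2 natrD -mul2n natrM.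
have q1 : 1 <= q by rewrite -sqrtr1 ler_sqrt// ler1n double_gt0.
have qQ : q <= Q by rewrite ler_wsqrtr// ler_nat; exact: leq_trans (leqnSn _) (leqnSn _).
pose s : R := (U + k).+1%:R / n.*2.+2%:R.
have s01 : 0 <= s <= 1.
  rewrite divr_ge0//= ler_pdivrMr ?ltr0n// mul1r ler_nat ltnS -addnn.
  by rewrite leqW// leq_add.
have sw := eqP (size_word_of p).
have excs : exc (word_of p) s = (1 + U%:Z - k%:Z)%:~R / Q.
  by have := @exc_nat R (word_of p) (U + k).+1; rewrite sw => /(_ isT) ->; rewrite hk.
pose H := exc (word_of p) s.
have HC : `|H| <= eta * (del^-1 + 1) by have := beta_sup_bound (ltW del0) eta0 del0 b1 (exc0 (word_of p)) s01.
have HQ : H * Q = 1 + U%:R - k%:R.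
  rewrite /H excs divfK ?lt0r_neq0 ?(lt_le_trans ltr01)//; last by exact: le_trans qQ.
  by rewrite intrB intrD.
have QQ : Q ^+ 2 = q ^+ 2 + 2 by rewrite q2 Q2.
have [|||||d1 d2] := @distance_arith H _ q Q (n%:R * x) (n%:R * x - k%:R) k%:R U%:R q1 qQ QQ HC HQ.
- by rewrite addrC subrK.
- by lra.
- by lra.
- by [].
- by rewrite q2 ler_pM2l// ler_nat.
have q0 : 0 < q by lra.
have procE : parking_process p x = (U%:R - n%:R * x) / q.
  have sqE : Num.sqrt (n%:R / 2) = n%:R / q.
    apply: (mulIf (lt0r_neq0 q0)); rewrite divfK ?lt0r_neq0// -sqrtrM ?divr_ge0//.
    have -> : n%:R / 2 * n.*2%:R = n%:R ^+ 2 :> R by rewrite -mul2n natrM; field.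
    by rewrite sqrtr_sqr ger0_norm.
  rewrite /parking_process parking_cdfE// sqE -/k -/U; field.
  by rewrite !lt0r_neq0.
have sx : `|s - x| <= del.
  have e1 : s = (U%:R + k%:R + 1) / Q ^+ 2.
    by rewrite /s /Q sqr_sqrtr// -(@natr1 _ (U + k)) natrD.
  have e2 : x = n%:R * x / (q ^+ 2 / 2) by rewrite q2; field; exact: lt0r_neq0.
  by rewrite e1 [in X in `|X|]e2; exact: le_trans d2 small2.
have x01 : 0 <= x <= 1 by rewrite x0.
have /ltW h2 := beta_lt1 (ltW del0) eta0 b1 s01 x01 sx.
rewrite procE; apply: le_trans (ler_distD H _ _) _.
have h1 := le_trans d1 small1.
by move: h1 h2; rewrite -/q -/H; move: (`|_|) (`|_|) => a b; lra.
Qed.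

End distance.

End parking_tuples.

(** * The limit theorem *)

Section parking_average.
Context {R : realType}.

Definition parking_average (n : nat) (h : (R -> R) -> R) : R :=
  (\sum_(p in increasing_parking_functions n) h (parking_process p)) /
  #|increasing_parking_functions n|%:R.

(** If the set were empty, [Ex_parking] would give 0 for the expectation of the constant 1, which is
    1. *)
Lemma ipf_card_gt0 n : (0 < n)%N -> (0 < #|increasing_parking_functions n|)%N.
Proof.
move=> n0; rewrite lt0n; apply/eqP => c0; have := @Ex_parking n n0 R (fun=> 1).
rewrite Ex_cst//=; last by rewrite negbK odd_double.
by rewrite c0 invr0 mulr0 => /eqP; rewrite oner_eq0.
Qed.

Lemma parking_average_affine n (a b : R) h : (0 < n)%N ->
  parking_average n (fun f => b + a * h f) = b + a * parking_average n h.
Proof.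
move=> n0; rewrite /parking_average big_split/= mulrDl sumr_const -[b *+ _]mulr_natr mulfK.
  by rewrite -mulr_sumr mulrA.
by rewrite pnatr_eq0 -lt0n ipf_card_gt0.
Qed.

Lemma le_parking_average n h h' : (forall f, h f <= h' f) ->
  parking_average n h <= parking_average n h'.
Proof. by move=> hh; rewrite ler_wpM2r ?invr_ge0// ler_sum. Qed.

(** By [Ex_parking] both averages run over the same parking functions; those with a large modulus
    are paid for by [beta], the others by [parking_close]. *)
Lemma parking_average_close n h (m eta del : R) : (0 < n)%N -> (forall f, 0 <= h f <= 1) ->
  lip 1 m h -> 0 <= m -> 0 < eta -> 0 < del ->
  (2 * (eta * (del^-1 + 1)) + 4) / Num.sqrt n.*2%:R <= Num.min eta del ->
  `|parking_average n h - Ex n.*2.+2 (fun v => h (exc v))| <=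
  2 * m * eta + Ex n.*2.+2 (fun v => beta del eta (exc v)).
Proof.
move=> n0 h01 lh m0 eta0 del0 small.
have c0 : 0 < #|increasing_parking_functions n|%:R :> R by rewrite ltr0n ipf_card_gt0.
have evn : ~~ odd n.*2.+2 by rewrite /= negbK odd_double.
have <- : Ex n.*2.+2 (fun v => 2 * m * eta + beta del eta (exc v)) =
    2 * m * eta + Ex n.*2.+2 (fun v => beta del eta (exc v)).
  by rewrite ExD Ex_cst.
rewrite !Ex_parking// /parking_average -mulrBl normrM [`|_^-1|]gtr0_norm ?invr_gt0//.
rewrite ler_pM2r ?invr_gt0// -sumrB; apply: le_trans (ler_norm_sum _ _ _) _.
apply: ler_sum => p pA; have [b1|b1] := boolP (1 <= beta del eta (exc (word_of p))).
  have /andP[? ?] := h01 (parking_process p); have /andP[? ?] := h01 (exc (word_of p)).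
  apply: (@le_trans _ _ 1); first by rewrite ler_norml; apply/andP; split; lra.
  by rewrite (le_trans b1)// lerDr !mulr_ge0// ltW.
apply: (@le_trans _ _ (2 * m * eta)); last by rewrite lerDl beta_ge0// ltW.
have -> : 2 * m * eta = m * (2 * eta) by ring.
by apply: lh => x x01; exact: (parking_close n0 pA eta0 del0 b1 small x01).
Qed.

End parking_average.

Section parking_limit.
Context {d : measure_display} {T : measurableType d} {R : realType}.
Variable P : probability T R.
Variables (B : R -> {RV P >-> R}).
Hypothesis BM : standard_brownian_motion B.
Implicit Types (h : (R -> R) -> R).

Lemma parking_average_lip h (m e : R) : (forall f, 0 <= h f <= 1) -> 0 <= m -> lip 1 m h -> 0 < e ->
  \forall n \near \oo, `|parking_average n h - EP P (fun w => h (brownian_excursion B w))| <= e.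
Proof.
move=> h01 m0 lh e0; have m1 : 0 < m + 1 by rewrite ltr_wpDl.
pose eta := e / (8 * (m + 1)); have eta0 : 0 < eta by rewrite divr_gt0// mulr_gt0.
have meta : 2 * m * eta <= e / 4.
  have : eta * (8 * (m + 1)) = e by rewrite divfK// lt0r_neq0// mulr_gt0.
  lra.
have e8 : 0 < e / 8 by rewrite divr_gt0.
have e4 : 0 < e / 4 by rewrite divr_gt0.
have [del /andP[del0 _] hdel] := beta_small BM eta0 e8.
have b01 f : 0 <= beta del eta f <= 1 by rewrite beta_ge0 ?beta_le1// ltW.
have eta2 : 0 <= 2 / eta by rewrite divr_ge0// ltW.
have [N1 h1] := excursion_expectation_limit BM h01 m0 lh e4.
have [N2 h2] := excursion_expectation_limit BM b01 eta2 (lip_beta (ltW del0) eta0) e8.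
have mn0 : 0 < Num.min eta del by rewrite lt_min eta0.
have [N3 h3] := sqrt_ge_near ((2 * (eta * (del^-1 + 1)) + 4) / Num.min eta del).
exists (N1 + N2 + N3).+1 => // n /= nn; have n0 : (0 < n)%N by exact: leq_ltn_trans nn.
have evn : ~~ odd n.*2.+2 by rewrite /= negbK odd_double.
have [n1 n2 n3] : [/\ (N1 <= n.*2.+2)%N, (N2 <= n.*2.+2)%N & (N3 <= n.*2)%N].
  by clear -nn; split; lia.
have small : (2 * (eta * (del^-1 + 1)) + 4) / Num.sqrt n.*2%:R <= Num.min eta del.
  rewrite ler_pdivrMr ?sqrtr_gt0 ?ltr0n ?double_gt0// [leRHS]mulrC -ler_pdivrMr//.
  exact: h3.
have := parking_average_close n0 h01 lh m0 eta0 del0 small.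
have := h1 _ n1 evn; have := h2 _ n2 evn; move: hdel.
rewrite /brownian_excursion; move: (EP _ _) (EP _ _) (Ex _ _) (Ex _ _) (parking_average _ _).
move=> a b x y z; rewrite !ler_norml; lra.
Qed.

(** Parking processes have jumps, so these envelopes range over all functions instead of continuous
    paths. *)
Let anyfun (f : R -> R) := True.

Lemma parking_average_lower h (e : R) : (forall f, 0 <= h f <= 1) ->
  (forall f, cont_at anyfun 1 h f) -> 0 < e ->
  aebmf P (fun w => h (brownian_excursion B w)) /\
  \forall n \near \oo, EP P (fun w => h (brownian_excursion B w)) - e <= parking_average n h.
Proof.
move=> h01 ch e0.
have lh n : lip 1 n%:R (envelope anyfun 1 h n%:R).
  exact: (@lip_envelope _ anyfun 1 _ h01 _ (ler0n R n)).
have l01 n f : 0 <= envelope anyfun 1 h n%:R f <= 1 by exact: envelope01.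
have [ah] : aebmf P (fun w => h (brownian_excursion B w)) /\
    EP P (fun w => envelope anyfun 1 h n%:R (brownian_excursion B w)) @[n --> \oo] -->
    EP P (fun w => h (brownian_excursion B w)).
  apply: (aeEP_dominated (C := 1)) => [n|n w|].
  - exact: aebmf_str BM _ _ (l01 n) (ler0n R n) (lh n).
  - by have /andP[? ?] := l01 n (brownian_excursion B w); rewrite ger0_norm.
  - by apply: aeW => w; apply: envelope_cvg.
have e2 : 0 < e / 2 by rewrite divr_gt0.
move=> /cvgrPdist_le/(_ _ e2)[k _ /(_ k (leqnn k))/= hk]; split=> //.
apply: filterS (parking_average_lip (l01 k) (ler0n R k) (lh k) e2) => n hn.
have : parking_average n (envelope anyfun 1 h k%:R) <= parking_average n h.
  by apply: le_parking_average => f; exact: envelope_le_self.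
move: hk hn; move: (EP _ _) (EP _ _) (parking_average _ _) (parking_average _ _).
by move=> a b x y; rewrite !ler_norml; lra.
Qed.

Lemma parking_average_cvg h : (forall f, 0 <= h f <= 1) -> (forall f, cont_at anyfun 1 h f) ->
  aebmf P (fun w => h (brownian_excursion B w)) /\
  parking_average n h @[n --> \oo] --> EP P (fun w => h (brownian_excursion B w)).
Proof.
move=> h01 ch; have [ah _] := parking_average_lower h01 ch ltr01; split=> //.
apply/cvgrPdist_le => e e0.
have h01' f : 0 <= 1 - h f <= 1 by have := h01 f; lra.
have ch' f : cont_at anyfun 1 (fun f => 1 - h f) f.
  move=> e1 e10; have [del del0 hd] := ch f e1 e10; exists del => // y _ fy.
  by rewrite opprD addrACA subrr add0r -normrN opprD !opprK; exact: hd.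
have [_ low] := parking_average_lower h01 ch e0.
have [_ up] := parking_average_lower h01' ch' e0.
have pos : \forall n \near \oo, (0 < n)%N by exists 1%N.
apply: filterS3 low up pos => n hl hu n0.
move: hu; have -> : (fun f => 1 - h f) = (fun f => 1 + -1 * h f).
  by apply/funext => f; rewrite mulN1r.
rewrite parking_average_affine// mulN1r aeEPB ?EP_cst//; last exact: aebmf_cst.
by move: hl; move: (EP _ _) (parking_average _ _) => a x; rewrite ler_norml; lra.
Qed.

(** The process takes finitely many values, each on a measurable event, so composing with an
    arbitrary [h] gives a simple function. *)
Lemma expectation_uniform (n : nat) dS (S : measurableType dS) (Q : probability S R)
    (X : S -> n.-tuple 'I_n.+1) h :
  uniform_law Q (increasing_parking_functions n) X ->
  ('E_Q[fun w => h (parking_process (X w))])%E = (parking_average n h)%:E.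
Proof.
move=> unif; pose F p w : R := h (parking_process p) * \1_(X @^-1` [set p]) w.
have mX p : measurable (X @^-1` [set p]) by have [] := unif p.
have bI p : bmf (\1_(X @^-1` [set p]) : S -> R).
  by apply: bmf01 => // w; rewrite indicE; case: (_ \in _); rewrite ?lexx ?ler01.
have bF p : bmf (F p) by apply: bmfM => //; exact: bmf_cst.
have -> : (fun w => h (parking_process (X w))) = (fun w => \sum_p F p w).
  apply/funext => w; rewrite (bigD1 (X w))//= big1 ?addr0.
    by rewrite /F indicE mem_set// mulr1.
  move=> p pX; rewrite /F indicE memNset ?mulr0//= => e.
  by rewrite e eqxx in pX.
rewrite expectation_EP; last exact: bmf_sum.
rewrite EP_sum//; congr _%:E; rewrite /parking_average mulr_suml [RHS]big_mkcond.
apply: eq_bigr => p _; rewrite EPZ// EP_indic//; have [_ ->] := unif p.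
by case: ifP; rewrite ?mulr0.
Qed.

Lemma uniform_continuous_at (h : {uniform` `[0, 1]%classic -> R} -> R) f :
  continuous h -> cont_at anyfun 1 (h : (R -> R) -> R) f.
Proof.
move=> ch e e0; have /cvgrPdist_le/(_ e e0) := ch f.
move=> /uniform_nbhs[E [entE sub]].
have [del del0 hE] : exists2 del : R, 0 < del & forall x y, `|x - y| < del -> E (x, y).
  move: entE; rewrite -entourage_ballE => -[del /= del0 dE]; exists del => // x y xy.
  exact: dE.
(* Halving turns the large inequality of [close] into the strict one of the entourage. *)
exists (del / 2); first by rewrite divr_gt0.
move=> y _ fy; apply: sub => x /=; rewrite in_itv/= => x01; apply: hE.
by apply: le_lt_trans (fy x x01) _; lra.
Qed.

End parking_limit.

Theorem proposition3 (R : realType)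
  (dS : nat -> measure_display) (S : forall n, measurableType (dS n))
  (Q : forall n, probability (S n) R)
  (pi_ : forall n, S n -> n.-tuple 'I_n.+1)
  (unif : forall n, (1 <= n)%N ->
     uniform_law (Q n) (increasing_parking_functions n) (pi_ n))
  (d : measure_display) (T : measurableType d) (P : probability T R)
  (B : R -> {RV P >-> R}) (BM : standard_brownian_motion B) :
  cvg_in_distribution (E := {uniform` `[0, 1]%classic -> R}) Q
    (fun n w => parking_process (pi_ n w) : R -> R)
    P (brownian_excursion B).
Proof.
move=> h ch [M hM].
(* The convergence is available for values in [0, 1]; an affine change with this constant, positive
   whatever the sign of [M], brings [h] there. *)
have M0 : 0 < `|M| + 1 by rewrite ltr_wpDl.
have hM' f : `|h f| < `|M| + 1.
  by rewrite (le_lt_trans (hM f))// (le_lt_trans (ler_norm M))// ltrDl.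
set c := `|M| + 1 in M0 hM'; have c2 : 0 < 2 * c by rewrite mulr_gt0.
pose h' (f : R -> R) := (h f + c) / (2 * c).
have hE f : h f = - c + 2 * c * h' f by rewrite /h' [_ * (_ / _)]mulrC divfK ?lt0r_neq0// addrC addrK.
have h'01 f : 0 <= h' f <= 1.
  have := hM' f; rewrite ltr_norml => /andP[h1 h2].
  by rewrite /h' divr_ge0 ?ler_pdivrMr ?mul1r//=; lra.
have ch' f : cont_at (fun=> True) 1 h' f.
  move=> e e0; have [del del0 hd] := uniform_continuous_at f ch (mulr_gt0 c2 e0).
  exists del => // y yT fy; rewrite /h' -mulrBl normrM [`|_^-1|]gtr0_norm ?invr_gt0//.
  by rewrite ler_pdivrMr// mulrC opprD addrACA subrr addr0; exact: hd.
have [ah lim] := parking_average_cvg BM h'01 ch'.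
have aff : aebmf P (fun w => - c + 2 * c * h' (brownian_excursion B w)).
  by apply: aebmfD; [|apply: aebmfM => //]; exact: aebmf_cst.
have -> : h \o brownian_excursion B = (fun w => - c + 2 * c * h' (brownian_excursion B w)).
  by apply/funext => w; exact: hE.
rewrite aebmf_expectation// aeEPD ?aeEPZ ?EP_cst//; last 2 first.
- exact: aebmf_cst.
- by apply: aebmfM => //; exact: aebmf_cst.
have lim' : ((- c + 2 * c * parking_average n h')%:E @[n --> \oo] -->
    (- c + 2 * c * EP P (fun w => h' (brownian_excursion B w)))%:E)%E.
  apply/fine_cvgP; split; first exact: nearW.
  by apply: cvgD; [|apply: cvgM => //]; exact: cvg_cst.
apply: cvg_trans lim'; apply: near_eq_cvg.
exists 1%N => // n /= n1.
rewrite (_ : _ \o _ = (fun w => (fun f => - c + 2 * c * h' f) (parking_process (pi_ n w)))); last first.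
  by apply/funext => w; exact: hE.
rewrite (expectation_uniform (fun f => - c + 2 * c * h' f) (unif n n1)).
by rewrite parking_average_affine.
Qed.
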